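(* Let $n\geq k\geq 5$ be integers, let $P_k$ denote the path on $k$ vertices, and let $\ell=\lfloor (k-1)/2\rfloor$. Then $$\mathrm{AR}(n,P_k)=\max\left\{\binom{k-2}{2}+1,\ \binom{\ell-1}{2}+(\ell-1)(n-\ell+1)+\epsilon\right\},$$ where $\epsilon=1$ if $k$ is odd and $\epsilon=2$ if $k$ is even.
   Context: A subgraph of an edge-colored graph is rainbow if all of its edges have distinct colors. For a graph $H$, the anti-Ramsey number $\mathrm{AR}(n,H)$ is the maximum number of colors in an edge-coloring of the complete graph $K_n$ such that $K_n$ contains no rainbow copy of $H$. *)

(* Defs.v *)
From mathcomp Require Import all_boot.
Set Implicit Arguments. Unset Strict Implicit. Unset Printing Implicit Defensive.

(* An edge-colouring of the complete graph K_n on vertex set 'I_n: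
   a colour (a natural number) for each unordered pair {u,v}, u <> v,
   modelled as a symmetric function; values on the diagonal are irrelevant. *)
Definition edge_coloring (n : nat) (c : 'I_n -> 'I_n -> nat) : Prop :=
  forall u v : 'I_n, c u v = c v u.

Definition colors_used (n : nat) (c : 'I_n -> 'I_n -> nat) : seq nat :=
  undup (flatten [seq [seq c u v | v <- filter (fun v => u != v) (enum 'I_n)] | u <- enum 'I_n]).

Definition num_colors (n : nat) (c : 'I_n -> 'I_n -> nat) : nat :=
  size (colors_used c).

Definition path_colors (n : nat) (c : 'I_n -> 'I_n -> nat) (s : seq 'I_n) : seq nat :=
  [seq c e.1 e.2 | e <- zip s (behead s)].

Definition has_rainbow_path (n k : nat) (c : 'I_n -> 'I_n -> nat) : Prop :=
  exists s : seq 'I_n, [/\ size s = k, uniq s & uniq (path_colors c s)].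

Definition is_AR_path (n k m : nat) : Prop :=
  (exists c : 'I_n -> 'I_n -> nat,
      [/\ edge_coloring c, (~ has_rainbow_path k c) & num_colors c = m]) /\
  (forall c : 'I_n -> 'I_n -> nat,
      edge_coloring c -> ~ has_rainbow_path k c -> num_colors c <= m).

(* Main.v *)
Require Import Defs.
From mathcomp Require Import all_boot zify.
Set Implicit Arguments. Unset Strict Implicit. Unset Printing Implicit Defensive.

(** Picking one edge of every colour gives a rainbow, hence P_k-free, graph E. Among these choices take one with as
    many connected pairs of vertices as possible.

    If E is disconnected, repeatedly delete the edges whose colour occurs on a pair crossing the current components.
    Maximality makes every deleted edge a bridge, so a graph F remains that has many components and none of whose
    colours crosses components; paths in two components of F can then be joined by a fresh colour. Glueing all
    components at one vertex yields a connected P_(k-1)-free graph, whose edges are counted by Kopylov's theorem.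

    If E is connected, Kopylov's theorem for P_k suffices unless some k - 2 vertices are almost complete, when all
    pairs not inside this set must have the same colour, or k = 2l + 2 and the (l+1)-core has at most l + 2 vertices.
    In the last case remove vertices of degree less than l. Either minimum degree l is reached on more than k vertices,
    or k vertices are left with almost as many edges as a graph without a spanning path can have. Both situations
    determine the graph so precisely that exchanging one edge for a suitable pair of the same colour creates a P_k.

    Kopylov's theorem follows from the lemma that, in an edge-maximal connected P_k-free graph, vertices of two sets
    with internal minimum degrees p and q are adjacent as soon as p + q >= k - 1. *)

(* [lia] compares atoms syntactically, so the spellings of the carriers of [finType]s and of their sets are
   identified first; boolean hypotheses that are not arithmetic are dropped, as [lia] would split on them. *)
Ltac flia :=
  try unfold reverse_coercion in *;
  repeat match goal with
  | |- context [Equality.sort (fintype_Finite__to__eqtype_Equality ?W)] =>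
      progress change (Equality.sort (fintype_Finite__to__eqtype_Equality W)) with (Finite.sort W)
  | H : context [Equality.sort (fintype_Finite__to__eqtype_Equality ?W)] |- _ =>
      progress change (Equality.sort (fintype_Finite__to__eqtype_Equality W)) with (Finite.sort W) in H
  | |- context [Finite.sort (finset_set_of__canonical__fintype_Finite ?W)] =>
      progress change (Finite.sort (finset_set_of__canonical__fintype_Finite W)) with (set_of W)
  | H : context [Finite.sort (finset_set_of__canonical__fintype_Finite ?W)] |- _ =>
      progress change (Finite.sort (finset_set_of__canonical__fintype_Finite W)) with (set_of W) in H
  end;
  repeat match goal with
  | H : is_true ?b |- _ =>
      lazymatch b with
      | leq _ _ => fail
      | andb _ _ => fail
      | orb _ _ => fail
      | ~~ leq _ _ => fail
      | eqn _ _ => fail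
      | @eq_op _ ?x _ => lazymatch type of x with nat => fail | _ => clear H end
      | ~~ @eq_op _ ?x _ => lazymatch type of x with nat => fail | _ => clear H end
      | _ => clear H
      end
  | H : ?P |- _ =>
      lazymatch P with
      | forall x : _, _ => lazymatch type of P with Prop => clear H end
      | ?x = _ => lazymatch type of x with nat => fail | _ => clear H end
      end
  end; lia.

(** For odd k = 2l + 1 Kopylov's theorem deletes vertices of degree at most l - 1, and l - 1 is the
    slope in n of the claimed bound. For k = 2l + 2 it only deletes vertices of degree at most l,
    and connected P_k-free graphs can indeed have more edges than the claimed number of colours. So
    path-freeness of a single rainbow graph is not enough, and the colouring has to be used again.
    The tool is the exchange: any pair can be added to a rainbow graph at the price of one edge g,
    which cannot be chosen. The case analyses on the position of g look for a path that survives its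
    loss. If E is disconnected, this obstacle is absent: the glued graph is P_(k-1)-free, k - 1 is
    2l or 2l + 1, and the slope is l - 1 for both parities. Deleting bridges does not decrease the
    number of components plus the number of edges, and glueing loses one vertex less than there are
    components; hence |E| is at most |F| plus the number of lost vertices minus 1. *)

(** Paths are assembled from [take], [drop] and [rev] pieces of other paths; comparing counts turns
    the absence of repetitions into linear arithmetic. *)
Lemma uniq_of_count (V : finType) (s t : seq V) :
  uniq t -> (forall p : pred V, count p s <= count p t) -> uniq s.
Proof.
move=> Ut le_st; apply: count_mem_uniq => x.
have := le_st (pred1 x); rewrite (count_uniq_mem x Ut) -(has_pred1 x s) has_count.
by case: (count_mem x s) => [|[|c]]; case: (x \in t).
Qed.

Section SeqFacts.
Variable T : Type.
Implicit Types (s t : seq T) (x : T).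

Lemma count_take_drop (U : Type) (p : pred U) i (s : seq U) :
  count p s = count p (take i s) + count p (drop i s).
Proof. by rewrite -count_cat cat_take_drop. Qed.

Lemma sorted_cat (e : rel T) x0 s t :
  sorted e s -> sorted e t -> (0 < size s -> 0 < size t -> e (last x0 s) (head x0 t)) ->
  sorted e (s ++ t).
Proof.
case: s => [|x s] //= ps pt h; rewrite cat_path ps /=.
by case: t pt h => [|y t] //= pt h; rewrite pt h.
Qed.

Lemma sorted_rev (e : rel T) s : symmetric e -> sorted e (rev s) = sorted e s.
Proof. by move=> es; rewrite rev_sorted; apply: eq_sorted => x y; rewrite es. Qed.

Lemma last_take x0 i s : i < size s -> last x0 (take i.+1 s) = nth x0 s i.
Proof.
by move=> lt_is; rewrite (last_nth x0) size_takel // -[_ :: _]cat1s nth_cat /= subn1 nth_take.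
Qed.

Lemma head_drop x0 i s : head x0 (drop i s) = nth x0 s i.
Proof. by rewrite -nth0 nth_drop addn0. Qed.

Lemma head_rev x0 s : head x0 (rev s) = last x0 s.
Proof. by case/lastP: s => [|s y] //; rewrite rev_rcons last_rcons. Qed.

Lemma last_rev x0 s : last x0 (rev s) = head x0 s.
Proof. by case: s => [|y s] //; rewrite rev_cons last_rcons. Qed.

Lemma count_nth_iota (p : pred T) x0 s :
  count p s = size [seq i <- iota 0 (size s) | p (nth x0 s i)].
Proof. by rewrite size_filter -[in LHS](mkseq_nth x0 s) /mkseq count_map. Qed.

End SeqFacts.

(** * Graphs as sets of pairs *)

Section Graph.
Variable V : finType.
Implicit Types (E H : {set {set V}}) (x y z : V) (s : seq V) (D R S W : {set V}).

Definition pairs_in D : {set {set V}} := [set e : {set V} | (e \subset D) && (#|e| == 2)].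
(** [[set x; x]] is a singleton, which an arbitrary [E] may contain; so loops are excluded here and
    not by a hypothesis on [E]. *)
Definition adj E x y := (x != y) && ([set x; y] \in E).
Definition deg E R x := #|[set y in R | adj E x y]|.
Definition ein E R := #|E :&: pairs_in R|.

Definition pathfree k E : bool :=
  [forall t : k.-tuple V, ~~ (uniq t && sorted (adj E) t)].

Lemma adj_sym E : symmetric (adj E).
Proof. by move=> x y; rewrite /adj eq_sym setUC. Qed.

Lemma adj_irr E x : adj E x x = false.
Proof. by rewrite /adj eqxx. Qed.

Lemma adj_neq E x y : adj E x y -> x != y.
Proof. by case/andP. Qed.

Lemma adjS E H x y : E \subset H -> adj E x y -> adj H x y.
Proof. by move=> /subsetP s /andP[n i]; rewrite /adj n s. Qed.

Lemma adjU1 E a b x y :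
  adj ([set a; b] |: E) x y = adj E x y || (x != y) && ([set x; y] == [set a; b]).
Proof. by rewrite /adj in_setU1; case: (x != y) => //=; rewrite orbC. Qed.

Lemma set2_eq x y a b :
  [set x; y] = [set a; b] -> (x = a /\ y = b) \/ (x = b /\ y = a).
Proof.
move=> e; have := set21 x y; rewrite e !inE => /orP[] /eqP xe.
  subst x; left; split => //.
  have := set22 a y; rewrite e !inE => /orP[] /eqP // ye; subst y.
  by have := set22 a b; rewrite -e !inE orbb => /eqP ->.
subst x; right; split => //.
have := set22 b y; rewrite e !inE => /orP[] /eqP // ye; subst y.
by have := set21 a b; rewrite -e !inE orbb => /eqP ->.
Qed.

Lemma pairs_inP D (e : {set V}) :
  reflect (exists x y, [/\ x \in D, y \in D, x != y & e = [set x; y]]) (e \in pairs_in D).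
Proof.
rewrite inE; apply: (iffP andP) => [[sub /cards2P[x [y [nxy ee]]]]|[x [y [xD yD nxy ->]]]].
  by exists x, y; split=> //; apply: (subsetP sub); rewrite ee !inE eqxx ?orbT.
by rewrite subUset !sub1set xD yD cards2 nxy.
Qed.

Lemma pair_pairs_in D x y : x != y -> ([set x; y] \in pairs_in D) = (x \in D) && (y \in D).
Proof. by move=> n; rewrite inE subUset !sub1set cards2 n andbT. Qed.

Lemma adj_in E D x y : E \subset pairs_in D -> adj E x y -> (x \in D) && (y \in D).
Proof. by move=> /subsetP sE /andP[n /sE]; rewrite pair_pairs_in. Qed.

Lemma pairs_inS D R : D \subset R -> pairs_in D \subset pairs_in R.
Proof.
by move=> sD; apply/subsetP => e; rewrite !inE => /andP[eD ->]; rewrite (subset_trans eD sD).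
Qed.

Lemma card_pairs_in D : #|pairs_in D| = 'C(#|D|, 2).
Proof. by rewrite -cards_draws. Qed.

Lemma pathfreeP k E :
  reflect (forall s, uniq s -> sorted (adj E) s -> size s < k) (pathfree k E).
Proof.
apply: (iffP forallP) => [h s us ss|h t].
  rewrite ltnNge; apply/negP => le.
  have sz : size (take k s) == k by rewrite size_takel.
  by have := h (Tuple sz); rewrite /= take_uniq // take_sorted.
by apply/negP => /andP[u s]; have := h _ u s; rewrite size_tuple ltnn.
Qed.

Lemma ein_le E R : ein E R <= 'C(#|R|, 2).
Proof. by rewrite -card_pairs_in subset_leq_card // subsetIr. Qed.

Lemma einS E H R : E \subset H -> ein E R <= ein H R.
Proof. by move=> s; rewrite subset_leq_card // setSI. Qed.

Lemma ein_full E D : E \subset pairs_in D -> ein E D = #|E|.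
Proof. by move=> /setIidPl s; rewrite /ein s. Qed.

Lemma degS E H R S x : E \subset H -> R \subset S -> deg E R x <= deg H S x.
Proof.
move=> sE sR; apply: subset_leq_card; apply/subsetP => y; rewrite !inE => /andP[yR a].
by rewrite (subsetP sR) ?(adjS sE).
Qed.

Lemma deg_lt E R x : x \in R -> deg E R x < #|R|.
Proof.
move=> xR; rewrite (cardsD1 x R) xR add1n ltnS; apply: subset_leq_card.
by apply/subsetP => y; rewrite !inE => /andP[-> /adj_neq]; rewrite eq_sym => ->.
Qed.

Lemma degD1 E R x : deg E (R :\ x) x = deg E R x.
Proof.
by apply: eq_card => y; rewrite !inE; case: eqP => [->|] //=; rewrite adj_irr andbF.
Qed.

Lemma ein_rem E R x : x \in R -> ein E R = ein E (R :\ x) + deg E R x.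
Proof.
move=> xR; rewrite /ein.
rewrite -(cardsID [set e : {set V} | x \notin e] (E :&: pairs_in R)); congr (_ + _).
  apply: eq_card => e; rewrite !inE subsetD1.
  by case: (e \in E); case: (e \subset R); case: (x \in e); case: (#|e| == 2).
rewrite /deg -(card_in_imset (f := fun y => [set x; y])); last first.
  by move=> y z _ _ /set2_eq [[_ //]|[-> <-]].
apply: eq_card => e; rewrite !inE negbK; apply/idP/imsetP.
  case/andP=> xe /andP[eE] /andP[eR /cards2P[a [b [nab ee]]]].
  move: xe; rewrite ee !inE => /orP[] /eqP xe; subst x.
    by exists b; rewrite // inE /adj nab -ee eE (subsetP eR) // ee !inE eqxx orbT.
  exists a; last by rewrite setUC.
  by rewrite inE /adj eq_sym nab setUC -ee eE (subsetP eR) // ee !inE eqxx.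
case=> y; rewrite inE => /andP[yR /andP[nxy eE]] ->.
by rewrite eE !inE eqxx subUset !sub1set xR yR cards2 nxy.
Qed.

(** The deleted vertices lie outside [S], so the deletion ends exactly at [S]; in [ein_degenerate]
    below it ends at some set of [b] vertices, whose edges are bounded trivially. *)
Lemma ein_peel E D S d :
  (forall W, S \proper W -> W \subset D -> exists2 x, x \in W :\: S & deg E W x <= d) ->
  forall W, S \subset W -> W \subset D -> ein E W <= ein E S + d * (#|W| - #|S|).
Proof.
move=> h W; have [m] := ubnP #|W|; elim: m W => // m IH W lt SW WD.
have [<-|ne] := eqVneq S W; first by rewrite subnn muln0 addn0.
have pr : S \proper W by rewrite properEneq ne.
have [x xW dx] := h _ pr WD; move: (xW); rewrite !inE => /andP[xS xWW].
have cW := cardsD1 x W; rewrite xWW in cW.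
have SWx : S \subset W :\ x by rewrite subsetD1 SW.
have IHx := IH (W :\ x) ltac:(lia) SWx (subset_trans (subD1set _ _) WD).
have := subset_leq_card SWx; rewrite (ein_rem _ xWW) => ?.
have -> : #|W| - #|S| = (#|W :\ x| - #|S|).+1 by lia.
by rewrite mulnS; lia.
Qed.

Lemma ein_degenerate E D d b :
  (forall R, R \subset D -> b < #|R| -> exists2 x, x \in R & deg E R x <= d) ->
  forall R, R \subset D -> b <= #|R| -> ein E R <= 'C(b, 2) + d * (#|R| - b).
Proof.
move=> h R; have [m] := ubnP #|R|; elim: m R => // m IH R lt RD.
rewrite leq_eqVlt => /orP[/eqP ->|lb]; first by rewrite subnn muln0 addn0 ein_le.
have [x xR dx] := h _ RD lb.
have cW := cardsD1 x R; rewrite xR in cW.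
have := IH (R :\ x) ltac:(lia) (subset_trans (subD1set _ _) RD) ltac:(lia).
rewrite (ein_rem _ xR); have -> : #|R| - b = (#|R :\ x| - b).+1 by lia.
by rewrite mulnS; lia.
Qed.

(** A path without repetitions uses the new edge at most once; cut there, it leaves two paths of
    [E]. *)
Lemma sorted_addE E x y s :
  uniq s -> sorted (adj ([set x; y] |: E)) s ->
  sorted (adj E) s \/ exists s1 u v s2,
    [/\ s = rcons s1 u ++ v :: s2, [set u; v] = [set x; y],
        sorted (adj E) (rcons s1 u) & sorted (adj E) (v :: s2)].
Proof.
elim: s => [|a s IH] /=; first by left.
case/andP=> as_ us pa; have ss : sorted (adj ([set x; y] |: E)) s by apply: path_sorted pa.
case: s => [|b s] in IH as_ us pa ss *; first by left.
case: (IH us ss) => [ps|[s1 [u [v [s2 [es euv p1 p2]]]]]].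
  move: pa => /= /andP[]; rewrite adjU1 => /orP[ab _|/andP[nab /eqP eab] _].
    by left; move: ps => /= ->; rewrite ab.
  by right; exists [::], a, b, s.
right; exists (a :: s1), u, v, s2; split => //; first by rewrite /= es.
move: pa => /= /andP[]; rewrite adjU1 => /orP[ab _|/andP[nab /eqP eab] _].
  case: s1 es p1 => [|c s1] /= [<-] _ p1; by rewrite ab.
suff : a \in b :: s by rewrite (negPf as_).
have au : a \in [set u; v] by rewrite euv -eab !inE eqxx.
by rewrite es mem_cat mem_rcons !inE; move: au; rewrite !inE => /orP[] ->; rewrite ?orbT.
Qed.

Lemma uniq_size_card s : uniq s -> size s <= #|V|.
Proof. by move/card_uniqP => <-; apply: max_card. Qed.

End Graph.

Lemma count_take_le (T : Type) (p : pred T) i j (s : seq T) :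
  i <= j -> count p (take i s) <= count p (take j s).
Proof.
by move=> ij; rewrite -(take_takel s ij) (count_take_drop p i (take j s)) leq_addr.
Qed.

Lemma max_index (T : Type) (p : pred T) x0 (s : seq T) : has p s ->
  exists i, [/\ i < size s, p (nth x0 s i) &
                forall j, i < j -> j < size s -> ~~ p (nth x0 s j)].
Proof.
rewrite -has_rev => hp; have := hp; rewrite has_find size_rev => lt.
have := nth_find x0 hp; rewrite nth_rev // => pi.
exists (size s - (find p (rev s)).+1); split=> //; first by lia.
move=> j lj lt'; have := @before_find _ x0 p (rev s) (size s - j.+1) ltac:(lia).
rewrite nth_rev; last by lia.
have -> : size s - (size s - j.+1).+1 = j by lia.
by move=> ->.
Qed.

(** * Kopylov's theorem on connected path-free graphs *)

Section AdjacentPairs.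
Variable V : finType.
Implicit Types (E : {set {set V}}) (x y z : V) (a b s : seq V) (D R S T : {set V}).

(** Let [y] be adjacent to position [i'] of [a] and [x] to position [i]. If [i' < i <= i' + h + 1],
    the path from the end of [a] back to [i], over to [x], on to [i'], over to [y] and along [b]
    skips at most [h] vertices, so it has at least [k]. Hence the neighbours of [x] avoid the
    successors of neighbours of [y], and also the [h] positions following the last such
    successor. *)
Lemma cross_count E k h x a y b :
  pathfree k E -> uniq (a ++ b) -> sorted (adj E) a -> sorted (adj E) b ->
  0 < size a -> 0 < size b -> head x a = x -> head y b = y ->
  size a + size b = k + h ->
  has (adj E y) a -> count (adj E x) a + count (adj E y) a + h < size a.
Proof.
move=> /pathfreeP pf U sa sb a0 b0 hx hy sz hy'.
have hyx : head x b = y by rewrite -hy; case: (b) b0.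
have adjC := adj_sym E.
have C1 i : i < size a -> adj E y (nth x a i) -> h < i.
  move=> ir yi; suff : size (rev (drop i a) ++ b) < k.
    by rewrite size_cat size_rev size_drop; lia.
  apply: pf.
    apply: (uniq_of_count U) => z; rewrite !count_cat count_rev (count_take_drop _ i a); lia.
  apply: (@sorted_cat _ _ x); rewrite ?sorted_rev ?drop_sorted //.
  by rewrite last_rev head_drop hyx adjC.
have C2 i : i < size a -> adj E y (nth x a i) -> i + h + 2 <= size a.
  move=> ir yi; suff : size (take i.+1 a ++ b) < k.
    by rewrite size_cat size_takel //; lia.
  apply: pf.
    apply: (uniq_of_count U) => z; rewrite !count_cat (count_take_drop _ i.+1 a); lia.
  apply: (@sorted_cat _ _ x); rewrite ?take_sorted //.
  by rewrite last_take // hyx adjC.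
have C3 i i' : i' < i -> i <= i' + h + 1 -> i < size a -> adj E y (nth x a i') ->
    adj E x (nth x a i) -> False.
  move=> ii' ii ir yi xi; suff : size (rev (drop i a) ++ take i'.+1 a ++ b) < k.
    by rewrite !size_cat size_rev size_drop size_takel; lia.
  apply: pf.
    apply: (uniq_of_count U) => z; rewrite !count_cat count_rev.
    have := @count_take_le _ z _ _ a ii'.
    rewrite (count_take_drop _ i a); lia.
  apply: (@sorted_cat _ _ x); rewrite ?sorted_rev ?drop_sorted //.
    apply: (@sorted_cat _ _ x); rewrite ?take_sorted //.
    by rewrite last_take; [rewrite hyx adjC | lia].
  have -> : head x (take i'.+1 a ++ b) = x by case: (a) a0 hx.
  by rewrite last_rev head_drop adjC.
have [y0 [y0r yy0 y0max]] := max_index x hy'.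
rewrite !(count_nth_iota _ x).
set X := filter _ _; set Y := filter _ _.
have XP i : i \in X = (adj E x (nth x a i)) && (i < size a) by rewrite mem_filter mem_iota.
have YP i : i \in Y = (adj E y (nth x a i)) && (i < size a) by rewrite mem_filter mem_iota.
have XY : [seq S i | i <- Y] =i [pred i | (0 < i) && (i.-1 \in Y)].
  move=> i; rewrite inE; apply/mapP/andP => [[j jY ->] //|[i0 iY]].
  by exists i.-1 => //; rewrite prednK.
have Yle i : i \in Y -> i <= y0.
  rewrite YP => /andP[yi ir]; rewrite leqNgt; apply/negP => /y0max /(_ ir).
  by rewrite yi.
(* All these positions lie in 1 .. [(size a).-1]: [C2] at the last neighbour of [y] leaves room for
   the window of length [h]. *)
have U2 : uniq (X ++ [seq S i | i <- Y] ++ iota (y0 + 2) h).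
  rewrite !cat_uniq filter_uniq ?iota_uniq // map_inj_uniq ?filter_uniq ?iota_uniq //=; last exact: succn_inj.
  rewrite andbT; apply/andP; split; apply/hasPn => i.
    rewrite mem_cat XY inE mem_iota => /orP[/andP[i0 iY]|/andP[i1 i2]]; apply/negP => /=; rewrite XP => /andP[xi ir].
      by move: iY; rewrite YP => /andP[yi _]; apply: (C3 i i.-1) => //; lia.
    by apply: (C3 i y0) => //; lia.
  rewrite mem_iota => ib; apply/negP; rewrite /= XY inE => /andP[i0 /Yle]; lia.
have := uniq_leq_size (s2 := iota 1 (size a).-1) U2.
rewrite !size_cat !size_iota size_map => H.
have {}H : size X + (size Y + h) <= (size a).-1.
  apply: H => i; rewrite !mem_cat mem_iota XY inE mem_iota => /orP[|/orP[]].
  - rewrite XP => /andP[xi ir]; case: i xi ir => [|i] xi ir; last by lia.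
    by move: xi; rewrite nth0 hx adj_irr.
  - by move=> /andP[i0]; rewrite YP => /andP[yi ir]; have := C2 _ ir yi; lia.
  by have := C2 _ y0r yy0; lia.
lia.
Qed.

(** The chord from [x] closes the first [i + 1] vertices into a cycle, which is cut open after
    position [j]. *)
Lemma cycle_path E x a i j :
  sorted (adj E) a -> head x a = x -> i < size a -> adj E x (nth x a i) -> j <= i ->
  exists s, [/\ perm_eq s (take i.+1 a), sorted (adj E) s & last x s = nth x a j].
Proof.
move=> sa hx ia xi ji; set c := take i.+1 a.
have sc : sorted (adj E) c by apply: take_sorted.
have szc : size c = i.+1 by rewrite size_takel.
exists (drop j.+1 c ++ take j.+1 c); split.
- by rewrite perm_catC cat_take_drop.
- apply: (@sorted_cat _ _ x); rewrite ?drop_sorted ?take_sorted // => n1 _.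
  have lc : last x (drop j.+1 c) = last x c.
    rewrite -[c in RHS](cat_take_drop j.+1 c) last_cat.
    by case: (drop j.+1 c) n1.
  rewrite lc /c last_take // adj_sym; case: (a) hx ia xi => //= w a' ->.
  by [].
rewrite last_cat (last_nth x) size_takel ?szc //=.
by rewrite nth_take // /c nth_take.
Qed.

(** Cutting the path at any further vertex of [A] or [B] shortens it, until only its ends lie in
    these sets. *)
Lemma link_path (e : rel V) (A B : pred V) u p :
  path e u p -> A u -> B (last u p) -> (forall z, A z -> B z -> False) ->
  exists v q, [/\ path e v q, uniq (v :: q), A v, B (last v q) &
                 (forall z, z \in q -> ~~ A z) /\ (forall z, z \in belast v q -> ~~ B z)].
Proof.
case/shortenP=> {p} p pp Up _ Au Bl dAB.
have [m] := ubnP (size p); elim: m u p pp Up Au Bl => // m IH u p pp Up Au Bl lt.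
have [/hasP[z zp Az]|nA] := boolP (has A p).
  case/splitPr: zp pp Up Bl lt => p1 p2; rewrite cat_path /= last_cat /=.
  move=> /and3P[_ _ pp] /andP[_]; rewrite cat_uniq => /and3P[_ _ U2] Bl.
  rewrite size_cat /= => lt; apply: (IH z p2) => //; flia.
have [/hasP[z zp Bz]|nB] := boolP (has B (belast u p)).
  case/lastP: p => [|p w] //in pp Up Bl lt zp nA *.
  move: zp; rewrite belast_rcons inE => /orP[/eqP zu|zp]; first by case: (dAB z) => //; rewrite zu.
  case/splitPr: zp pp Up lt {Bl nA} => p1 p2; rewrite rcons_cat /= cat_path /=.
  move=> /and3P[pp1 lz _] U; rewrite size_cat /= size_rcons => lt.
  apply: (IH u (rcons p1 z)) => //; last by rewrite size_rcons; flia.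
  - by rewrite rcons_path pp1.
  - move: U; rewrite -cat_rcons mem_cat cat_uniq negb_or => /andP[/andP[u1 _] /andP[u2 _]].
    by rewrite /= u1.
  by rewrite last_rcons.
exists u, p; split=> //; split=> z zz; first by move/hasPn: nA; apply.
by move/hasPn: nB; apply.
Qed.

Definition edge_max k D E :=
  forall x y, x \in D -> y \in D -> x != y -> ~~ adj E x y ->
  ~~ pathfree k ([set x; y] |: E).

(** The connecting walks may leave [D]. *)
Definition conn E D := forall x y, x \in D -> y \in D -> connect (adj E) x y.

Lemma deg_le_count E T x s : 
  (forall z, z \in T -> adj E x z -> z \in s) -> deg E T x <= count (adj E x) s.
Proof.
move=> h; rewrite -size_filter; apply: leq_trans (card_size _).
apply: subset_leq_card; apply/subsetP => z; rewrite inE => /andP[zT az].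
by rewrite mem_filter az h.
Qed.

(* The induction makes the two disjoint paths issued from the non-adjacent pair as long as possible, so that
   all neighbours of [x] in [T1] and of [y] in [T2] lie on them; chords are then counted on each path. *)
Lemma kopylov_maximal_pair E D k T1 T2 p q x a y b :
  pathfree k E -> conn E D -> T1 \subset D -> T2 \subset D ->
  (forall x, x \in T1 -> p <= deg E T1 x) -> (forall y, y \in T2 -> q <= deg E T2 y) ->
  0 < p -> 0 < q -> k <= p + q + 1 ->
  x \in T1 -> y \in T2 -> x != y -> ~~ adj E x y ->
  uniq ((x :: a) ++ y :: b) -> path (adj E) x a -> path (adj E) y b ->
  k <= size a + size b + 2 -> False.
Proof.
move=> pf cn TD1 TD2 d1 d2 p0 q0 kpq.
have [m] := ubnP (#|V| - (size a + size b + 2)).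
have adjC := adj_sym E; have pfP := pathfreeP _ _ pf.
elim: m x a y b => // m IH x a y b lt xT yT nxy nadj U pa pb km.
have szV := uniq_size_card U; rewrite size_cat /= in szV.
have nx z : z \in T1 -> adj E x z -> z \in (x :: a) ++ y :: b.
  move=> zT xz; apply/negPn/negP => zn.
  have Uz : uniq (z :: (x :: a) ++ y :: b) by rewrite cons_uniq zn.
  have := uniq_size_card Uz; rewrite /= size_cat /= => szz.
  (* If [z] is adjacent to [y], it joins both paths into one on more than [k] vertices; otherwise
     [z] takes the place of [x] and lengthens the first path. *)
  have [yz|nyz] := boolP (adj E z y).
    have : size (rev (x :: a) ++ z :: y :: b) < k.
      apply: pfP.
        apply: (@uniq_of_count V _ (z :: (x :: a) ++ y :: b)) => //.
        by move=> w; rewrite /= !count_cat count_rev /=; flia.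
      apply: (@sorted_cat _ _ x); rewrite ?sorted_rev //= ?yz //.
      by rewrite rev_cons last_rcons xz.
    by rewrite size_cat size_rev /=; flia.
  have zy : z != y by move: zn; rewrite mem_cat inE negb_or => /andP[_]; rewrite inE negb_or => /andP[].
  apply: (IH z (x :: a) y b) => //=; try flia.
  - by rewrite adjC xz.
have ny z : z \in T2 -> adj E y z -> z \in (x :: a) ++ y :: b.
  move=> zT yz; apply/negPn/negP => zn.
  have Uz : uniq (z :: (x :: a) ++ y :: b) by rewrite cons_uniq zn.
  have := uniq_size_card Uz; rewrite /= size_cat /= => szz.
  have [xz|nxz] := boolP (adj E x z).
    have : size (rev (x :: a) ++ z :: y :: b) < k.
      apply: pfP.
        apply: (@uniq_of_count V _ (z :: (x :: a) ++ y :: b)) => //.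
        by move=> w; rewrite /= !count_cat count_rev /=; flia.
      apply: (@sorted_cat _ _ x); rewrite ?sorted_rev //= 1?[adj E z y]adjC ?yz //.
      by rewrite rev_cons last_rcons xz.
    by rewrite size_cat size_rev /=; flia.
  have zx : x != z.
    by move: zn; rewrite mem_cat inE negb_or => /andP[]; rewrite negb_or eq_sym => /andP[].
  apply: (IH x a z (y :: b)) => //=; try flia.
  - rewrite -[_ && _]/(uniq ((x :: a) ++ z :: y :: b)).
    apply: (@uniq_of_count V _ (z :: (x :: a) ++ y :: b)) => //.
    by move=> w; rewrite /= !count_cat /=; flia.
  - by rewrite adjC yz.
have := leq_trans (d1 _ xT) (deg_le_count nx); have := leq_trans (d2 _ yT) (deg_le_count ny).
rewrite !count_cat => dy dx.
set A := x :: a in U dy dx nx ny *; set B := y :: b in U dy dx nx ny *.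
have U' : uniq (B ++ A) by rewrite uniq_catC.
have sA : sorted (adj E) A by []. have sB : sorted (adj E) B by [].
have szA : size A = (size a).+1 by []. have szB : size B = (size b).+1 by [].
have cA : count (adj E x) A <= size a by rewrite /= adj_irr count_size.
have cB : count (adj E y) B <= size b by rewrite /= adj_irr count_size.
have [h hE] : exists h, size A + size B = k + h by exists (size A + size B - k); flia.
have H1 := cross_count pf U sA sB isT isT erefl erefl hE.
have H2 := cross_count pf U' sB sA isT isT erefl erefl (etrans (addnC _ _) hE).
(* As soon as [x] or [y] has a neighbour on the path of the other, [cross_count] bounds the sum of
   both degrees by [k - 2], which is less than [p + q]. *)
have [hA|nhA] := boolP (has (adj E y) A).
  have {}H1 := H1 hA; have [hB|nhB] := boolP (has (adj E x) B).
    by have {}H2 := H2 hB; flia.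
  by move: nhB; rewrite has_count; flia.
have [hB|nhB] := boolP (has (adj E x) B).
  by have {}H2 := H2 hB; move: nhA; rewrite has_count; flia.
move: nhA nhB; rewrite !has_count => nhA nhB.
have hxA : has (adj E x) A by rewrite has_count; flia.
have hyB : has (adj E y) B by rewrite has_count; flia.
have cnt w w0 c i : i < size (w :: c) -> (forall j, i < j -> j < size (w :: c) -> ~~ adj E w (nth w0 (w :: c) j)) ->
    count (adj E w) (w :: c) <= i.
  move=> ic im; rewrite (count_take_drop _ i.+1 (w :: c)).
  rewrite [X in _ + X <= _](_ : _ = 0); last first.
    apply/eqP; rewrite -leqn0 leqNgt -has_count; apply/hasPn => z /(nthP w0)[j].
    rewrite size_drop nth_drop => jl <-; apply: im; flia.
  rewrite addn0 /= adj_irr /=; apply: leq_trans (count_size _ _) _.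
  by rewrite size_take; case: ltnP => //; move: ic => /=; flia.
(* Without such neighbours the farthest chords close cycles on more than [p] and more than [q]
   vertices. A connecting path links the two cycles, and opening both gives a path on at least
   [p + q + 2 > k] vertices. *)
have [i [ia xi imax]] := max_index x hxA.
have [j [jb yj jmax]] := max_index y hyB.
have pi : p <= i by have := cnt x x a i ia imax; rewrite -/A; flia.
have qj : q <= j by have := cnt y y b j jb jmax; rewrite -/B; flia.
have /connectP[w pw ew] := cn x y (subsetP TD1 _ xT) (subsetP TD2 _ yT).
pose A' := take i.+1 A; pose B' := take j.+1 B.
have UA : uniq A by move: U; rewrite cat_uniq => /and3P[].
have UB : uniq B by move: U; rewrite cat_uniq => /and3P[].
have UA' : uniq A' by apply: take_uniq. have UB' : uniq B' by apply: take_uniq.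
have dAB z : z \in A' -> z \in B' -> False.
  move=> /mem_take zA /mem_take zB; move: U; rewrite cat_uniq => /and3P[_ /hasPn h1 _].
  by have := h1 _ zB; rewrite /= zA.
have xA' : x \in A' by rewrite inE eqxx. have yB' : y \in B' by rewrite inE eqxx.
have lB' : last x w \in B' by rewrite -ew.
have [u [r [pr Ur uA lB [rA rB]]]] := @link_path _ (mem A') (mem B') _ _ pw xA' lB' dAB.
have [iu iua eu] : exists2 iu, iu <= i & u = nth x A iu.
  exists (index u A'); first by move: uA => /=; rewrite -index_mem size_takel.
  by rewrite -[u in LHS](nth_index x uA) nth_take //; move: uA; rewrite /= -index_mem size_takel.
have [sa [psa ssa lsa]] := cycle_path sA erefl ia xi iua.
case/lastP: r => [|r v] in pr Ur uA lB rA rB *; first by case: (dAB u).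
rewrite last_rcons /= in lB.
have [iv iva ev] : exists2 iv, iv <= j & v = nth y B iv.
  exists (index v B'); first by move: lB; rewrite -index_mem size_takel.
  by rewrite -[v in LHS](nth_index y lB) nth_take //; move: lB; rewrite -index_mem size_takel.
have [sb [psb ssb lsb]] := cycle_path sB erefl jb yj iva.
rewrite -eu in lsa; rewrite -ev in lsb.
rewrite rcons_path in pr; case/andP: pr => pr lv.
have msa : sa =i A' by apply: perm_mem. have msb : sb =i B' by apply: perm_mem.
have zsa : size sa = i.+1 by rewrite (perm_size psa) size_takel.
have zsb : size sb = j.+1 by rewrite (perm_size psb) size_takel.
have : size (sa ++ r ++ rev sb) < k.
  apply: pfP.
    rewrite !cat_uniq rev_uniq (perm_uniq psa) (perm_uniq psb) UA' UB' /= andbT.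
    move: Ur; rewrite /= rcons_uniq => /and3P[ur vr ->]; rewrite /=.
    apply/andP; split; apply/hasPn => z; rewrite ?mem_cat mem_rev msb.
      case/orP => [zr|zB]; apply/negP; rewrite /= msa => zA; last exact: (dAB z).
      by have := rA z; rewrite mem_rcons inE zr orbT /= zA => /(_ isT).
    move=> zB; apply/negP => zr; have := rB z; rewrite belast_rcons inE zr orbT => /(_ isT) /=.
    by rewrite zB.
  case/lastP: sa => [|sa u'] in psa ssa lsa zsa msa *; first by [].
  rewrite last_rcons in lsa; rewrite {}lsa in ssa *.
  case/lastP: sb => [|sb v'] in psb ssb lsb zsb msb *; first by [].
  rewrite last_rcons in lsb; rewrite {}lsb in ssb *.
  rewrite cat_rcons sorted_cat_cons ssa cat_path pr /= rev_rcons /= lv /=.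
  by move: ssb; rewrite -sorted_rev // rev_rcons.
by rewrite !size_cat size_rev zsa zsb; flia.
Qed.

(** Edge-maximality yields a path on [k] vertices through the missing pair; cut at this pair, it
    becomes the two disjoint paths that [kopylov_maximal_pair] refutes. *)
Lemma kopylov_adjacent E D k T1 T2 p q :
  pathfree k E -> conn E D -> edge_max k D E -> T1 \subset D -> T2 \subset D ->
  (forall x, x \in T1 -> p <= deg E T1 x) -> (forall y, y \in T2 -> q <= deg E T2 y) ->
  0 < p -> 0 < q -> k <= p + q + 1 ->
  forall x y, x \in T1 -> y \in T2 -> x != y -> adj E x y.
Proof.
move=> pf cn em TD1 TD2 d1 d2 p0 q0 kpq x y xT yT nxy; apply/negPn/negP => nadj.
have := em _ _ (subsetP TD1 _ xT) (subsetP TD2 _ yT) nxy nadj.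
rewrite negb_forall => /existsP[t]; rewrite negbK => /andP[Ut st].
case: (sorted_addE Ut st) => [s0|[s1 [u [v [s2 [et euv ss1 ss2]]]]]].
  by have := pathfreeP _ _ pf _ Ut s0; rewrite size_tuple ltnn.
have szt := size_tuple t; rewrite et size_cat size_rcons /= in szt.
rewrite et in Ut.
have C := kopylov_maximal_pair pf cn TD1 TD2 d1 d2 p0 q0 kpq xT yT nxy nadj.
have adjC := adj_sym E.
have pu : path (adj E) u (rev s1) by move: ss1; rewrite -sorted_rev // rev_rcons.
case/set2_eq: euv => -[eu ev]; subst.
  apply: (C (rev s1) s2) => //; last by rewrite size_rev; flia.
  apply: (uniq_of_count Ut) => z; rewrite !count_cat -cats1 count_cat /= count_rev; flia.
apply: (C s2 (rev s1)) => //; last by rewrite size_rev; flia.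
apply: (uniq_of_count Ut) => z; rewrite !count_cat -cats1 count_cat /= count_rev; flia.
Qed.

End AdjacentPairs.

Section Kopylov.
Variable V : finType.
Implicit Types (E H : {set {set V}}) (x y z : V) (a b s : seq V) (D R S T W : {set V}).

Lemma edge_max_exists k E : pathfree k E ->
  exists H, [/\ E \subset H, pathfree k H & forall D, edge_max k D H].
Proof.
move=> pf; have [H /maxsetP[pH mH] EH] := @maxset_exists _ (pathfree k) _ pf.
exists H; split=> // D x y _ _ nxy; apply: contraNN => pf'.
have := mH _ pf' (subsetUr _ _) => eH; rewrite /adj nxy -eH.
by rewrite in_setU1 eqxx.
Qed.

Lemma connS E H D : E \subset H -> conn E D -> conn H D.
Proof.
move=> sE cn x y xD yD; apply: connect_sub (cn _ _ xD yD) => u v uv.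
by apply: connect1; apply: adjS uv.
Qed.

Lemma clique_sorted E s :
  (forall x y, x \in s -> y \in s -> x != y -> adj E x y) -> uniq s -> sorted (adj E) s.
Proof.
elim: s => //= x [|y s] //= IH cl /andP[xn U]; apply/andP; split.
  by apply: cl; rewrite ?inE ?eqxx ?orbT //; apply: contraNneq xn => ->; rewrite inE eqxx.
by apply: IH => // u v us vs; apply: cl; rewrite inE ?us ?vs orbT.
Qed.

Lemma path_cross (e : rel V) (P : pred V) x p :
  path e x p -> P x -> ~~ P (last x p) -> exists u v, [/\ P u, ~~ P v & e u v].
Proof.
elim: p x => [|y p IH] x /=; first by move=> _ ->.
case/andP=> xy pp Px nl; have [Py|nPy] := boolP (P y); first exact: IH pp Py nl.
by exists x, y.
Qed.

(** A larger clique either fills [D] or has an edge leaving it, and in both cases there is a path on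
    [k] vertices. *)
Lemma clique_small E D S k :
  pathfree k E -> conn E D -> S \subset D -> S != set0 -> k <= #|D| ->
  (forall x y, x \in S -> y \in S -> x != y -> adj E x y) -> #|S| + 2 <= k.
Proof.
move=> /pathfreeP pf cn SD /set0Pn[s sS] kD cl; rewrite leqNgt; apply/negP => lt.
have [DS|] := boolP (D \subset S).
  have : size (enum S) < k.
    apply: pf; rewrite ?enum_uniq //; apply: clique_sorted; rewrite ?enum_uniq //.
    by move=> x y; rewrite !mem_enum; apply: cl.
  by rewrite -cardE; have := subset_leq_card DS; flia.
case/subsetPn=> z zD zS.
have /connectP[p pp ep] := cn z s zD (subsetP SD _ sS).
have [u [v [/= uS vS uv]]] := @path_cross _ (fun v => v \notin S) _ _ pp zS
   ltac:(by rewrite -ep /= negbK).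
rewrite negbK in vS.
have U : uniq (v :: enum (S :\ v)) by rewrite /= mem_enum !inE eqxx enum_uniq.
have : size (u :: v :: enum (S :\ v)) < k.
  apply: pf; first by rewrite cons_uniq U inE mem_enum !inE negb_or (adj_neq uv) (negPf uS) andbF.
  rewrite /= uv /=; have := @clique_sorted E (v :: enum (S :\ v)) _ U; apply.
  by move=> x y; rewrite !inE !mem_enum !inE => /orP[/eqP->|/andP[_ xS]] /orP[/eqP->|/andP[_ yS]];
    apply: cl.
by rewrite /= -cardE; have := cardsD1 v S; rewrite vS; flia.
Qed.

(** [S] is the largest set of minimum degree [t] in an edge-maximal P_k-free graph [H] containing
    [E]. It is a clique of [H] because [2 * t + 1 >= k], and all degree bounds pass from [H] down to
    [E]. *)
Theorem kopylov E D k t :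
  pathfree k E -> conn E D -> 0 < t -> 2 * t <= k <= 2 * t + 1 -> k <= #|D| ->
  exists S, [/\ S \subset D,
    forall R, R \subset D -> ~~ (R \subset S) -> exists2 x, x \in R :\: S & deg E R x < t &
    S = set0 \/ [/\ t < #|S|, #|S| + 2 <= k &
                    ein E D <= ein E S + (k - 1 - #|S|) * (#|D| - #|S|)]].
Proof.
move=> pfE cnE t0 tk kD.
have [H [EH pf em]] := edge_max_exists pfE; have {}em := em D.
have cn := connS EH cnE.
pose ok T := (T \subset D) && [forall x in T, t <= deg H T x].
pose S := \bigcup_(T | ok T) T.
have TS T : ok T -> T \subset S by move=> oT; apply: (bigcup_sup T).
have SD : S \subset D by apply/bigcupsP => T /andP[].
have dS x : x \in S -> t <= deg H S x.
  case/bigcupP=> T oT xT; have := oT => /andP[_ /forall_inP/(_ x xT)] h.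
  by apply: leq_trans h _; apply: degS => //; apply: TS.
have P1 R : R \subset D -> ~~ (R \subset S) -> exists2 x, x \in R :\: S & deg E R x < t.
  move=> RD RS; have : ~~ ok (R :|: S).
    by apply: contra RS => /TS; rewrite subUset => /andP[].
  rewrite /ok subUset RD SD /= negb_forall => /existsP[x]; rewrite negb_imply -ltnNge.
  case/andP=> xR dx; exists x.
    move: xR; rewrite !inE => /orP[xR|xS].
      rewrite xR andbT; apply/negP => /dS; have := @degS _ H H S (R :|: S) x (subxx _) (subsetUr _ _).
      flia.
    by have := dS _ xS; have := @degS _ H H S (R :|: S) x (subxx _) (subsetUr _ _); flia.
  by apply: leq_ltn_trans dx; apply: degS => //; apply: subsetUl.
exists S; split=> //; have [->|nS] := eqVneq S set0; [by left|right].
have cl x y : x \in S -> y \in S -> x != y -> adj H x y.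
  by apply: (@kopylov_adjacent _ H D k S S t t) => //; flia.
have sk := clique_small pf cn SD nS kD cl.
have tS : t < #|S|.
  by case/set0Pn: nS => x xS; apply: leq_ltn_trans (dS _ xS) _; apply: deg_lt.
have degSc x : x \in S -> #|S| - 1 <= deg H S x.
  move=> xS; rewrite (cardsD1 x S) xS add1n subn1 /=; apply: subset_leq_card.
  by apply/subsetP => y; rewrite !inE => /andP[yx yS]; rewrite yS cl // eq_sym.
split=> //.
apply: (@ein_peel _ E D S (k - 1 - #|S|)) => // W SW WD.
have [/existsP[x /andP[xW dx]]|] := boolP [exists x, (x \in W :\: S) && (deg H W x <= k - 1 - #|S|)].
  by exists x => //; apply: leq_trans dx; apply: degS.
(* Otherwise [W] has minimum degree at least [k - #|S|] and the clique [S] has minimum degree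
   [#|S| - 1], which suffices to make all of [W] adjacent to [S]. A vertex of [W] outside [S] can
   then be added to [S], against its maximality. *)
rewrite negb_exists => /forallP nd; exfalso.
have sSW := proper_sub SW.
have dW x : x \in W -> k - #|S| <= deg H W x.
  move=> xW; have [xS|xS] := boolP (x \in S).
    have := @degS _ H H S W x (subxx _) sSW; have := degSc _ xS; flia.
  by have := nd x; rewrite inE xS xW /= -ltnNge; flia.
have ad := @kopylov_adjacent _ H D k W S (k - #|S|) (#|S| - 1) pf cn em WD SD dW degSc
  ltac:(flia) ltac:(flia) ltac:(flia).
case/properP: SW => _ [x xW xS].
suff /TS : ok (x |: S) by rewrite subUset sub1set (negPf xS).
rewrite /ok subUset sub1set SD (subsetP WD) //=; apply/forall_inP => y.
rewrite in_setU1 => /orP[/eqP->|yS].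
  apply: leq_trans (ltnW tS) _; apply: subset_leq_card; apply/subsetP => z zS.
  by rewrite !inE zS orbT ad //; apply: contraNneq xS => ->.
by apply: leq_trans (dS _ yS) _; apply: degS => //; apply: subsetUr.
Qed.

Lemma deg_compl K S x : x \in S ->
  deg K S x + deg (pairs_in S :\: K) S x = #|S| - 1.
Proof.
move=> xS; rewrite (cardsD1 x S) xS add1n subn1 /= /deg.
rewrite -(cardsID [set y | adj K x y] (S :\ x)); congr (_ + _); apply: eq_card => y.
  by rewrite !inE eq_sym; case a: (adj K x y); rewrite ?andbF // (adj_neq a).
rewrite !inE /adj eq_sym !inE subUset !sub1set cards2 xS.
by rewrite (eq_sym x y); case: (y != x); case: (y \in S); case: (_ \in K).
Qed.

Lemma deg_le_ein K R x : x \in R -> deg K R x <= ein K R.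
Proof. by move=> xR; rewrite (ein_rem K xR) leq_addl. Qed.

(** In an edge-maximal supergraph [S] becomes a clique, and a spanning path of this clique that
    starts at [y] is prolonged by [w] and [w']. *)
Lemma near_clique_path K S y w w' :
  'C(#|S|, 2) + 4 <= ein K S + #|S| -> y \in S -> w \notin S -> w' \notin S ->
  adj K y w -> adj K w w' -> ~~ pathfree (#|S| + 2) K.
Proof.
move=> cS yS wS w'S yw ww'; apply/negP => pf.
set s := #|S| in cS *; pose M := pairs_in S :\: K.
have cM : ein M S + 4 <= s.
  rewrite ein_full ?subsetDl //.
  have := cardsID K (pairs_in S); rewrite card_pairs_in -/M setIC -/(ein K S) -/s; flia.
have dc x : x \in S -> deg K S x + deg M S x = s - 1 by apply: deg_compl.
have conS x z : x \in S -> z \in S -> connect (adj K) x z.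
  move=> xS zS; have [->|nxz] := eqVneq x z; first exact: connect0.
  have zS' : z \in S :\ x by rewrite !inE eq_sym nxz.
  have := ein_rem M xS; rewrite (ein_rem M zS') => e1.
  have d1 : deg M S z <= deg M (S :\ x) z + 1.
    rewrite {1}/deg (cardsD1 x) addnC leq_add //; last by case: (_ \in _).
    by apply: subset_leq_card; apply/subsetP => u; rewrite !inE => /and3P[-> -> ->].
  have [a|na] := boolP (adj K x z); first exact: connect1.
  have : 0 < #|[set u in S | adj K x u] :&: [set u in S | adj K z u]|.
    have := cardsUI [set u in S | adj K x u] [set u in S | adj K z u].
    rewrite -/(deg K S x) -/(deg K S z); have := dc _ xS; have := dc _ zS.
    have : #|[set u in S | adj K x u] :|: [set u in S | adj K z u]| <= s.
      by apply: subset_leq_card; apply/subsetP => u; rewrite !inE => /orP[] /andP[].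
    flia.
  case/card_gt0P => u; rewrite !inE => /andP[/andP[_ xu] /andP[_ zu]].
  by apply: (@connect_trans _ _ u); apply: connect1; rewrite // adj_sym.
pose D := S :|: [set w; w'].
have cs : connect_sym (adj K) by apply: sym_connect_sym; apply: adj_sym.
have cn : conn K D.
  suff h x : x \in D -> connect (adj K) x y.
    by move=> x z xD zD; apply: connect_trans (h _ xD) _; rewrite cs; apply: h.
  have hw : connect (adj K) w y by rewrite cs; apply: connect1.
  rewrite !inE => /or3P[xS|/eqP->|/eqP->] //; first exact: conS.
  by apply: connect_trans hw; apply: connect1; rewrite adj_sym.
have [H [KH pfH em]] := edge_max_exists pf; have {}em := em D.
have cnH := connS KH cn.
have SD : S \subset D by apply: subsetUl.
(* The choice of [x] bounds all missing degrees. The minimum degrees in [S] and [S :\ x] then add up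
   to at least [2 * s - 3] minus the number of missing edges, that is to [s + 1], as
   [kopylov_adjacent] demands for [k = s + 2]. *)
have [x xS xmax] : exists2 x, x \in S & forall z, z \in S -> deg M S z <= deg M S x.
  by case: (arg_maxnP (deg M S) yS) => x xS h; exists x.
have := ein_rem M xS; set nu := ein M (S :\ x) => e1.
have cl1 u v : u \in S -> v \in S :\ x -> u != v -> adj H u v.
  apply: (@kopylov_adjacent _ H D (s + 2) S (S :\ x) (s - 1 - deg M S x) (s - 2 - nu)) => //; try flia.
  - by apply: subset_trans SD; apply: subD1set.
  - move=> z zS; have := dc _ zS; have := xmax _ zS.
    by have := @degS _ K H S S z KH (subxx _); flia.
  move=> z zS; have := deg_compl K zS.
  have := cardsD1 x S; rewrite xS -/s => cx.
  have dM : deg (pairs_in (S :\ x) :\: K) (S :\ x) z <= nu.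
    apply: leq_trans (deg_le_ein M zS); apply: degS => //.
    by rewrite setSD // pairs_inS // subD1set.
  by have := @degS _ K H (S :\ x) (S :\ x) z KH (subxx _); flia.
have cl u v : u \in S -> v \in S -> u != v -> adj H u v.
  move=> uS vS nuv; have [vx|vx] := eqVneq v x.
    by rewrite adj_sym; apply: cl1; rewrite // ?inE ?uS // -?vx ?nuv // eq_sym.
  by apply: cl1 => //; rewrite !inE vx.
have := pathfreeP _ _ pfH (w' :: w :: y :: enum (S :\ y)).
have U : uniq (y :: enum (S :\ y)) by rewrite /= mem_enum !inE eqxx enum_uniq.
have nin z : z \notin S -> z \notin y :: enum (S :\ y).
  move=> zS; rewrite inE mem_enum !inE (negPf zS) andbF orbF.
  by apply: contraNneq zS => ->.
have Uw : uniq (w :: y :: enum (S :\ y)) by rewrite cons_uniq U nin.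
have Uw' : uniq (w' :: w :: y :: enum (S :\ y)).
  by rewrite cons_uniq Uw inE negb_or (nin w') // eq_sym (adj_neq ww').
move=> /(_ Uw') h.
have /h : sorted (adj H) [:: w', w, y & enum (S :\ y)].
  rewrite /= adj_sym (adjS KH ww') adj_sym (adjS KH yw) /=.
  apply: (@clique_sorted H (y :: enum (S :\ y)) _ U).
  by move=> u v; rewrite !inE !mem_enum !inE => /orP[/eqP->|/andP[_ uS]] /orP[/eqP->|/andP[_ vS]];
    apply: cl.
by rewrite /= -cardE; have := cardsD1 y S; rewrite yS -/s; flia.
Qed.

Lemma outside_nbr E D s : conn E D -> size s < #|D| -> {subset s <= D} -> 0 < size s ->
  exists u w, [/\ u \in s, w \notin s & adj E u w].
Proof.
move=> cn sD sub s0; have /subsetPn[z zD zs] : ~~ (D \subset s).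
  by apply/negP => /subset_leq_card h; have := leq_trans h (card_size s); flia.
have [x xs] : exists x, x \in s by case: (s) s0 => // x s' _; exists x; rewrite inE eqxx.
have /connectP[p pp ez] := cn x z (sub _ xs) zD.
have [u [w [uS wS uw]]] := @path_cross _ (mem s) _ _ pp xs ltac:(by rewrite -ez).
by exists u, w.
Qed.

End Kopylov.

(** * Rainbow edge sets and almost complete sets of k - 2 vertices *)

Section Rainbow.
Variables (V : finType) (col : {set V} -> nat).
Implicit Types (E F : {set {set V}}) (S : {set V}).

Definition rainbow E := (E \subset pairs_in [set: V]) && [forall e in E, forall g in E, (col e == col g) ==> (e == g)].

Lemma rainbowP E : reflect (E \subset pairs_in [set: V] /\ {in E &, injective col}) (rainbow E).
Proof.
apply: (iffP andP) => -[sE h]; split => //.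
  by move=> e g eE gE ce; move/forall_inP: h => /(_ e eE)/forall_inP/(_ g gE); rewrite ce eqxx => /eqP.
by apply/forall_inP => e eE; apply/forall_inP => g gE; apply/implyP => /eqP /h ->.
Qed.

Lemma rainbow_subset E F : F \subset E -> rainbow E -> rainbow F.
Proof.
move=> sF /rainbowP[sE i]; apply/rainbowP; split; first exact: subset_trans sE.
by move=> e g /(subsetP sF) eE /(subsetP sF) gE; apply: i.
Qed.

Lemma rainbow_add E e : rainbow E -> e \in pairs_in [set: V] ->
  (forall g, g \in E -> col g = col e -> g = e) -> rainbow (e |: E).
Proof.
move=> /rainbowP[sE i] eP h; apply/rainbowP; split; first by rewrite subUset sub1set eP.
move=> a b; rewrite !in_setU1 => /orP[/eqP->|aE] /orP[/eqP->|bE] c //; last exact: i.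
  by rewrite (h b).
exact: h.
Qed.

Lemma rainbow_single E c : rainbow E -> #|[set e in E | col e == c]| <= 1.
Proof.
move=> /rainbowP[_ i]; apply/card_le1P => e; rewrite inE => /andP[eE /eqP ec] g.
rewrite !inE; apply/andP/eqP => [[gE /eqP gc]|-> //]; first by apply: i; rewrite // gc.
by rewrite eE ec eqxx.
Qed.

Variable k : nat.
Hypothesis no_rainbow_path : forall E, rainbow E -> pathfree k E.

(** If the pairs [yw] and [ww'], with only [y] in [S], had two colours, adding both and deleting the
    edges of these colours would create a path on [k] vertices. So all pairs not inside [S] share
    one colour. The deletion costs at most two edges, whence 6 in place of the 4 in
    [near_clique_path]. *)
Lemma dense_set_bound E S :
  rainbow E -> #|S| + 2 = k -> k <= #|V| -> 'C(#|S|, 2) + 6 <= ein E S + #|S| ->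
  #|E| <= 'C(#|S|, 2) + 1.
Proof.
move=> rE sk kV dS.
have sE : E \subset pairs_in [set: V] by case/rainbowP: rE.
have same y w w' : y \in S -> w \notin S -> w' \notin S -> w != w' ->
    col [set y; w] = col [set w; w'].
  move=> yS wS w'S nww; apply/eqP/negPn/negP => nc.
  have nyw : y != w by apply: contraNneq wS => <-.
  pose E0 := [set e in E | (col e != col [set y; w]) && (col e != col [set w; w'])].
  pose K := [set w; w'] |: ([set y; w] |: E0).
  have p2 a b : a != b -> [set a; b] \in pairs_in [set: V].
    by move=> n; rewrite pair_pairs_in // !inE.
  have rK : rainbow K.
    apply: rainbow_add; [apply: rainbow_add| |] => //; try exact: p2.
    - by apply: rainbow_subset rE; apply/subsetP => e; rewrite inE => /andP[].
    - by move=> g; rewrite inE => /and3P[_ /eqP g1 _] /g1.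
    move=> g; rewrite !inE => /orP[/eqP->|/and3P[_ _ /eqP g1]]; last by move/g1.
    by move/eqP: nc.
  have := no_rainbow_path rK; apply/negP; rewrite -sk.
  apply: (@near_clique_path _ K S y w w') => //; last 2 first.
  - by rewrite /adj nyw !inE eqxx orbT.
  - by rewrite /adj nww !inE eqxx.
  suff : ein E S <= ein K S + 2 by flia.
  pose C c := [set e in E | col e == c].
  apply: (@leq_trans #|(K :&: pairs_in S) :|: (C (col [set y; w]) :|: C (col [set w; w']))|).
    apply: subset_leq_card; apply/subsetP => e; rewrite !in_setU !inE => /andP[eE ->].
    rewrite eE /=; case: (col e == col [set y; w]); case: (col e == col [set w; w']);
      by rewrite ?orbT ?andbT.
  apply: leq_trans (leq_card_setU _ _) _; rewrite leq_add2l.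
  apply: leq_trans (leq_card_setU _ _) _.
  by apply: (@leq_add _ _ 1 1); apply: rainbow_single.
have : 1 < #|~: S| by have := cardsC S; flia.
case/card_gt1P => w0 [w1 []]; rewrite !inE => w0S w1S n01.
have : 0 < #|S|.
  have := ein_le E S; flia.
case/card_gt0P => y0 y0S.
pose c0 := col [set y0; w0].
have cy y w : y \in S -> w \notin S -> col [set y; w] = c0.
  move=> yS wS; have [->|n] := eqVneq w w0; first by rewrite (same y w0 w1) // -(same y0 w0 w1).
  by rewrite (same y w w0) // setUC -(same y0 w0 w) // eq_sym.
have cw w w' : w \notin S -> w' \notin S -> w != w' -> col [set w; w'] = c0.
  by move=> wS w'S n; rewrite -(same y0 w w') // cy.
rewrite -(cardsID (pairs_in S) E); apply: leq_add; first exact: ein_le.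
apply: leq_trans (rainbow_single c0 rE); apply: subset_leq_card.
apply/subsetP => e; rewrite in_setD inE => /andP[eS eE]; rewrite eE /=.
have /pairs_inP[x [y [_ _ nxy ee]]] := subsetP sE _ eE.
move: eS; rewrite ee pair_pairs_in // negb_and.
have [xS|xS] := boolP (x \in S); have [yS|yS] := boolP (y \in S) => // _.
- by rewrite cy.
- by rewrite setUC cy.
by rewrite cw.
Qed.

End Rainbow.

(** * Suzuki's dichotomy *)

Section Components.
Variable V : finType.
Implicit Types (E F : {set {set V}}) (x y u v : V).

Lemma adj_csym F : connect_sym (adj F).
Proof. by apply: sym_connect_sym; apply: adj_sym. Qed.

Lemma connect_subset E F x y : E \subset F -> connect (adj E) x y -> connect (adj F) x y.
Proof. by move=> sE; apply: connect_sub => u v uv; apply: connect1; apply: adjS uv. Qed.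

Definition ncomp F := #|[set x | root (adj F) x == x]|.

Lemma ncomp_lt E F u v :
  E \subset F -> connect (adj F) u v -> ~~ connect (adj E) u v -> ncomp F < ncomp E.
Proof.
move=> sE cuv nuv; rewrite /ncomp.
have csF := adj_csym F; have csE := adj_csym E.
have rF x y : (root (adj F) x == root (adj F) y) = connect (adj F) x y by apply: root_connect.
have rE x y : (root (adj E) x == root (adj E) y) = connect (adj E) x y by apply: root_connect.
have rFE x : root (adj F) (root (adj E) x) = root (adj F) x.
  by apply/eqP; rewrite rF csF; apply: connect_subset sE (connect_root _ _).
have rr G x : root (adj G) (root (adj G) x) = root (adj G) x by apply: root_root; apply: adj_csym.
set A := [set x | root (adj F) x == x].
rewrite -(@card_in_imset _ _ (root (adj E)) (mem A)); last first.
  move=> x y; rewrite !inE => /eqP xF /eqP yF e.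
  by rewrite -xF -yF -(rFE x) e rFE.
apply: proper_card; apply/properP; split.
  by apply/subsetP => z /imsetP[x xA ->]; rewrite inE rr.
have im z : root (adj E) z \in root (adj E) @: A -> root (adj E) z = root (adj E) (root (adj F) z).
  by case/imsetP=> r; rewrite inE => /eqP rA e; rewrite e; congr root; rewrite -(rFE z) e rFE.
have [uI|uI] := boolP (root (adj E) u \in root (adj E) @: A); last first.
  by exists (root (adj E) u) => //; rewrite inE rr.
exists (root (adj E) v); first by rewrite inE rr.
apply: contra nuv => vI; rewrite -rE (im _ uI) (im _ vI).
by move: cuv; rewrite -rF => /eqP ->.
Qed.

Definition bridge F u v := ~~ connect (adj (F :\ [set u; v])) u v.

(** A bridge stays a bridge when other edges are deleted, so the edges of [B] can be deleted one at
    a time, each adding a component. *)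
Lemma ncomp_bridges F (B : {set {set V}}) : B \subset F ->
  (forall e, e \in B -> exists u v, [/\ e = [set u; v], u != v & bridge F u v]) ->
  ncomp F + #|B| <= ncomp (F :\: B).
Proof.
have [m] := ubnP #|B|; elim: m B => // m IH B lt sB br.
have [->|/set0Pn[e eB]] := eqVneq B set0; first by rewrite cards0 addn0 setD0.
have cB := cardsD1 e B; rewrite eB in cB.
have IHe := IH (B :\ e) ltac:(flia) (subset_trans (subD1set _ _) sB)
  ltac:(by move=> g /setD1P[_ /br]).
have [u [v [ee nuv buv]]] := br _ eB.
have : ncomp (F :\: (B :\ e)) < ncomp (F :\: B).
  apply: (@ncomp_lt _ _ u v).
  - by apply: setDS; apply: subD1set.
  - by apply: connect1; rewrite /adj nuv -ee !inE eqxx (subsetP sB).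
  apply: contra buv; apply: connect_subset; apply/subsetP => g.
  rewrite !inE => /andP[gB gF]; rewrite gF andbT -ee.
  by apply: contraNneq gB => ->.
flia.
Qed.

Lemma connect_del F u v x y : connect (adj (F :\ [set u; v])) u v ->
  connect (adj F) x y -> connect (adj (F :\ [set u; v])) x y.
Proof.
move=> cuv; apply: connect_sub => a b /andP[nab ab].
have [e|ne] := eqVneq [set a; b] [set u; v].
  by case/set2_eq: e => -[-> ->] //; rewrite adj_csym.
by apply: connect1; rewrite /adj nab !inE ne.
Qed.

Lemma connect_add F x y u v : connect (adj F) x y ->
  connect (adj ([set x; y] |: F)) u v = connect (adj F) u v.
Proof.
move=> cxy; apply/idP/idP; last by apply: connect_subset; apply: subsetUr.
apply: connect_sub => a b; rewrite adjU1 => /orP[|/andP[_ /eqP e]]; first exact: connect1.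
by case/set2_eq: e => -[-> ->] //; rewrite adj_csym.
Qed.

End Components.

Section Dichotomy.
Variables (V : finType) (col : {set V} -> nat).
Implicit Types (E F : {set {set V}}) (x y u v : V).
Notation rainbow := (rainbow col).
Notation allpairs := (pairs_in [set: V]).

Definition full E := rainbow E && [forall e in allpairs, exists g in E, col g == col e].

Lemma fullP E : reflect (rainbow E /\ forall e, e \in allpairs -> exists2 g, g \in E & col g = col e)
  (full E).
Proof.
apply: (iffP andP) => -[rE h]; split => //.
  by move=> e eP; move/forall_inP: h => /(_ e eP)/exists_inP[g gE /eqP]; exists g.
by apply/forall_inP => e /h[g gE ge]; apply/exists_inP; exists g => //; apply/eqP.
Qed.

(** Used in both directions it gives all full sets the same size, so that [E0] may be replaced by a
    full set with more connected pairs. *)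
Lemma rainbow_le_full E F : rainbow E -> full F -> #|E| <= #|F|.
Proof.
move=> /rainbowP[sE iE] /fullP[rF hF].
pose f e := odflt set0 [pick g in F | col g == col e].
have fP e : e \in E -> f e \in F /\ col (f e) = col e.
  move=> eE; rewrite /f; case: pickP => [g /andP[gF /eqP ge] //|no].
  by have [g gF ge] := hF _ (subsetP sE _ eE); have := no g; rewrite gF ge eqxx.
rewrite -(@card_in_imset _ _ f (mem E)).
  by apply: subset_leq_card; apply/subsetP => g /imsetP[e /fP[? _] ->].
move=> e g eE gE fe; have [_ c1] := fP _ eE; have [_ c2] := fP _ gE.
by apply: iE => //; rewrite -c1 -c2 fe.
Qed.

Lemma full_swap E e g : full E -> e \in allpairs -> g \in E -> col g = col e ->
  full (e |: (E :\ g)).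
Proof.
move=> /fullP[rE hE] eP gE ge; apply/fullP; split.
  apply: rainbow_add => //; first by apply: rainbow_subset rE; apply: subD1set.
  move=> h /setD1P[hg hE'] hc; case/rainbowP: rE => _ iE; case/eqP: hg.
  by apply: iE; rewrite // hc ge.
move=> a aP; have [h hE' ha] := hE _ aP.
have [hg|hg] := eqVneq h g; last by exists h => //; rewrite !inE hE' hg orbT.
by exists e; rewrite ?inE ?eqxx // -ge -hg.
Qed.

Definition crossing_color F c :=
  [exists x, exists y, [&& x != y, ~~ connect (adj F) x y & col [set x; y] == c]].

Lemma crossing_colorP F c :
  reflect (exists x y, [/\ x != y, ~~ connect (adj F) x y & col [set x; y] = c])
          (crossing_color F c).
Proof.
apply: (iffP existsP) => [[x /existsP[y /and3P[? ? /eqP]]]|[x [y [n c1 <-]]]].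
  by exists x, y.
by exists x; apply/existsP; exists y; rewrite n c1 eqxx.
Qed.

Definition prune F := [set g in F | ~~ crossing_color F (col g)].
Definition npairs E := #|[set p : V * V | connect (adj E) p.1 p.2]|.
Definition max_full E := full E /\ forall E', full E' -> npairs E' <= npairs E.

Lemma prune_sub F : prune F \subset F.
Proof. by apply/subsetP => g; rewrite inE => /andP[]. Qed.

Lemma iter_prune_sub j F : iter j prune F \subset F.
Proof. by elim: j => //= j IH; apply: subset_trans (prune_sub _) IH. Qed.

Lemma iter_pruneS i j F : i <= j -> iter j prune F \subset iter i prune F.
Proof. by move=> ij; rewrite -(subnK ij) iterD iter_prune_sub. Qed.

Lemma eq_crossing E F c : (forall x y, connect (adj E) x y = connect (adj F) x y) ->
  crossing_color E c = crossing_color F c.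
Proof. by move=> h; apply: eq_existsb => x; apply: eq_existsb => y; rewrite h. Qed.

(** The induction on [j] is for all [E] at once, as it passes to the set [E'] in which [xy] replaces
    [g]. If [g] were no bridge, this exchange would not change connectivity up to round [j], so [E']
    is pruned in parallel with [E]. A path from [x] to [y] in round [j] uses an edge [ab] deleted in
    the next round. By induction [ab] is a bridge for [E'], although the rest of the path together
    with [xy] bypasses it. *)
Lemma pruned_bridge j E x y g u v : max_full E ->
  g \in iter j prune E -> g = [set u; v] -> u != v -> x != y ->
  ~~ connect (adj (iter j prune E)) x y ->
  col g = col [set x; y] -> bridge (iter j prune E) u v.
Proof.
elim: j E x y g u v => [|j IH] E x y g u v mE gF eg nuv nxy nc cg; apply/negP => cuv;
  have [fE maxE] := mE; have gE : g \in E := subsetP (iter_prune_sub _ _) _ gF;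
  have eP : [set x; y] \in allpairs by [rewrite pair_pairs_in // !inE];
  have fE' := full_swap fE eP gE cg; set E' := _ |: _ in fE'.
  have : npairs E < npairs E'.
    apply: proper_card; apply/properP; split.
      apply/subsetP => -[a b]; rewrite !inE /= => cab; apply: connect_subset (subsetUr _ _) _.
      by rewrite eg; apply: connect_del.
    exists (x, y); last by rewrite inE.
    by rewrite inE /=; apply: connect1; rewrite /adj nxy !inE eqxx.
  by rewrite ltnNge maxE.
set F := iter j.+1 prune E in gF nc cuv *.
have sF a : a <= j.+1 -> F \subset iter a prune E by move=> aj; apply: iter_pruneS.
(* [g] survives round [a + 1], so its colour, which is that of [xy], does not cross the components
   of round [a]. *)
have inF a : a <= j -> connect (adj (iter a prune E)) x y.
  move=> aj; have : g \in iter a.+1 prune E by apply: (subsetP (sF _ _)).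
  rewrite /= inE => /andP[_]; apply: contraNT => nc'; apply/crossing_colorP.
  by exists x, y.
have same a : a <= j -> forall p q, connect (adj ([set x; y] |: (iter a prune E :\ g))) p q
     = connect (adj (iter a prune E)) p q.
  move=> aj p q.
  have cuv' : connect (adj (iter a prune E :\ [set u; v])) u v.
    by apply: connect_subset cuv; apply: setSD; apply: sF; flia.
  rewrite connect_add; last by rewrite eg; apply: connect_del (inF _ aj).
  apply/idP/idP; first by apply: connect_subset; apply: subD1set.
  by rewrite eg; apply: connect_del.
have eF' a : a <= j.+1 -> iter a prune E' = [set x; y] |: (iter a prune E :\ g).
  elim: a => // a IHa aj; rewrite /= IHa 1?ltnW //.
  apply/setP => h; rewrite in_setU1 in_setD1 [in LHS]inE [h \in prune _]inE.
  rewrite (eq_crossing _ (same a _)) // in_setU1 in_setD1.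
  have [->|_] := eqVneq h [set x; y]; last by rewrite /= andbA.
  have : g \in iter a.+1 prune E by apply: (subsetP (sF _ _)).
  by rewrite /= inE -cg => /andP[_ ->].
have mE' : max_full E'.
  split=> // E2 fE2; apply: leq_trans (maxE _ fE2) _.
  by apply: eq_leq; apply: eq_card => -[p q]; rewrite !inE /= -(same 0).
have cxy : connect (adj (iter j prune E :\ g)) x y.
  rewrite eg; apply: connect_del; last exact: inF.
  by apply: connect_subset cuv; apply: setSD; apply: sF; flia.
case/connectP: cxy => p0 pp0 ey; case/shortenP: pp0 ey => p pp Up _ ey.
have nF : ~~ connect (adj F) x (last x p) by rewrite -ey.
have [p1 [b [p2 [ep nab]]]] : exists p1 b p2, p = p1 ++ b :: p2 /\
    ~~ connect (adj F) (last x p1) b.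
  elim/last_ind: p nF {pp Up ey} => [|p b IHp] /=; first by rewrite connect0.
  rewrite last_rcons => nb; have [cl|/IHp[p1 [b' [p2 [e ?]]]]] := boolP (connect (adj F) x (last x p)).
    exists p, b, [::]; split; first by rewrite cats1.
    by apply: contra nb; apply: connect_trans.
  by exists p1, b', (rcons p2 b); split => //; rewrite e -rcons_cons -rcons_cat.
set a := last x p1 in nab.
have pp' := pp; rewrite ep cat_path /= -/a in pp'; case/and3P: pp' => pp1 hab pp2.
have {}Up : uniq ((x :: p1) ++ b :: p2) by rewrite /= -ep.
have hF : [set a; b] \in iter j prune E.
  by case/andP: hab => _; rewrite inE => /andP[].
have nabE : a != b by apply: adj_neq hab.
have : [set a; b] \notin F.
  by apply: contra nab => h; apply: connect1; rewrite /adj nabE.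
(* Since [ab] was deleted in the last round, its colour occurs on a pair [x2 y2] crossing the
   components of round [j]. *)
rewrite /F /= inE hF /= negbK => /crossing_colorP[x2 [y2 [n2 c2 k2]]].
have ejF := eF' j (leqnSn j).
have xyE : [set x; y] != [set a; b].
  apply: contraNneq nc => e; apply: connect1; rewrite /adj nxy /=.
  have [_] := fullP _ fE; have [_ iE] := rainbowP _ _ (proj1 (fullP _ fE)).
  have : [set x; y] = g.
    by apply: iE; rewrite ?cg // e; apply: (subsetP (iter_prune_sub j E)).
  by move=> ->.
have hF' : [set a; b] \in iter j prune E'.
  rewrite ejF in_setU1 in_setD1 hF andbT; case/andP: hab => _.
  by rewrite in_setD1 => /andP[-> _]; rewrite orbT.
have := IH E' x2 y2 _ a b mE' hF' erefl nabE n2.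
rewrite ejF same // => /(_ c2 (esym k2)) /negP; apply.
have aIn : a \in x :: p1 by apply: mem_last.
have nb z : z \in x :: p1 -> z != b.
  move=> zp; apply: contraTneq Up => zb; rewrite cat_uniq; apply/negP => /and3P[_ /hasPn/(_ b)].
  by rewrite inE eqxx -zb zp => /(_ isT).
have na z : z \in b :: p2 -> z != a.
  move=> zp; apply: contraTneq Up => zb; rewrite cat_uniq; apply/negP => /and3P[_ /hasPn/(_ z)].
  by move=> /(_ zp) /negP h _; apply: h; rewrite zb.
set G := (_ |: _) :\ _.
have GP z w : adj (iter j prune E :\ g) z w -> [set z; w] != [set a; b] -> adj G z w.
  by case/andP=> nzw h1 h2; rewrite /adj nzw /G in_setD1 h2 in_setU1 h1 orbT.
have c1 : connect (adj G) x a.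
  apply/connectP; exists p1 => //; apply: (@sub_in_path _ (mem (x :: p1)) _ _ _ x p1 _ pp1).
    move=> z w zp wp h; apply: GP h _; apply/eqP => e; have : b \in [set z; w] by rewrite e !inE eqxx orbT.
    by rewrite !inE => /orP[] /eqP eb; [have := nb z zp|have := nb w wp]; rewrite eb eqxx.
  exact/allP.
have c3 : connect (adj G) b y.
  apply/connectP; exists p2; last by rewrite ey ep last_cat.
  apply: (@sub_in_path _ (mem (b :: p2)) _ _ _ b p2 _ pp2).
    move=> z w zp wp h; apply: GP h _; apply/eqP => e; have : a \in [set z; w] by rewrite e !inE eqxx.
    by rewrite !inE => /orP[] /eqP eb; [have := na z zp|have := na w wp]; rewrite eb eqxx.
  exact/allP.
rewrite adj_csym in c1; apply: connect_trans c1 _; rewrite adj_csym in c3.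
apply: connect_trans c3; apply: connect1.
by rewrite /adj nxy /G in_setD1 xyE in_setU1 eqxx.
Qed.

(** All deleted edges are bridges, so a round adds at least as many components as it removes
    edges. *)
Lemma prune_ncomp j E : max_full E ->
  ncomp E + #|E| <= ncomp (iter j prune E) + #|iter j prune E|.
Proof.
move=> mE; elim: j => //= j IH; apply: leq_trans IH _.
set F := iter j prune E.
have eF : prune F = F :\: (F :\: prune F).
  by rewrite setDDr setDv set0U; apply/esym/setIidPr; apply: prune_sub.
have := @ncomp_bridges _ F (F :\: prune F) (subsetDl _ _).
rewrite -eF => h; have := cardsID (prune F) F.
rewrite (setIidPr (prune_sub F)); suff : ncomp F + #|F :\: prune F| <= ncomp (prune F) by flia.
apply: h => e; rewrite in_setD inE => /andP[]; case eF' : (e \in F) => //=.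
rewrite negbK => /crossing_colorP[x [y [nxy cxy cc]]] _.
have [rE _] := fullP _ (proj1 mE); have [sE _] := rainbowP _ _ rE.
have /pairs_inP[u [v [_ _ nuv ee]]] := subsetP sE _ (subsetP (iter_prune_sub j E) _ eF').
exists u, v; split=> //.
by apply: (@pruned_bridge j E x y e u v).
Qed.

Lemma prune_stable E : exists j, prune (iter j prune E) = iter j prune E.
Proof.
suff h m : (exists2 j, j < m & prune (iter j prune E) = iter j prune E) \/
    #|iter m prune E| + m <= #|E|.
  case: (h #|E|.+1) => [[j _]|]; first by exists j.
  flia.
elim: m => [|m [[j jm]|le]]; first by right; rewrite addn0.
  by left; exists j => //; flia.
have [e|ne] := eqVneq (prune (iter m prune E)) (iter m prune E); first by left; exists m.
right; have : prune (iter m prune E) \proper iter m prune E by rewrite properEneq ne prune_sub.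
by move/proper_card => /=; flia.
Qed.

Theorem suzuki_dichotomy E0 : full E0 -> exists E, [/\ full E, #|E| = #|E0| &
  conn E [set: V] \/
  exists F, [/\ F \subset E, #|E| + 2 <= ncomp F + #|F| &
    forall x y g, ~~ connect (adj F) x y -> g \in F -> col g != col [set x; y]]].
Proof.
move=> fE0; case: (arg_maxnP npairs fE0) => E fE mE.
exists E; split => //.
  have [rE _] := fullP _ fE; have [rE0 _] := fullP _ fE0.
  by have := rainbow_le_full rE fE0; have := rainbow_le_full rE0 fE; flia.
have mxE : max_full E by split.
have [/forallP h|] := boolP [forall x, forall y, connect (adj E) x y].
  by left => x y _ _; have /forallP := h x; apply.
rewrite negb_forall => /existsP[x]; rewrite negb_forall => /existsP[y nxy].
right; have [j ej] := prune_stable E; exists (iter j prune E); split.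
- exact: iter_prune_sub.
(* The summand 2: a disconnected [E] has at least two components. *)
- have := prune_ncomp j mxE; suff : 1 < ncomp E by flia.
  apply/card_gt1P; exists (root (adj E) x), (root (adj E) y).
  rewrite !inE !root_root ?eqxx; try exact: adj_csym.
  by rewrite root_connect //; apply: adj_csym.
move=> x' y' g nc gF; apply: contraL gF => /eqP cg; rewrite -ej inE negb_and negbK.
apply/orP; right; apply/crossing_colorP; exists x', y'; split=> //.
by apply: contraNneq nc => ->; apply: connect0.
Qed.

End Dichotomy.

(** * Glueing components *)

Section Glue.
Variables (V : finType) (F : {set {set V}}) (r0 : V).
Implicit Types (x y a b : V) (s : seq V).
Hypothesis r0_root : root (adj F) r0 = r0.
Hypothesis F_pairs : F \subset pairs_in [set: V].

(** The representatives of all components are identified with the single vertex [r0]. The glued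
    graph keeps the vertex type [V] and lives on [glued_dom]. *)
Definition glue x := if root (adj F) x == x then r0 else x.
Definition glued : {set {set V}} := [set glue @: (e : {set V}) | e in F].
Definition glued_dom : {set V} := r0 |: [set x | root (adj F) x != x].

Lemma adj_root x y : adj F x y -> root (adj F) x = root (adj F) y.
Proof. by move=> a; apply/eqP; rewrite root_connect; [apply: connect1 | apply: adj_csym]. Qed.

Lemma root_rootF x : root (adj F) (root (adj F) x) = root (adj F) x.
Proof. by apply: root_root; apply: adj_csym. Qed.

Lemma glue_root x : root (adj F) x = x -> glue x = r0.
Proof. by rewrite /glue => ->; rewrite eqxx. Qed.

Lemma glue_id x : glue x != r0 -> glue x = x /\ root (adj F) x != x.
Proof. by rewrite /glue; case: ifP => //; rewrite eqxx. Qed.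

Lemma glue_dom x : x \in glued_dom -> glue x = x.
Proof.
rewrite !inE => /orP[/eqP->|h]; first by rewrite glue_root.
by rewrite /glue (negPf h).
Qed.

Lemma glue_in x : glue x \in glued_dom.
Proof. by rewrite /glue !inE; case: ifP => [|->]; rewrite ?eqxx ?orbT. Qed.

Lemma glue_neq x y : adj F x y -> glue x != glue y.
Proof.
move=> a; have := adj_root a; have := adj_neq a; rewrite /glue.
case: (root _ x =P x) => [rx|rx]; case: (root _ y =P y) => [ry|ry] n e //.
- by rewrite -rx -ry e eqxx in n.
- by apply: contra_notN ry => /eqP <-.
by apply: contra_notN rx => /eqP ->.
Qed.

Lemma glue_pair x y : glue @: [set x; y] = [set glue x; glue y].
Proof. by rewrite imsetU1 imset_set1. Qed.

Lemma adj_glue x y : adj F x y -> adj glued (glue x) (glue y).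
Proof.
move=> a; rewrite /adj glue_neq //=; apply/imsetP; exists [set x; y]; last by rewrite glue_pair.
by case/andP: a.
Qed.

Lemma edgeF e : e \in F -> exists x y, e = [set x; y] /\ adj F x y.
Proof.
move=> eF; have /pairs_inP[x [y [_ _ n ee]]] := subsetP F_pairs _ eF.
by exists x, y; split => //; rewrite /adj n -ee.
Qed.

Lemma glued_adj a b : adj glued a b -> exists x y, [/\ adj F x y, glue x = a & glue y = b].
Proof.
case/andP=> n /imsetP[e eF]; have [x [y [-> axy]]] := edgeF eF.
rewrite glue_pair => /set2_eq[[-> ->]|[-> ->]]; first by exists x, y.
by exists y, x; rewrite adj_sym.
Qed.

Lemma glued_sub : glued \subset pairs_in glued_dom.
Proof.
apply/subsetP => e /imsetP[g gF ->]; have [x [y [-> a]]] := edgeF gF.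
by rewrite glue_pair pair_pairs_in ?glue_neq // !glue_in.
Qed.

(** No two edges collapse: at most one end of an edge is a root, and this root is determined by the
    component of the other end. *)
Lemma card_glued : #|glued| = #|F|.
Proof.
rewrite card_in_imset // => e g /edgeF[x [y [-> a]]] /edgeF[x' [y' [-> a']]].
have inj u v u' v' : adj F u v -> adj F u' v' -> glue u = glue u' -> glue v = glue v' ->
    [set u; v] = [set u'; v'].
  move=> b b' eu ev; have nb := glue_neq b.
  have sp p q : glue p != r0 -> glue p = glue q -> p = q.
    by move=> h epq; have [p1 _] := glue_id h; rewrite epq in h; have [q1 _] := glue_id h; rewrite -p1 epq.
  have rr p q : adj F p q -> glue p = r0 -> glue q != r0 -> p = root (adj F) q.
    move=> apq gp gq; rewrite -(adj_root apq); move: gp; rewrite /glue; case: eqP => // _ gp.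
    by rewrite gp r0_root.
  have [u0|u0] := eqVneq (glue u) r0.
    have v0 : glue v != r0 by rewrite -u0 eq_sym.
    have vv := sp _ _ v0 ev; rewrite (rr _ _ b u0 v0) vv; congr [set _; _]; apply/esym.
    by apply: rr b' _ _; rewrite -?eu // -ev.
  have uu := sp _ _ u0 eu; rewrite uu.
  have [v0|v0] := eqVneq (glue v) r0; last by rewrite (sp _ _ v0 ev).
  rewrite adj_sym in b; rewrite adj_sym in b'.
  rewrite (rr _ _ b v0 u0) uu; congr [set _; _]; apply/esym.
  by apply: rr b' _ _; rewrite -?ev // -eu.
rewrite !glue_pair => /set2_eq[[e1 e2]|[e1 e2]]; first exact: inj.
by rewrite [RHS]setUC; apply: inj => //; rewrite adj_sym.
Qed.

Lemma card_glued_dom : #|glued_dom| + ncomp F = #|V| + 1.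
Proof.
rewrite cardsU1 inE r0_root eqxx /= /ncomp.
have := cardsC [set x | root (adj F) x == x].
have -> : ~: [set x | root (adj F) x == x] = [set x | root (adj F) x != x].
  by apply/setP => x; rewrite !inE.
flia.
Qed.

Lemma glued_conn : conn glued glued_dom.
Proof.
have h x : x \in glued_dom -> connect (adj glued) x r0.
  move=> xD; rewrite -[x](glue_dom xD) -(glue_root (root_rootF x)).
  have /connectP[p pp ->] := connect_root (adj F) x.
  elim: p {xD} x pp => [|y p IH] x /=; first by rewrite connect0.
  by case/andP=> a pp; apply: connect_trans (connect1 (adj_glue a)) (IH _ pp).
by move=> x y xD yD; apply: connect_trans (h _ xD) _; rewrite adj_csym; apply: h.
Qed.

Lemma adj_glued_nonroot a b : adj glued a b -> a != r0 -> b != r0 -> adj F a b.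
Proof.
case/glued_adj=> x [y [axy xa yb]] na nb; rewrite -xa in na; rewrite -yb in nb.
by have [ex _] := glue_id na; have [ey _] := glue_id nb; rewrite -xa -yb ex ey.
Qed.

Lemma adj_glued_root b : adj glued r0 b -> adj F (root (adj F) b) b.
Proof.
move=> a; have nb := adj_neq a; case/glued_adj: a => x [y [axy xa yb]].
rewrite -yb eq_sym in nb; have [ey _] := glue_id nb; rewrite -yb ey.
suff -> : root (adj F) y = x by [].
rewrite -(adj_root axy); move: xa; rewrite /glue; case: eqP => // nx xr.
by rewrite xr r0_root.
Qed.

Lemma sorted_glued s : sorted (adj glued) s -> r0 \notin s -> sorted (adj F) s.
Proof.
move=> ss rs; apply: (@sub_in_sorted _ [pred x | x != r0] _ _ _ s _ ss).
  by move=> a b; rewrite !inE => na nb ab; apply: adj_glued_nonroot.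
by apply/allP => x xs; rewrite inE; apply: contraNneq rs => <-.
Qed.

Lemma sorted_root_same s x y : sorted (adj F) s -> x \in s -> y \in s ->
  root (adj F) x = root (adj F) y.
Proof.
case: s => // z s /= pz; suff h w : w \in z :: s -> root (adj F) w = root (adj F) z.
  by move=> /h -> /h ->.
rewrite inE => /orP[/eqP-> //|ws].
have := path_connect pz; move=> /(_ w); rewrite inE ws orbT => /(_ isT) c.
by apply/esym/eqP; rewrite root_connect //; apply: adj_csym.
Qed.

Lemma glued_nonroot s x : sorted (adj glued) s -> 1 < size s -> x \in s -> x != r0 ->
  root (adj F) x != x.
Proof.
move=> ss sz xs nx.
have : x \in glued_dom.
  case/splitPr: xs ss sz => p1 p2; case/lastP: p1 => [|p1 y].
    case: p2 => // y p2 /= /andP[a _] _.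
    by case/andP: (adj_in glued_sub a).
  rewrite cat_rcons sorted_cat_cons /= => /and3P[_ a _] _.
  by case/andP: (adj_in glued_sub a).
by rewrite !inE (negPf nx).
Qed.

(** A path through [r0] splits into two paths of [F], each of which can be prolonged by the root of
    its own component. If the roots differ, these lie in two components and have one vertex more in
    total; if they agree, they form one path of [F]. A path inside one component leaves room for a
    single vertex of another. *)
Lemma glued_pathfree k : 1 < ncomp F -> 2 < k ->
  (forall p q x y, uniq p -> uniq q -> sorted (adj F) p -> sorted (adj F) q ->
     x \in p -> y \in q -> ~~ connect (adj F) x y -> size p + size q < k) ->
  pathfree (k - 1) glued.
Proof.
move=> nc k2 two; apply/pathfreeP => s us ss.
have one p : uniq p -> sorted (adj F) p -> size p < k - 1.
  case: p => [|x p] up sp; first by rewrite /=; flia.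
  case/card_gt1P: nc => r1 [r2 []]; rewrite !inE => /eqP e1 /eqP e2 n12.
  have [y ny] : exists y, ~~ connect (adj F) x y.
    have [c1|] := boolP (connect (adj F) x r1); last by exists r1.
    exists r2; apply: contra n12 => c2; rewrite -e1 -e2 root_connect; last exact: adj_csym.
    by rewrite adj_csym in c1; apply: connect_trans c1 c2.
  have := @two (x :: p) [:: y] x y up isT sp isT (mem_head _ _) (mem_head _ _) ny.
  by rewrite /=; flia.
have [rs|rs] := boolP (r0 \in s); last by apply: one => //; apply: sorted_glued.
have [sz1|sz1] := leqP (size s) 1; first by flia.
have nonroot x := @glued_nonroot s x ss sz1.
case/splitPr: rs us ss sz1 nonroot => s1 s2; rewrite cat_uniq sorted_cat_cons.
case/and3P=> us1 /=; rewrite negb_or => /andP[r1 ds] /andP[r2 us2] /andP[ss1 ss2] _ nonroot.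
have sr1 : sorted (adj F) s1.
  apply: sorted_glued => //; have := ss1; rewrite -cats1.
  by move=> h; move: (@take_sorted _ _ (size s1) _ h); rewrite take_size_cat.
have sr2 : sorted (adj F) s2 by apply: sorted_glued => //; apply: path_sorted ss2.
have P2 y p : s2 = y :: p -> uniq (root (adj F) y :: s2) /\ path (adj F) (root (adj F) y) s2.
  move=> e2; split.
    rewrite /= us2 andbT; apply/negP => rys.
    have /negP := nonroot (root (adj F) y) ltac:(by rewrite mem_cat inE rys !orbT)
      ltac:(by apply: contraNneq r2 => <-).
    by apply; apply/eqP; apply: root_rootF.
  rewrite e2 /=; apply/andP; split; last by move: sr2; rewrite e2.
  by apply: adj_glued_root; move: ss2; rewrite e2 /= => /andP[].
have P1 y p : s1 = rcons p y -> uniq (rcons s1 (root (adj F) y)) /\ sorted (adj F) (rcons s1 (root (adj F) y)).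
  move=> e1; split.
    rewrite rcons_uniq us1 andbT; apply/negP => rys.
    have /negP := nonroot (root (adj F) y) ltac:(by rewrite mem_cat rys)
      ltac:(by apply: contraNneq r1 => <-).
    by apply; apply/eqP; apply: root_rootF.
  rewrite e1 -[rcons (rcons _ _) _]cats1 cat_rcons sorted_cat_cons -e1 sr1 /= andbT adj_sym.
  apply: adj_glued_root; move: ss1; rewrite e1 -[rcons (rcons _ _) _]cats1 cat_rcons sorted_cat_cons /=.
  by rewrite andbT adj_sym => /andP[].
rewrite size_cat /=.
case: s2 => [|y2 p2] in us2 r2 ds ss2 sr2 P2 nonroot *.
  case/lastP: s1 => [|p1 y1] in us1 r1 ds ss1 sr1 P1 nonroot *; first by rewrite /=; flia.
  have [u1 q1] := P1 y1 p1 erefl; have := one _ u1 q1; rewrite !size_rcons /=; flia.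
have [u2 q2] := P2 y2 p2 erefl.
case/lastP: s1 => [|p1 y1] in us1 r1 ds ss1 sr1 P1 nonroot *.
  by have := one _ u2 q2; rewrite /=; flia.
have [u1 q1] := P1 y1 p1 erefl.
have [c|nc12] := boolP (connect (adj F) y1 y2).
  have re : root (adj F) y1 = root (adj F) y2.
    by apply/eqP; rewrite root_connect //; apply: adj_csym.
  have := one (rcons p1 y1 ++ root (adj F) y2 :: y2 :: p2); rewrite size_cat /= => h.
  suff : size (rcons p1 y1) + (size p2).+2 < k - 1 by flia.
  apply: h; last by rewrite sorted_cat_cons -re q1 re.
  rewrite -cat_rcons cat_uniq -re u1 us2 andbT andTb; apply/hasPn => z zs /=; rewrite mem_rcons inE negb_or.
  apply/andP; split.
    rewrite re; apply: contraTneq u2 => <-; by rewrite cons_uniq zs.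
  by move/hasPn: ds; apply.
have := two _ _ y1 y2 u1 u2 q1 q2; rewrite mem_rcons inE mem_rcons inE eqxx orbT.
rewrite inE inE eqxx orbT size_rcons /= => /(_ isT isT nc12); flia.
Qed.

End Glue.

(** * The bound in the disconnected case *)

Section CaseDisconnected.
Variables (V : finType) (col : {set V} -> nat) (k l f : nat).
Hypothesis no_rainbow_path : forall E : {set {set V}}, rainbow col E -> pathfree k E.
Let n := #|V|.
Hypothesis l_k : 2 * l + 1 <= k <= 2 * l + 2.
Hypothesis l_ge2 : 2 <= l.
Hypothesis k_le_n : k <= n.
(** In these hypotheses [N] stands for the order of the glued graph; the [n - N] lost vertices
    account for [n - N - 1] further edges of [E]. *)
Hypothesis bound_degenerate : forall N, k - 1 <= N -> N < n ->
  'C(l - 1, 2) + (l - 1) * (N - (l - 1)) + (n - N - 1) <= f.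
Hypothesis bound_core : forall N s, k - 1 <= N -> N < n -> l < s -> s + 3 <= k ->
  'C(s, 2) + (k - 2 - s) * (N - s) + (n - N - 1) <= f.
Hypothesis bound_small : forall N, 0 < N -> N + 3 <= k -> 'C(N, 2) + (n - N - 1) <= f.
Hypothesis bound_clique : 'C(k - 2, 2) + (n - k + 1) <= f \/ 'C(k - 2, 2) + (n - k) + 8 <= f + k.
Hypothesis bound_dense : 'C(k - 2, 2) + 1 <= f.

Lemma disconnected_bound (E F : {set {set V}}) :
  full col E -> F \subset E -> #|E| + 2 <= ncomp F + #|F| ->
  (forall x y g, ~~ connect (adj F) x y -> g \in F -> col g != col [set x; y]) ->
  #|E| <= f.
Proof.
have eqn : n = #|V| by [].
move=> /fullP[rE hE] FE cE cross; have [sE _] := rainbowP _ _ rE.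
have FP := subset_trans FE sE.
have rF : rainbow col F by apply: rainbow_subset rE.
have ncF : 1 < ncomp F by have := subset_leq_card FE; flia.
have [r0 r0r] : exists r, root (adj F) r = r.
  by case/card_gt1P: ncF => r [_ [+ _ _]]; rewrite inE => /eqP; exists r.
have two p q x y : uniq p -> uniq q -> sorted (adj F) p -> sorted (adj F) q ->
     x \in p -> y \in q -> ~~ connect (adj F) x y -> size p + size q < k.
  move=> up uq sp sq xp yq nxy.
  have r x' y' : x' \in p -> y' \in q -> ~~ connect (adj F) x' y'.
    move=> x'p y'q; apply: contra nxy => c; rewrite -root_connect; last exact: adj_csym.
    rewrite (sorted_root_same sp xp x'p) (sorted_root_same sq yq y'q) root_connect //.
    exact: adj_csym.
  have lp : last x p \in p by case: (p) xp => //= a p' _; apply: mem_last.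
  have hq : head y q \in q by case: (q) yq => //= a q' _; rewrite inE eqxx.
  have nlh : last x p != head y q by apply: contraNneq (r _ _ lp hq) => ->; apply: connect0.
  pose K := [set last x p; head y q] |: F.
  have rK : rainbow col K.
    apply: rainbow_add => //; first by rewrite pair_pairs_in // !inE.
    by move=> g gF /eqP; rewrite (negPf (cross _ _ _ (r _ _ lp hq) gF)).
  rewrite -size_cat; apply: (pathfreeP _ _ (no_rainbow_path rK)).
    rewrite cat_uniq up uq /= andbT; apply/hasPn => z zq; apply/negP => zp.
    by have := r z z zp zq; rewrite connect0.
  have FK : F \subset K by apply: subsetUr.
  apply: (@sorted_cat _ _ x).
  - by apply: sub_sorted sp => a b; apply: adjS.
  - by apply: sub_sorted sq => a b; apply: adjS.
  have -> : head x q = head y q by case: (q) yq.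
  by rewrite /adj nlh !inE eqxx.
have k3 : 2 < k by flia.
have pfG := glued_pathfree r0r FP ncF k3 two.
have cnG := glued_conn r0r.
have cD := card_glued_dom r0r; have cG := card_glued r0r FP.
have sG := glued_sub r0r FP.
set G := glued F r0 in pfG cnG cG sG; set D := glued_dom F r0 in cnG cD sG.
have eG : ein G D = #|F| by rewrite ein_full.
have Dn : #|D| < n by rewrite /n; flia.
have D0 : 0 < #|D| by apply/card_gt0P; exists r0; rewrite !inE eqxx.
have EF : #|E| <= #|F| + (n - #|D| - 1) by rewrite /n; flia.
have [kD|Dk] := leqP (k - 1) #|D|.
  have [S [SD P1 P2]] := @kopylov _ G D (k - 1) l pfG cnG ltac:(flia) ltac:(flia) kD.
  case: P2 => [S0|[lS Sk eS]].
    have := bound_degenerate kD Dn.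
    have := @ein_degenerate _ G D (l - 1) (l - 1) _ D (subxx _) ltac:(flia).
    rewrite eG => h.
    have : #|F| <= 'C(l - 1, 2) + (l - 1) * (#|D| - (l - 1)).
      apply: h => R RD lR; have [|x] := P1 R RD.
        by rewrite S0 subset0 -card_gt0; flia.
      by rewrite inE => /andP[_ xR] dx; exists x => //; flia.
    flia.
  have := bound_core kD Dn lS ltac:(flia); have := ein_le G S.
  have -> : k - 2 - #|S| = k - 1 - 1 - #|S| by flia.
  rewrite eG in eS; flia.
have [Dk3|Dk3] := leqP (#|D| + 3) k.
  by have := bound_small D0 Dk3; have := ein_le G D; rewrite eG; flia.
have eD : #|D| + 2 = k by flia.
(* In the remaining case the glued graph has [k - 2] vertices and may be almost complete. Then [F]
   has a single nontrivial component, contained in a set of [k - 2] vertices to which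
   [dense_set_bound] applies. *)
case: (leqP #|E| f) => // fE.
have eD' : #|D| = k - 2 by flia.
have eFC : #|F| <= 'C(k - 2, 2) by rewrite -eG -eD' ein_le.
have few : 'C(k - 2, 2) + 8 <= #|F| + k by case: bound_clique; flia.
have k8 : 8 <= k by flia.
pose M := pairs_in D :\: G.
have cM : ein M D + 8 <= k.
  rewrite ein_full ?subsetDl //.
  have := cardsID G (pairs_in D); rewrite card_pairs_in -/M setIC -/(ein G D) eG eD'; flia.
pose U := [set x | root (adj F) x != x].
have eU : #|U| + 3 = k.
  by move: eD; rewrite /D /glued_dom cardsU1 inE r0r eqxx /= -/U; flia.
have adjM x y : x \in U -> y \in U -> ~~ connect (adj F) x y -> adj M x y.
  rewrite !inE => xU yU nxy; have nn : x != y by apply: contraNneq nxy => ->; apply: connect0.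
  rewrite /adj nn in_setD pair_pairs_in // !inE xU yU !orbT !andbT.
  apply: contra nxy => h; apply: connect1; apply: (adj_glued_nonroot FP (r0 := r0)).
  - by rewrite /adj nn.
  - by apply: contraNneq xU => ->; rewrite r0r.
  by apply: contraNneq yU => ->; rewrite r0r.
have UD : U \subset D by apply: subsetUr.
(* Vertices of different components are not adjacent in [G], so a second component would cost at
   least [#|U| - 1 = k - 4] missing edges. *)
have allc x y : x \in U -> y \in U -> connect (adj F) x y.
  move=> xU yU; apply/negPn/negP => nxy.
  pose A := [set z in U | connect (adj F) x z]; pose B := [set z in U | ~~ connect (adj F) x z].
  have cAB : #|A| + #|B| = #|U|.
    rewrite -(cardsID [set z | connect (adj F) x z] U); congr (_ + _); apply: eq_card => z.
      by rewrite !inE.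
    by rewrite !inE andbC.
  have xD := subsetP UD _ xU; have xA : x \in A by rewrite inE xU connect0.
  have yx : y != x by apply: contraNneq nxy => ->; apply: connect0.
  have yD : y \in D :\ x by rewrite !inE yx -/D; have := subsetP UD _ yU; rewrite !inE.
  have d1 : #|B| <= deg M D x.
    apply: subset_leq_card; apply/subsetP => z; rewrite !inE => /andP[zU nz].
    by rewrite adjM ?inE ?zU ?orbT //; move: xU; rewrite inE.
  have d2 : #|A :\ x| <= deg M (D :\ x) y.
    apply: subset_leq_card; apply/subsetP => z; rewrite !inE => /and3P[zx zU cz].
    rewrite zx zU orbT /= adjM ?inE //; first by move: yU; rewrite inE.
    by apply: contra nxy => c; apply: connect_trans cz _; rewrite adj_csym.
  have := ein_rem M xD; have := deg_le_ein M yD; have := cardsD1 x A; rewrite xA; flia.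
have : 0 < #|U| by flia.
case/card_gt0P => x0 x0U.
have rx0 x : x \in U -> root (adj F) x = root (adj F) x0.
  by move=> xU; apply/eqP; rewrite root_connect; [apply: allc | apply: adj_csym].
pose C := root (adj F) x0 |: U.
have cC : #|C| = k - 2.
  by rewrite cardsU1 inE root_root ?eqxx /=; [flia | apply: adj_csym].
have FC : F \subset pairs_in C.
  apply/subsetP => e eF; have [x [y [-> a]]] := edgeF FP eF.
  rewrite pair_pairs_in ?(adj_neq a) // !inE.
  have ra := adj_root a.
  case: (eqVneq (root (adj F) x) x) => xr; case: (eqVneq (root (adj F) y) y) => yr; rewrite ?orbT //=.
  - by have := adj_neq a; rewrite -xr -yr ra eqxx.
  - by rewrite orbF andbT -(rx0 y) ?inE // -ra xr.
  by rewrite orbF -(rx0 x) ?inE // ra yr.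
have := @dense_set_bound _ col k no_rainbow_path E C rE ltac:(flia) k_le_n.
rewrite cC; have := einS C FE; rewrite (ein_full FC) => h1 h2.
have {}h2 : #|E| <= 'C(k - 2, 2) + 1 by apply: h2; flia.
by have := bound_dense; flia.
Qed.

End CaseDisconnected.

(** The entries and their successors are disjoint subsets of an interval of length [b + 2 - a]. *)
Lemma spaced_count (s : seq nat) a b :
  uniq s -> (forall i, i \in s -> a <= i <= b) ->
  (forall i, i \in s -> i.+1 \notin s) -> 0 < size s -> 2 * size s <= b + 2 - a.
Proof.
move=> us ab sp s0.
have U : uniq (s ++ [seq S i | i <- s]).
  rewrite cat_uniq us map_inj_uniq ?us ?andbT /=; last exact: succn_inj.
  by apply/hasPn => j /mapP[i iss ->]; apply: sp.
have := uniq_leq_size (s2 := iota a (b + 2 - a)) U.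
rewrite size_cat size_map size_iota => h; suff : size s + size s <= b + 2 - a by flia.
apply: h => i; rewrite mem_cat mem_iota => /orP[/ab|/mapP[j /ab h ->]]; flia.
Qed.

(** * Exchanging edges of the same colour, and alternating paths *)

Section Swap.
Variables (V : finType) (col : {set V} -> nat).
Implicit Types (E : {set {set V}}) (x y : V) (s : seq V).

(** [g] is the edge that has the colour of [e]. If there is none, [e] is not in [E], and the default
    [g = e] deletes nothing. *)
Lemma rainbow_swap E e : rainbow col E -> e \in pairs_in [set: V] ->
  exists g, [/\ rainbow col (e |: (E :\ g)), #|g| = 2 & g \in E \/ g = e].
Proof.
move=> rE eP; have [sE iE] := rainbowP _ _ rE.
have c2 g : g \in pairs_in [set: V] -> #|g| = 2 by rewrite inE => /andP[_ /eqP].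
have rD g : rainbow col (E :\ g) by apply: rainbow_subset rE; apply: subD1set.
have [/existsP[g /andP[gE /eqP ge]]|no] := boolP [exists g, (g \in E) && (col g == col e)].
  exists g; split; [|exact: c2 (subsetP sE _ gE)|by left].
  apply: rainbow_add => // h /setD1P[hg hE] hc; case/eqP: hg.
  by apply: iE; rewrite // hc.
exists e; split; [|exact: c2|by right].
apply: rainbow_add => // h /setD1P[_ hE] hc; case/negP: no.
by apply/existsP; exists h; rewrite hE hc eqxx.
Qed.

Lemma adj_swap E e g x y : adj E x y -> [set x; y] != g -> adj (e |: (E :\ g)) x y.
Proof. by case/andP=> n h ng; rewrite /adj n !inE ng h orbT. Qed.

Lemma adj_link E g x y : x != y -> adj ([set x; y] |: (E :\ g)) x y.
Proof. by move=> n; rewrite /adj n !inE eqxx. Qed.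

Lemma sorted_swap E e (g : {set V}) s :
  sorted (adj E) s -> ~~ (g \subset s) -> sorted (adj (e |: (E :\ g))) s.
Proof.
move=> ss gs; apply: (@sub_in_sorted _ (mem s) _ _ _ s _ ss); last exact/allP.
move=> x y xs ys a; apply: adj_swap => //; apply: contraNneq gs => <-.
by apply/subsetP => z; rewrite !inE => /orP[] /eqP->.
Qed.

Lemma not_sub_disjoint (g : {set V}) (s t : seq V) :
  #|g| = 2 -> g \subset s -> (forall x, x \in s -> x \notin t) -> ~~ (g \subset t).
Proof.
move=> g2 gs d; have : 0 < #|g| by rewrite g2.
case/card_gt0P => x xg; apply/subsetPn; exists x => //; apply: d; exact: (subsetP gs).
Qed.

End Swap.

Section Zigzag.
Variables (V : finType) (e : rel V).
Implicit Types (js ks : seq V).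

Fixpoint zig js ks := match js, ks with
  | j :: js', i :: is' => j :: i :: zig js' is'
  | _, _ => [::]
  end.

Lemma zig_path i1 js ks :
  (forall j i, j \in js -> i \in i1 :: ks -> e j i && e i j) -> path e i1 (zig js ks).
Proof.
elim: js ks i1 => [|j js IH] [|i ks] i1 h //=.
have /andP[_ ->] := h j i1 (mem_head _ _) (mem_head _ _).
have /andP[-> _] := h j i (mem_head _ _) ltac:(by rewrite !inE eqxx orbT).
apply: IH => j' i' jj ii; apply: h; rewrite inE ?jj ?ii orbT //.
Qed.

Lemma count_zig (p : pred V) js ks : size js = size ks ->
  count p (zig js ks) = count p js + count p ks.
Proof. by elim: js ks => [|j js IH] [|i ks] //= [/IH ->]; flia. Qed.

Lemma size_zig js ks : size js = size ks -> size (zig js ks) = size js + size ks.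
Proof. by elim: js ks => [|j js IH] [|i ks] //= [/IH ->]; flia. Qed.

End Zigzag.


(** * Large minimum degree *)

Section MinDegree.
Variables (V : finType) (E : {set {set V}}) (D : {set V}) (l : nat).
Implicit Types (x y z u v w : V) (s q : seq V).
Hypothesis E_in : E \subset pairs_in D.
Hypothesis min_deg : forall x, x \in D -> l <= deg E D x.
Hypothesis l_ge2 : 2 <= l.
Let adjC := adj_sym E.

(* A path whose ends have crossing chords spans a cycle, which any outside neighbour turns into a longer path. *)
Lemma crossing_extend x0 s i u w :
  uniq s -> sorted (adj E) s -> i.+1 < size s ->
  adj E (nth x0 s 0) (nth x0 s i.+1) -> adj E (nth x0 s (size s).-1) (nth x0 s i) ->
  u \in s -> w \notin s -> adj E u w ->
  exists s', [/\ uniq s', sorted (adj E) s' & size s' = (size s).+1].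
Proof.
move=> us ss iz a0 al us' ws uw.
pose c := take i.+1 s ++ rev (drop i.+1 s).
have pc : perm_eq c s.
  apply: (@perm_trans _ (take i.+1 s ++ drop i.+1 s)); last by rewrite cat_take_drop.
  by rewrite perm_cat2l perm_rev.
have szc : size c = size s by apply: perm_size.
have sc : sorted (adj E) c.
  apply: (@sorted_cat _ _ x0); rewrite ?sorted_rev ?take_sorted ?drop_sorted // => _ _.
  rewrite last_take ?head_rev; last by flia.
  have -> : last x0 (drop i.+1 s) = nth x0 s (size s).-1.
    by rewrite -nth_last nth_drop size_drop; congr nth; flia.
  by rewrite adjC.
have c0 : 0 < size c by flia.
have hc : nth x0 c 0 = nth x0 s 0 by rewrite nth_cat size_takel ?nth_take //; flia.
have lc : nth x0 c (size c).-1 = nth x0 s i.+1.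
  by rewrite nth_last /c last_cat last_rev (drop_nth x0).
have uc : u \in c by rewrite (perm_mem pc).
pose x := nth x0 s 0.
have hx : head x c = x by rewrite -nth0 (set_nth_default x0) // hc.
have ix : (size c).-1 < size c by flia.
have ax : adj E x (nth x c (size c).-1) by rewrite (set_nth_default x0) // lc.
have ju : index u c <= (size c).-1 by have := uc; rewrite -index_mem; flia.
have [s1 [p1 ss1 l1]] := cycle_path sc hx ix ax ju.
have e1 : take (size c).-1.+1 c = c by rewrite take_oversize //; flia.
rewrite e1 in p1; rewrite nth_index // in l1.
exists (rcons s1 w); split.
- by rewrite rcons_uniq (perm_mem p1) (perm_mem pc) ws (perm_uniq p1) (perm_uniq pc).
- rewrite -cats1; apply: (@sorted_cat _ _ x) => // _ _; by rewrite /= l1.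
by rewrite size_rcons (perm_size p1) szc.
Qed.

Lemma sorted_sub s : sorted (adj E) s -> 1 < size s -> {subset s <= D}.
Proof.
move=> ss sz x xs; case/splitPr: xs ss sz => p1 p2; case/lastP: p1 => [|p1 y].
  case: p2 => // y p2 /= /andP[a _] _.
  by case/andP: (adj_in E_in a).
rewrite cat_rcons sorted_cat_cons /= => /and3P[_ a _] _.
by case/andP: (adj_in E_in a).
Qed.

Lemma count_first x0 s : 0 < size s -> count (adj E (nth x0 s 0)) s =
  size [seq i <- iota 0 (size s).-1 | adj E (nth x0 s 0) (nth x0 s i.+1)].
Proof. by case: s => //= y s _; rewrite adj_irr (count_nth_iota _ x0). Qed.

Lemma count_last x0 s : 0 < size s -> count (adj E (nth x0 s (size s).-1)) s =
  size [seq i <- iota 0 (size s).-1 | adj E (nth x0 s (size s).-1) (nth x0 s i)].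
Proof.
case/lastP: s => // s y _; rewrite size_rcons /=.
have -> : nth x0 (rcons s y) (size s) = y by rewrite nth_rcons ltnn eqxx.
rewrite -cats1 count_cat /= adj_irr !addn0 (count_nth_iota _ x0); congr size.
by apply: eq_in_filter => i; rewrite mem_iota => /andP[_ h]; rewrite nth_cat h.
Qed.

Section LongestPath.
Variables (x0 : V) (s : seq V).
Hypotheses (us : uniq s) (ss : sorted (adj E) s).
Hypothesis no_ext : forall s', uniq s' -> sorted (adj E) s' -> size s' <= size s.
Hypothesis s_gt0 : 0 < size s.
Hypothesis s_D : {subset s <= D}.
Let v i := nth x0 s i.
Let m := (size s).-1.

Let v_in i : i <= m -> v i \in s.
Proof. by move=> im; apply: mem_nth; rewrite /m in im; flia. Qed.

Lemma first_nbr z : adj E (v 0) z -> z \in s.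
Proof.
move=> a; apply/negPn/negP => zs; have := @no_ext (z :: s); rewrite /= zs us /=.
suff : path (adj E) z s by move=> -> /(_ isT isT); flia.
have a' : adj E z (nth x0 s 0) by rewrite adjC.
by case: (s) s_gt0 a' ss => //= y s' _ -> ->.
Qed.

Lemma last_nbr z : adj E (v m) z -> z \in s.
Proof.
move=> a; apply/negPn/negP => zs; have := @no_ext (rcons s z); rewrite rcons_uniq zs us size_rcons.
suff -> : sorted (adj E) (rcons s z) by move=> /(_ isT isT); flia.
rewrite -cats1; apply: (@sorted_cat _ _ x0) => // _ _.
by rewrite -nth_last /=.
Qed.

Lemma ends_disjoint i u w : u \in s -> w \notin s -> adj E u w -> i < m ->
  adj E (v 0) (v i.+1) -> adj E (v m) (v i) -> False.
Proof.
move=> us' ws uw im a b; have iz : i.+1 < size s by rewrite /m in im; flia.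
have [s' [us1 ss1 sz]] := crossing_extend us ss iz a b us' ws uw.
by have := no_ext us1 ss1; flia.
Qed.

Let X := [seq i <- iota 0 m | adj E (v 0) (v i.+1)].
Let Y := [seq i <- iota 0 m | adj E (v m) (v i)].

Lemma ends_size : l <= size X /\ l <= size Y.
Proof.
split.
  rewrite -(count_first x0 s_gt0); apply: leq_trans (min_deg (s_D (v_in (leq0n m)))) _.
  by apply: deg_le_count => z _; apply: first_nbr.
rewrite -(count_last x0 s_gt0); apply: leq_trans (min_deg (s_D (v_in (leqnn m)))) _.
by apply: deg_le_count => z _; apply: last_nbr.
Qed.

(** By [ends_disjoint] the index sets [X] and [Y] are disjoint parts of 0 .. [m - 1] with at least
    [l] elements each; when [m = 2 * l], they fill it. *)
Lemma ends_cover u w : u \in s -> w \notin s -> adj E u w -> 2 * l <= m /\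
  (m <= 2 * l -> forall i, i < m -> adj E (v 0) (v i.+1) || adj E (v m) (v i)).
Proof.
move=> us' ws uw; have [lX lY] := ends_size.
have XP i : (i \in X) = adj E (v 0) (v i.+1) && (i < m) by rewrite mem_filter mem_iota.
have YP i : (i \in Y) = adj E (v m) (v i) && (i < m) by rewrite mem_filter mem_iota.
have U : uniq (X ++ Y).
  rewrite cat_uniq !filter_uniq ?iota_uniq //= andbT; apply/hasPn => i.
  rewrite YP => /andP[b im]; apply/negP => /=; rewrite XP => /andP[a _].
  exact: (ends_disjoint us' ws uw im a b).
split.
  have := uniq_leq_size (s2 := iota 0 m) U; rewrite size_cat size_iota => h.
  suff : size X + size Y <= m by flia.
  by apply: h => i; rewrite mem_cat XP YP mem_iota => /orP[] /andP[].
move=> m2 i im; apply/negPn/negP; rewrite negb_or => /andP[na nb].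
have U' : uniq (i :: X ++ Y) by rewrite cons_uniq U mem_cat XP YP (negPf na) (negPf nb).
have := uniq_leq_size (s2 := iota 0 m) U'; rewrite /= size_cat size_iota => h.
suff : (size X + size Y).+1 <= m by flia.
apply: h => j; rewrite inE mem_cat XP YP mem_iota => /orP[/eqP->|/orP[] /andP[]] //.
Qed.

End LongestPath.

(** By connectivity a path that does not fill [D] has an outside neighbour; if no path with one more
    vertex existed, [ends_cover] would already give it [2 * l + 1] vertices. *)
Lemma long_path : conn E D -> 2 * l + 2 <= #|D| ->
  exists s, [/\ uniq s, sorted (adj E) s & size s = 2 * l + 1].
Proof.
move=> cn lD.
suff h r : r <= 2 * l -> exists s, [/\ uniq s, sorted (adj E) s, size s = r.+1 & {subset s <= D}].
  by have [s [? ? sz _]] := h _ (leqnn _); exists s; split=> //; rewrite sz addn1.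
elim: r => [|r IH] rl.
  have : 0 < #|D| by flia.
  by case/card_gt0P => x xD; exists [:: x]; split=> // y; rewrite inE => /eqP ->.
have [s [us ss sz sD]] := IH (ltnW rl).
have s0 : 0 < size s by flia.
have szD : size s < #|D| by flia.
have [u [w [uS wS uw]]] := outside_nbr cn szD sD s0.
have [t /andP[ut st]|no] := pickP [pred t : (r.+2).-tuple V | uniq t && sorted (adj E) t].
  exists t; split=> //; first by rewrite size_tuple.
  by apply: sorted_sub st _; rewrite size_tuple.
have no_ext s' : uniq s' -> sorted (adj E) s' -> size s' <= size s.
  move=> us' ss'; rewrite leqNgt; apply/negP => lt.
  have sz' : size (take r.+2 s') == r.+2 by rewrite size_takel //; flia.
  by have := no (Tuple sz'); rewrite inE /= take_uniq // take_sorted.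
have [+ _] := ends_cover u us ss no_ext s0 sD uS wS uw.
by rewrite sz /=; flia.
Qed.

Section Outside.
Variables (x0 : V) (s : seq V).
Hypotheses (us : uniq s) (ss : sorted (adj E) s).
Hypothesis s_size : size s = 2 * l + 1.
Hypothesis no_ext : forall s', uniq s' -> sorted (adj E) s' -> size s' <= 2 * l + 1.
Let v i := nth x0 s i.

Let s_gt0 : 0 < size s. Proof. by rewrite s_size; flia. Qed.
Let s_D : {subset s <= D}. Proof. by apply: sorted_sub ss _; rewrite s_size; flia. Qed.

(** Attached at [v i], the path [q] may replace the piece of [s] on either side, which must not give
    a longer path. *)
Lemma outside_end q w1 i : uniq (s ++ q) -> sorted (adj E) q -> 0 < size q -> head x0 q = w1 ->
  i <= 2 * l -> adj E w1 (v i) -> (size q <= i) /\ (i + size q <= 2 * l).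
Proof.
move=> U sq q0 hq il a; split.
  have : size (rev q ++ drop i s) <= 2 * l + 1.
    apply: no_ext; first by apply: (uniq_of_count U) => p; rewrite !count_cat count_rev (count_take_drop p i s); flia.
    apply: (@sorted_cat _ _ x0); rewrite ?sorted_rev ?drop_sorted // => _ _.
    by rewrite last_rev hq head_drop.
  by rewrite size_cat size_rev size_drop s_size; flia.
have : size (take i.+1 s ++ q) <= 2 * l + 1.
  apply: no_ext; first by apply: (uniq_of_count U) => p; rewrite !count_cat (count_take_drop p i.+1 s); flia.
  apply: (@sorted_cat _ _ x0); rewrite ?take_sorted // => _ _.
  by rewrite hq last_take; [rewrite adjC | flia].
by rewrite size_cat size_takel; flia.
Qed.

Lemma outside_gap q i j : uniq (s ++ q) -> sorted (adj E) q -> 0 < size q ->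
  i < j -> j <= 2 * l -> adj E (v i) (head x0 q) -> adj E (last x0 q) (v j) -> i + size q < j.
Proof.
move=> U sq q0 ij jl a b.
have : size (take i.+1 s ++ q ++ drop j s) <= 2 * l + 1.
  apply: no_ext.
    apply: (uniq_of_count U) => p; rewrite !count_cat.
    by have := @count_take_le _ p _ _ s ij; rewrite (count_take_drop p j s); flia.
  apply: (@sorted_cat _ _ x0); rewrite ?take_sorted //.
    by apply: (@sorted_cat _ _ x0); rewrite ?drop_sorted // => _ _; rewrite head_drop.
  move=> _ _; rewrite last_take; last by flia.
  by case: (q) q0 a.
by rewrite !size_cat size_takel ?size_drop; flia.
Qed.

(** At the positions [i.-1] and [i], [ends_cover] offers two chords each; the unwanted one would
    give a path through [w] and all of [s]. *)
Lemma outside_chords w i : w \notin s -> i <= 2 * l -> adj E w (v i) ->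
  [/\ 0 < i, i < 2 * l, adj E (v 0) (v i) & adj E (v (2 * l)) (v i)].
Proof.
move=> ws il a.
have U : uniq (s ++ [:: w]) by rewrite cat_uniq us /= orbF ws.
have [i0 i2] := @outside_end [:: w] w i U isT isT erefl il a; rewrite /= in i0 i2.
have no_ext' s' : uniq s' -> sorted (adj E) s' -> size s' <= size s by rewrite s_size; apply: no_ext.
have vi : v i \in s by apply: mem_nth; flia.
have aC : adj E (v i) w by rewrite adjC.
have [_] := ends_cover x0 us ss no_ext' s_gt0 s_D vi ws aC.
have -> : (size s).-1 = 2 * l by flia.
move=> /(_ (leqnn _)) cov; split; try flia.
  have /orP[|b] := cov i.-1 ltac:(flia); first by rewrite prednK.
  have : size (take i s ++ rev (drop i s) ++ [:: w]) <= 2 * l + 1.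
    apply: no_ext; first by apply: (uniq_of_count U) => p; rewrite !count_cat count_rev (count_take_drop p i s); flia.
    apply: (@sorted_cat _ _ x0); rewrite ?take_sorted //.
      apply: (@sorted_cat _ _ x0); rewrite ?sorted_rev ?drop_sorted // => _ _.
      by rewrite last_rev head_drop adjC.
    move=> _ _; have -> : head x0 (rev (drop i s) ++ [:: w]) = v (2 * l).
      have : head x0 (rev (drop i s)) = v (2 * l).
        by rewrite head_rev -nth_last nth_drop size_drop; congr nth; flia.
      have : 0 < size (rev (drop i s)) by rewrite size_rev size_drop; flia.
      by case: (rev (drop i s)).
    have -> : last x0 (take i s) = v i.-1 by rewrite -[in LHS](prednK i0) last_take //; flia.
    by rewrite adjC.
  by rewrite !size_cat size_rev size_takel ?size_drop /=; flia.
have /orP[b|//] := cov i ltac:(flia).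
have : size ((w :: rev (take i.+1 s)) ++ drop i.+1 s) <= 2 * l + 1.
  apply: no_ext; first by apply: (uniq_of_count U) => p; rewrite /= !count_cat count_rev (count_take_drop p i.+1 s) /=; flia.
  apply: (@sorted_cat _ _ x0); rewrite ?drop_sorted //.
    rewrite -cat1s; apply: (@sorted_cat _ _ x0); rewrite ?sorted_rev ?take_sorted // => _ _.
    by rewrite head_rev last_take //; flia.
  move=> _ _; rewrite head_drop.
  have -> : last x0 (w :: rev (take i.+1 s)) = v 0.
    by rewrite /= last_rev /v; case: (s) s_gt0.
  exact: b.
by rewrite size_cat /= size_rev size_takel ?size_drop; flia.
Qed.

End Outside.
End MinDegree.

Section ZigSpanning.
Variables (V : finType) (K : {set {set V}}) (l : nat).
Hypothesis l_ge2 : 2 <= l.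

(** Only the pair of [i] and [j] may lack its edge. They are kept apart by putting [j] first among
    the [Js] and [i] at the end of the path; [l >= 2] provides the vertex [i2] that follows [j]. *)
Lemma zig_spanning (i0 i1 i j : V) (Js Is : seq V) :
  size Js = l -> size Is = l -> uniq (i0 :: i1 :: Js ++ Is) -> j \in Js -> i \in Is ->
  adj K i0 i1 ->
  (forall a b, a \in i1 :: Is -> b \in Js -> ~~ ((a == i) && (b == j)) -> adj K a b) ->
  exists s, [/\ uniq s, sorted (adj K) s & size s = 2 * l + 2].
Proof.
move=> sJ sI U jJ iI a01 h.
have UI : uniq Is by move: U; rewrite /= cat_uniq => /and3P[_ _ /and3P[]].
have UJ : uniq Js by move: U; rewrite /= cat_uniq => /and3P[_ _ /and3P[]].
have i1I : i1 \notin Is by move: U; rewrite /= mem_cat negb_or => /and3P[_ /andP[]].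
have pI := perm_to_rem iI; have pJ := perm_to_rem jJ.
have zI := size_rem iI; have zJ := size_rem jJ.
have mI := mem_rem_uniq i UI; have mJ := mem_rem_uniq j UJ.
case: (rem i Is) pI zI mI => [|i2 is'] pI zI mI; first by rewrite /= in zI; flia.
have i2I : (i2 != i) && (i2 \in Is) by have := mI i2; rewrite inE eqxx /= !inE => <-.
exists (i0 :: i1 :: zig (j :: rem j Js) (i2 :: rcons is' i)); split.
- apply: (uniq_of_count U) => p.
  have e1 : size (j :: rem j Js) = size (i2 :: rcons is' i).
    by rewrite /= size_rcons; rewrite /= in zI; flia.
  have := permP pI p; have := permP pJ p; rewrite /= => c1 c2.
  have := count_zig p e1; rewrite /= -cats1 !count_cat /= => ->; flia.
- have A1 : adj K i1 j.
    by apply: h; rewrite ?inE ?eqxx //; apply: contra i1I => /andP[/eqP-> _].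
  have A2 : adj K j i2.
    case/andP: i2I => n2 i2I; rewrite adj_sym; apply: h; rewrite ?inE ?i2I ?orbT //.
    by rewrite (negPf n2).
  rewrite /= a01 A1 A2 /=; apply: zig_path => b a bJ aI.
  have bJ' : (b != j) && (b \in Js) by have := mJ b; rewrite bJ !inE => <-.
  case/andP: bJ' => nb bJs.
  suff ab : adj K a b by rewrite ab adj_sym ab.
  apply: h => //; last by rewrite (negPf nb) andbF.
  move: aI; rewrite inE mem_rcons !inE => /or3P[/eqP->|/eqP->|aI].
  - by case/andP: i2I => _ ->; rewrite orbT.
  - by rewrite iI orbT.
  by have := mI a; rewrite inE aI orbT !inE => /esym/andP[_ ->]; rewrite orbT.
rewrite /= -/(zig _ _) size_zig; last by rewrite size_rcons; rewrite /= in zI; flia.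
by rewrite size_rcons; rewrite /= in zI; flia.
Qed.

End ZigSpanning.

(** * Connected graphs of minimum degree l *)

Section ConnectedMinDegree.
Variables (V : finType) (col : {set V} -> nat) (E : {set {set V}}) (D : {set V}) (l : nat).
Implicit Types (x y z u v w : V) (s q : seq V).
Hypothesis no_rainbow_path : forall E : {set {set V}}, rainbow col E -> pathfree (2 * l + 2) E.
Hypothesis rE : rainbow col E.
Hypothesis E_in : E \subset pairs_in D.
Hypothesis min_deg : forall x, x \in D -> l <= deg E D x.
Hypothesis l_ge2 : 2 <= l.
Let adjC := adj_sym E.

Lemma no_long (K : {set {set V}}) s : rainbow col K -> uniq s -> sorted (adj K) s -> size s <= 2 * l + 1.
Proof. by move=> rK us ss; have := pathfreeP _ _ (no_rainbow_path rK) _ us ss; flia. Qed.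

(** Two cycles on [l + 1] vertices and a path on [l] further vertices meet at [u]. With the new pair
    [w1 v0], two of the three petals in full, [u] and one more vertex form a path on [2 * l + 2]
    vertices; wherever the lost edge [g] lies, one of these routes avoids it. *)
Lemma petals v0 A u p B w1 q :
  (size A).+1 = l -> (size B).+1 = l -> (size q).+1 = l ->
  uniq ((v0 :: A) ++ u :: (p :: B) ++ (w1 :: q)) ->
  sorted (adj E) ((v0 :: A) ++ u :: p :: B) -> sorted (adj E) (w1 :: q) ->
  adj E w1 u -> adj E v0 u -> adj E (last p B) u -> False.
Proof.
move=> sA sB sq U ss sW aw av al.
set V0 := v0 :: A in U ss *; set V1 := p :: B in U ss *; set W := w1 :: q in U sW *.
have := U; rewrite cat_uniq => /and3P[_ /hasPn h0]; rewrite cons_uniq cat_uniq.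
rewrite mem_cat negb_or => /and3P[/andP[uV1 uW] _ /andP[/hasPn h1 _]].
have uV0 : u \notin V0 by apply: h0; rewrite inE eqxx.
have d01 x : x \in V0 -> x \notin V1.
  by apply: contraL => xV; apply: h0; rewrite inE mem_cat xV orbT.
have d0W x : x \in V0 -> x \notin W.
  by apply: contraL => xV; apply: h0; rewrite inE mem_cat xV !orbT.
have dW1 x : x \in W -> x \notin V1 by apply: h1.
have dW0 x : x \in W -> x \notin V0 by apply: contraL; apply: d0W.
have d10 x : x \in V1 -> x \notin V0 by apply: contraL; apply: d01.
have d1W x : x \in V1 -> x \notin W by apply: contraL; apply: dW1.
have v0V : v0 \in V0 by rewrite inE eqxx. have pV : p \in V1 by rewrite inE eqxx.
have w1W : w1 \in W by rewrite inE eqxx. have lV : last p B \in V1 by apply: mem_last.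
have := ss; rewrite sorted_cat_cons => /andP[sV0u /andP[aup sV1]].
have sV0 : sorted (adj E) V0.
  by have := @take_sorted _ _ (size V0) _ ss; rewrite take_size_cat.
have n1 : w1 != v0 by apply: contraNneq (dW0 _ w1W) => ->.
have eP : [set w1; v0] \in pairs_in [set: V] by rewrite pair_pairs_in // !inE.
have [g [rK g2 _]] := rainbow_swap rE eP; set K := _ |: _ in rK.
have KC := adj_sym K.
have kl : adj K w1 v0 by apply: adj_link.
have sw x y : adj E x y -> [set x; y] != g -> adj K x y by apply: adj_swap.
have so t : sorted (adj E) t -> ~~ (g \subset t) -> sorted (adj K) t by apply: sorted_swap.
have uy : adj E u v0 by rewrite adjC.
have ul : adj E u (last p B) by rewrite adjC.
have lastV0 : adj E (last v0 A) u.
  by move: sV0u; rewrite /V0 rcons_cons /= rcons_path => /andP[].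
have plB : p != last p B.
  have UB : uniq (p :: B) by move: U; rewrite cat_uniq => /and3P[_ _]; rewrite cons_uniq cat_uniq => /andP[_ /and3P[]].
  case/lastP: (B) sB UB => [|B' b]; first by rewrite /=; flia.
  by rewrite last_rcons cons_uniq mem_rcons inE negb_or => _ /andP[/andP[]].
have neq x y a b t : x \in (t : seq V) -> y \notin t -> a \notin t -> b \notin t -> [set x; y] != [set a; b].
  move=> xt yt at_ bt; apply: contraNneq at_ => /set2_eq[[<- _]|[xb _]] //.
  by rewrite -xb xt in bt.
have [gW|gW] := boolP (g \subset W).
  have : size (rev V0 ++ w1 :: u :: V1) <= 2 * l + 1.
    apply: (no_long rK); first by apply: (uniq_of_count U) => P; rewrite !count_cat count_rev /= !count_cat /=; flia.
    have gu x y : y \notin W -> [set x; y] != g.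
      by move=> yW; apply: contraNneq yW => eg; apply: (subsetP gW); rewrite -eg !inE eqxx orbT.
    apply: (@sorted_cat _ _ w1); first by rewrite sorted_rev // so // (not_sub_disjoint g2 gW dW0).
      rewrite /= sw // ?gu // sw // ?gu ?d1W //=.
      by apply: (so V1) => //; apply: (not_sub_disjoint g2 gW dW1).
    by rewrite /= last_rev /= KC.
  by rewrite size_cat size_rev /=; flia.
have [/eqP g1|g1] := boolP (g == [set v0; u]).
  have : size (rev V0 ++ w1 :: u :: V1) <= 2 * l + 1.
    apply: (no_long rK); first by apply: (uniq_of_count U) => P; rewrite !count_cat count_rev /= !count_cat /=; flia.
    have nsub t : u \notin (t : seq V) -> ~~ (g \subset t).
      by move=> ut; apply/subsetPn; exists u => //; rewrite g1 !inE eqxx orbT.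
    apply: (@sorted_cat _ _ w1); first by rewrite sorted_rev // so // nsub.
      rewrite /= sw //=; last by rewrite g1; apply: (neq _ _ _ _ W) => //; apply: d0W.
      rewrite sw //=; last by rewrite g1 [[set u; p]]setUC; apply: (neq _ _ _ _ V1) => //; apply: d01.
      by apply: (so V1) => //; apply: nsub.
    by rewrite /= last_rev /= KC.
  by rewrite size_cat size_rev /=; flia.
have k0u : adj K v0 u by apply: sw; rewrite // eq_sym.
have sKW : sorted (adj K) (rev W) by rewrite sorted_rev // so.
have [/eqP g3|g3] := boolP (g == [set u; p]).
  have : size (rev W ++ v0 :: u :: rev V1) <= 2 * l + 1.
    apply: (no_long rK); first by apply: (uniq_of_count U) => P; rewrite !count_cat count_rev /= !count_cat count_rev /=; flia.
    have nsub t : u \notin (t : seq V) -> ~~ (g \subset t).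
      by move=> ut; apply/subsetPn; exists u => //; rewrite g3 !inE eqxx.
    apply: (@sorted_cat _ _ w1) => //; last by rewrite last_rev.
    rewrite /= k0u /= -[path _ u _]/(sorted (adj K) ([:: u] ++ rev V1)).
    apply: (@sorted_cat _ _ u) => //; first by rewrite sorted_rev // so // nsub.
    move=> _ _; rewrite /= head_rev /=; apply: sw => //.
    rewrite g3; apply: contraNneq plB => /set2_eq[[_ ->]|[e _]] //.
    by move: uV1; rewrite e inE eqxx.
  by rewrite size_cat size_rev /= size_rev /=; flia.
have kup : adj K u p by apply: sw; rewrite // eq_sym.
have [gV|gV] := boolP (g \subset V1).
  have gu x y : x \notin V1 -> [set x; y] != g.
    by move=> yW; apply: contraNneq yW => eg; apply: (subsetP gV); rewrite -eg !inE eqxx.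
  have : size (rev W ++ V0 ++ [:: u; p]) <= 2 * l + 1.
    apply: (no_long rK); first by apply: (uniq_of_count U) => P; rewrite !count_cat count_rev /= !count_cat /=; flia.
    apply: (@sorted_cat _ _ w1) => //; last by rewrite last_rev.
    apply: (@sorted_cat _ _ w1); first by rewrite so // (not_sub_disjoint g2 gV d10).
      by rewrite /= kup.
    move=> _ _; rewrite /=; apply: sw => //; apply: gu; apply: d01; exact: mem_last.
  by rewrite !size_cat size_rev /=; flia.
have : size (rev W ++ v0 :: u :: V1) <= 2 * l + 1.
  apply: (no_long rK); first by apply: (uniq_of_count U) => P; rewrite !count_cat count_rev /= !count_cat /=; flia.
  apply: (@sorted_cat _ _ w1) => //; last by rewrite last_rev.
  rewrite /= k0u kup /=; exact: (so V1).
by rewrite size_cat size_rev /=; flia.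
Qed.

Section WithPath.
Variables (x0 : V) (s : seq V).
Hypotheses (us : uniq s) (ss : sorted (adj E) s).
Hypothesis s_size : size s = 2 * l + 1.
Let v i := nth x0 s i.
Let no_ext s' : uniq s' -> sorted (adj E) s' -> size s' <= 2 * l + 1.
Proof. exact: no_long. Qed.

(** The neighbours of [w] on [s] are exactly the [l] odd positions. This makes the even positions
    independent and without neighbours outside [s], so by the minimum degree they are adjacent to
    all odd ones. In this complete bipartite graph with classes of [l] and [l + 2] vertices the new
    pair [w], [v 0] allows a path on [2 * l + 2] vertices, whichever edge is lost. *)
Lemma bipartite_case w : w \notin s -> l <= count (adj E w) s -> False.
Proof.
move=> ws; rewrite (count_nth_iota _ x0) s_size => cM; set M := filter _ _ in cM.
have U : uniq (s ++ [:: w]) by rewrite cat_uniq us /= orbF ws.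
have MP i : (i \in M) = adj E w (v i) && (i < 2 * l + 1) by rewrite mem_filter mem_iota.
have chords i : i <= 2 * l -> adj E w (v i) ->
  [/\ 0 < i, i < 2 * l, adj E (v 0) (v i) & adj E (v (2 * l)) (v i)].
  by apply: (outside_chords E_in min_deg l_ge2 us ss s_size no_ext ws).
have gap i : i < 2 * l -> adj E w (v i) -> adj E w (v i.+1) -> False.
  move=> il a b; have a' : adj E (v i) w by rewrite adjC.
  have := @outside_gap _ E l l_ge2 x0 s ss s_size no_ext [:: w] i i.+1 U isT isT (ltnSn _) il a' b.
  by rewrite /=; flia.
(* Otherwise [M], its successors and [i + 1] would be more than [2 * l] positions in 1 ..
   [2 * l]. *)
have xor i : i < 2 * l -> adj E w (v i) || adj E w (v i.+1).
  move=> il; apply/negPn/negP; rewrite negb_or => /andP[na nb].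
  have U2 : uniq (i.+1 :: M ++ [seq S j | j <- M]).
    have UM : uniq M by rewrite filter_uniq ?iota_uniq.
    rewrite cons_uniq cat_uniq UM (map_inj_uniq succn_inj) UM mem_cat MP (negPf nb) /= andbT.
    apply/andP; split.
      by apply/negP => /mapP[j jM [ej]]; move: jM; rewrite -ej MP (negPf na).
    apply/hasPn => j /mapP[j' j'M ->]; apply/negP => /=; rewrite MP => /andP[b jl].
    by move: j'M; rewrite MP => /andP[a _]; apply: (gap j') => //; flia.
  have := uniq_leq_size (s2 := iota 1 (2 * l)) U2; rewrite /= size_cat size_map size_iota => h.
  suff : (size M + size M).+1 <= 2 * l by flia.
  apply: h => j; rewrite inE mem_cat mem_iota => /or3P[/eqP->|jM|/mapP[j' jM ->]]; first by flia.
    move: jM; rewrite MP => /andP[a jl]; have [] := chords j _ a; flia.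
  move: jM; rewrite MP => /andP[a jl]; have [] := chords j' _ a; flia.
have wodd i : i <= 2 * l -> adj E w (v i) = odd i.
  elim: i => [|i IH] il.
    by apply/negP => a; have [] := chords 0 il a.
  have := xor i il; have := gap i il; rewrite IH 1?ltnW //=.
  case: (odd i); case: (adj E w (v i.+1)) => //= h _.
  by case: h.
have vs i : i <= 2 * l -> v i \in s by move=> il; apply: mem_nth; flia.
(* As [i.-1] is odd, [v i.-1] is adjacent to the last vertex of [s]: the longer path goes from [z]
   to [v i], to the end of [s], and from [v i.-1] back to [v 0]. *)
have even_out i z : i <= 2 * l -> ~~ odd i -> adj E (v i) z -> z \in s.
  move=> il oi a; apply/negPn/negP => zs.
  have a' : adj E z (v i) by rewrite adjC.
  have [i0 i2 _ _] := outside_chords E_in min_deg l_ge2 us ss s_size no_ext zs il a'.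
  have Uz : uniq (s ++ [:: z]) by rewrite cat_uniq us /= orbF zs.
  have oi1 : odd i.-1 by move: oi; rewrite -{1}(prednK i0) /= negbK.
  have il1 : i.-1 <= 2 * l by flia.
  have [_ _ _ b] := chords i.-1 il1 ltac:(by rewrite wodd).
  have : size ([:: z] ++ drop i s ++ rev (take i s)) <= 2 * l + 1.
    apply: no_ext; first by apply: (uniq_of_count Uz) => p; rewrite !count_cat count_rev (count_take_drop p i s); flia.
    apply: (@sorted_cat _ _ x0) => //.
      apply: (@sorted_cat _ _ x0); rewrite ?sorted_rev ?take_sorted ?drop_sorted // => _ _.
      have -> : last x0 (drop i s) = v (2 * l).
        by rewrite -nth_last nth_drop size_drop; congr nth; flia.
      by rewrite head_rev -[in take i _](prednK i0) last_take //; flia.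
    move=> _ _; rewrite /=.
    suff -> : head x0 (drop i s ++ rev (take i s)) = v i by [].
    by rewrite (drop_nth x0) //; flia.
  by rewrite !size_cat size_rev size_takel ?size_drop /=; flia.
(* The longer path goes up to [v i], over to [v j], back to [v i.+1], and then by way of [w] to
   [v j.+1] and onwards. *)
have even_even i j : i < j -> j <= 2 * l -> ~~ odd i -> ~~ odd j -> adj E (v i) (v j) -> False.
  move=> ij jl oi oj a.
  have : size (take i.+1 s ++ rev (drop i.+1 (take j.+1 s)) ++ [:: w] ++ drop j.+1 s) <= 2 * l + 1.
    apply: no_ext.
      apply: (uniq_of_count U) => p; rewrite !count_cat count_rev.
      have := count_take_drop p j.+1 s; have := count_take_drop p i.+1 (take j.+1 s).
      have ij' : i.+1 <= j.+1 by flia.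
      rewrite (take_takel s ij'); flia.
    have e1 : size (take j.+1 s) = j.+1 by rewrite size_takel //; flia.
    have hd : head x0 (drop i.+1 (take j.+1 s)) = v i.+1 by rewrite head_drop nth_take //; flia.
    have ld : last x0 (drop i.+1 (take j.+1 s)) = v j.
      by rewrite -nth_last nth_drop size_drop e1 nth_take; [congr nth; flia | flia].
    have ndrop : 0 < size (drop i.+1 (take j.+1 s)) by rewrite size_drop e1; flia.
    apply: (@sorted_cat _ _ x0); rewrite ?take_sorted //.
      apply: (@sorted_cat _ _ x0); first by rewrite sorted_rev // drop_sorted // take_sorted.
        apply: (@sorted_cat _ _ x0); rewrite ?drop_sorted //.
        move=> _ dj; rewrite /= head_drop wodd; first by rewrite /= oj.
        by move: dj; rewrite size_drop; flia.
      move=> _ _; rewrite last_rev hd /= adjC wodd; first by rewrite /= oi.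
      flia.
    move=> _ _; rewrite last_take; last by flia.
    suff -> : head x0 (rev (drop i.+1 (take j.+1 s)) ++ [:: w] ++ drop j.+1 s) = v j by [].
    have := head_rev x0 (drop i.+1 (take j.+1 s)); rewrite ld.
    have := ndrop; rewrite -size_rev.
    by case: (rev _).
  by rewrite !size_cat size_rev /= !size_drop !size_takel; flia.
pose Js := [seq v i.*2.+1 | i <- iota 0 l]; pose Is := [seq v i.*2.+2 | i <- iota 0 l].
have sJ : size Js = l by rewrite size_map size_iota.
have sI : size Is = l by rewrite size_map size_iota.
have IsP z : z \in Is -> exists2 i, (0 < i <= 2 * l) && ~~ odd i & z = v i.
  case/mapP=> i; rewrite mem_iota => il ->; exists i.*2.+2 => //.
  by rewrite /= negbK odd_double; flia.
have JsP z : z \in Js -> exists2 i, (0 < i <= 2 * l) && odd i & z = v i.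
  case/mapP=> i; rewrite mem_iota => il ->; exists i.*2.+1 => //.
  by rewrite /= odd_double; flia.
have UV : uniq (w :: v 0 :: Js ++ Is).
  have -> : v 0 :: Js ++ Is = [seq v i | i <- 0 :: [seq i.*2.+1 | i <- iota 0 l] ++ [seq i.*2.+2 | i <- iota 0 l]].
    by rewrite /= map_cat -!map_comp.
  rewrite cons_uniq map_inj_in_uniq.
    apply/andP; split.
      apply: contra ws => /mapP[i]; rewrite inE mem_cat => ii ->; apply: vs.
      by case/or3P: ii => [/eqP->|/mapP[j]|/mapP[j]] //; rewrite mem_iota => jl ->; flia.
    rewrite cons_uniq cat_uniq mem_cat negb_or !map_inj_uniq ?iota_uniq /=; try by move=> i j; flia.
    rewrite andbT -!andbA; apply/and3P; split.
    - by apply/negP => /mapP[].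
    - by apply/negP => /mapP[].
    by apply/hasPn => i /mapP[j _ ->]; apply/negP => /mapP[j' _]; flia.
  move=> i j; rewrite !inE !mem_cat => ii jj /eqP; rewrite nth_uniq //.
  - by move/eqP.
  - by rewrite s_size; case/or3P: ii => [/eqP->|/mapP[j']|/mapP[j']] //; rewrite ?mem_iota; flia.
  by rewrite s_size; case/or3P: jj => [/eqP->|/mapP[j']|/mapP[j']] //; rewrite ?mem_iota; flia.
have full i z : i <= 2 * l -> ~~ odd i -> z \in Js -> adj E (v i) z.
  move=> il oi zJ; pose N := [set z in D | adj E (v i) z].
  have sN : N \subset [set z in Js].
    apply/subsetP => y; rewrite !inE => /andP[yD a].
    have ys := even_out _ _ il oi a; have /(nthP x0)[j jl ej] := ys.
    have jl2 : j <= 2 * l by rewrite s_size in jl; flia.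
    have [oj|oj] := boolP (odd j).
      have ej2 : j = j./2.*2.+1 by rewrite -[LHS]odd_double_half oj.
      by rewrite -ej; apply/mapP; exists j./2; rewrite ?mem_iota /v -?ej2 //; flia.
    have nij : i != j by apply: contraTneq a => ->; rewrite /v ej adj_irr.
    rewrite -ej -/(v j) in a.
    have [lt|lt|e] := ltngtP i j; last by rewrite e eqxx in nij.
      by case: (even_even i j).
    by case: (even_even j i) => //; rewrite adjC.
  have cN : #|[set z in Js]| <= #|N|.
    apply: leq_trans (min_deg (sorted_sub E_in ss _ (vs _ il))); last by rewrite s_size; flia.
    by rewrite cardsE -sJ; apply: card_size.
  have eN : N = [set z in Js] by apply/eqP; rewrite eqEcard sN.
  have : z \in N by rewrite eN inE.
  by rewrite inE => /andP[].
have wfull z : z \in Js -> adj E w z.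
  by case/JsP=> i /andP[il oi] ->; rewrite wodd //; flia.
have v0full z : z \in Js -> adj E (v 0) z by move=> zJ; apply: full.
have Ifull a b : a \in Is -> b \in Js -> adj E a b.
  by case/IsP=> i /andP[il oi] -> bJ; apply: full => //; flia.
have nw0 : w != v 0 by move: UV; rewrite cons_uniq inE negb_or => /andP[/andP[]].
have eP : [set w; v 0] \in pairs_in [set: V] by rewrite pair_pairs_in // !inE.
have [g [rK g2 _]] := rainbow_swap rE eP; set K := _ |: _ in rK.
have kl : adj K w (v 0) by apply: adj_link.
have kl' : adj K (v 0) w by rewrite adj_sym.
have sw x y : adj E x y -> [set x; y] != g -> adj K x y by apply: adj_swap.
have [jj jjJ] : exists j, j \in Js.
  by case: (Js) sJ => [|j r]; [rewrite /=; flia | exists j; rewrite inE eqxx].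
have [ii iiI] : exists i, i \in Is.
  by case: (Is) sI => [|j r]; [rewrite /=; flia | exists j; rewrite inE eqxx].
suff [t [ut st szt]] : exists t, [/\ uniq t, sorted (adj K) t & size t = 2 * l + 2].
  by have := no_long rK ut st; flia.
have UV' : uniq (v 0 :: w :: Js ++ Is).
  by apply: (uniq_of_count UV) => p; rewrite /=; flia.
have win x y : w \in g -> w != x -> w != y -> [set x; y] != g.
  by move=> wg nx ny; apply: contraTneq wg => <-; rewrite !inE negb_or nx.
(* If [g] contains [w] or [v 0], the path starts at that vertex, which then needs no edge but the
   new one. If [g] joins the two classes elsewhere, [zig_spanning] keeps its ends apart. *)
have [wg|wg] := boolP (w \in g).
  apply: (zig_spanning l_ge2 sJ sI UV jjJ iiI kl) => a b aI bJ _.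
  have wn c : c \in v 0 :: Js ++ Is -> w != c.
    by move=> cc; apply: contraTneq UV => ->; rewrite cons_uniq cc.
  apply: sw; last by apply: win => //; apply: wn; move: aI; rewrite ?inE ?mem_cat ?bJ ?orbT // => /orP[] ->; rewrite ?orbT.
  by move: aI; rewrite inE => /orP[/eqP->|aI]; [apply: v0full | apply: Ifull].
have [vg|vg] := boolP (v 0 \in g).
  apply: (zig_spanning l_ge2 sJ sI UV' jjJ iiI kl') => a b aI bJ _.
  have wn c : c \in w :: Js ++ Is -> v 0 != c.
    by move=> cc; apply: contraTneq UV' => ->; rewrite cons_uniq cc.
  apply: sw.
    by move: aI; rewrite inE => /orP[/eqP->|aI]; [apply: wfull | apply: Ifull].
  apply: contraTneq vg => <-; rewrite !inE negb_or; apply/andP; split; apply: wn.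
    by move: aI; rewrite !inE mem_cat => /orP[] ->; rewrite ?orbT.
  by rewrite inE mem_cat bJ orbT.
have Kv b : b \in Js -> adj K (v 0) b.
  move=> bJ; apply: sw; first exact: v0full.
  by apply: contraNneq vg => <-; rewrite !inE eqxx.
have [/hasP[i iI /hasP[j jJ /eqP gij]]|no] := boolP (has (fun i => has (fun j => g == [set i; j]) Js) Is).
  apply: (zig_spanning l_ge2 sJ sI UV jJ iI kl) => a b.
  rewrite inE => /orP[/eqP-> bJ _|aI bJ nab]; first exact: Kv.
  apply: sw; first exact: Ifull.
  apply: contraNneq nab; rewrite gij => /set2_eq[[-> ->]|[aj _]]; first by rewrite !eqxx.
  move: UV; rewrite !cons_uniq cat_uniq => /and3P[_ _ /and3P[_ /hasPn h _]].
  by have := h _ aI; rewrite aj /= jJ.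
apply: (zig_spanning l_ge2 sJ sI UV jjJ iiI kl) => a b.
rewrite inE => /orP[/eqP-> bJ _|aI bJ _]; first exact: Kv.
apply: sw; first exact: Ifull.
by apply: contraNneq no => <-; apply/hasP; exists a => //; apply/hasP; exists b.
Qed.

(** The last premise says that the outside path [Q] cannot be prolonged. Then the neighbours of its
    last vertex lie on [Q] or on [s], and on [s] they are far from both ends, far from [m] unless
    equal to it, and never consecutive. The minimum degree leaves only [size Q = 1], the bipartite
    case, and [size Q = l = m], the petals. *)
Lemma outside_path_false w1 q m :
  uniq (s ++ w1 :: q) -> path (adj E) w1 q -> m <= 2 * l -> adj E w1 (v m) ->
  (forall z, uniq (s ++ w1 :: rcons q z) -> path (adj E) w1 (rcons q z) -> False) -> False.
Proof.
move=> U pq ml a1 nomax; set Q := w1 :: q; set wr := last w1 q.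
have sQ : sorted (adj E) Q by [].
have hQ : head x0 Q = w1 by [].
have [rm mr] := outside_end l_ge2 ss s_size no_ext U sQ isT hQ ml a1.
have ws z : z \in Q -> z \notin s.
  by move=> zQ; move: U; rewrite cat_uniq => /and3P[_ /hasPn/(_ z zQ)].
have wrQ : wr \in Q by apply: mem_last.
have wrs := ws _ wrQ.
have Ur : uniq (s ++ rev Q) by apply: (uniq_of_count U) => p; rewrite !count_cat count_rev.
have sQr : sorted (adj E) (rev Q) by rewrite sorted_rev.
have Qr0 : 0 < size (rev Q) by rewrite size_rev.
have hQr : head x0 (rev Q) = wr by rewrite head_rev.
pose M := [seq i <- iota 0 (2 * l + 1) | adj E wr (v i)].
have MP i : (i \in M) = adj E wr (v i) && (i < 2 * l + 1) by rewrite mem_filter mem_iota.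
have UM : uniq M by rewrite filter_uniq // iota_uniq.
have cM : size M = count (adj E wr) s by rewrite (count_nth_iota _ x0) s_size.
have wrD : wr \in D.
  have [q0|q0] := posnP (size q).
    rewrite /wr; case: (q) q0 => //= _; by case/andP: (adj_in E_in a1).
  by apply: (sorted_sub E_in sQ) => //=; flia.
have dwr : l <= size q + size M.
  apply: leq_trans (min_deg wrD) _; rewrite cM.
  apply: leq_trans (@deg_le_count _ _ _ _ (belast w1 q ++ s) _) _.
    move=> z zD az; rewrite mem_cat; apply/negPn/negP; rewrite negb_or => /andP[zq zs].
    have zQ : z \notin Q.
      rewrite /Q lastI mem_rcons inE negb_or zq andbT; apply: contraTneq az => ->.
      by rewrite -/wr adj_irr.
    apply: (nomax z); last by rewrite rcons_path pq.
    have Uz : uniq (z :: (s ++ w1 :: q)) by rewrite cons_uniq U mem_cat negb_or zs zQ.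
    by apply: (uniq_of_count Uz) => p; rewrite /= !count_cat /= -cats1 count_cat /=; flia.
  by rewrite count_cat leq_add2r; apply: leq_trans (count_size _ _) _; rewrite size_belast.
have Mb i : i \in M -> (size Q <= i) && (i + size Q <= 2 * l).
  rewrite MP => /andP[ai il].
  have := outside_end l_ge2 ss s_size no_ext Ur sQr Qr0 hQr (i := i) ltac:(flia) ai.
  by rewrite size_rev => -[-> ->].
have Mgt i : i \in M -> m < i -> m + size Q < i.
  rewrite MP => /andP[ai il] mi.
  apply: (outside_gap (x0 := x0) l_ge2 ss s_size no_ext U sQ isT mi ltac:(flia)) => //.
  by rewrite /= adjC.
have Mlt i : i \in M -> i < m -> i + size Q < m.
  rewrite MP => /andP[ai il] mi.
  have := outside_gap (x0 := x0) l_ge2 ss s_size no_ext Ur sQr Qr0 mi ml; rewrite hQr last_rev hQ size_rev.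
  by apply => //; rewrite adjC.
have Msp i : i \in M -> i.+1 \notin M.
  rewrite MP => /andP[ai il]; apply/negP; rewrite MP => /andP[ai' il'].
  have U1 : uniq (s ++ [:: wr]) by rewrite cat_uniq us /= orbF wrs.
  have := outside_gap (x0 := x0) l_ge2 ss s_size no_ext U1 isT isT (ltnSn i) ltac:(flia).
  by rewrite /= adjC => /(_ ai ai'); flia.
have szQ : size Q = (size q).+1 by [].
have [q0|q0] := posnP (size q).
  apply: (@bipartite_case wr wrs); rewrite -cM; flia.
pose L := [seq i <- M | i < m]; pose R := [seq i <- M | m < i].
(* The summand 1 stands for position [m] itself. *)
have cM3 : size M <= size L + size R + 1.
  have := count_predC (fun i => i < m) M; rewrite -size_filter -/L -size_filter.
  have -> : [seq x <- M | predC (fun i => i < m) x] = [seq x <- M | m <= x].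
    by apply: eq_filter => i /=; rewrite -leqNgt.
  suff : size [seq x <- M | m <= x] <= size R + 1 by flia.
  have Um : uniq [seq x <- M | m <= x] by rewrite filter_uniq.
  have := uniq_leq_size (s2 := rcons R m) Um; rewrite size_rcons addn1; apply.
  by move=> i; rewrite mem_rcons inE !mem_filter => /andP[mi ->]; rewrite andbT; flia.
have cL : 0 < size L -> 2 * size L <= (m - size Q - 1) + 2 - size Q.
  apply: spaced_count; first by rewrite filter_uniq.
    by move=> i; rewrite mem_filter => /andP[im iM]; have := Mb i iM; have := Mlt i iM im; flia.
  by move=> i; rewrite mem_filter => /andP[_ iM]; rewrite mem_filter negb_and (Msp _ iM) orbT.
have cR : 0 < size R -> 2 * size R <= (2 * l - size Q) + 2 - (m + size Q + 1).
  apply: spaced_count; first by rewrite filter_uniq.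
    by move=> i; rewrite mem_filter => /andP[im iM]; have := Mb i iM; have := Mgt i iM im; flia.
  by move=> i; rewrite mem_filter => /andP[_ iM]; rewrite mem_filter negb_and (Msp _ iM) orbT.
have [eQ em] : size Q = l /\ m = l.
  rewrite szQ in rm mr cL cR.
  have [L0|L0] := posnP (size L); have [R0|R0] := posnP (size R).
  - by flia.
  - by have := cR R0; flia.
  - by have := cL L0; flia.
  by have := cR R0; have := cL L0; flia.
have w1s := ws w1 (mem_head _ _).
have [_ _ c0 c2] := outside_chords E_in min_deg l_ge2 us ss s_size no_ext w1s ml a1.
have es : s = take l s ++ v l :: drop l.+1 s.
  by rewrite -drop_nth ?cat_take_drop //; flia.
have z0 : size (take l s) = l by rewrite size_takel; flia.
have z1 : size (drop l.+1 s) = l by rewrite size_drop; flia.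
have h0 : forall y, head y (take l s) = v 0.
  by move=> y; rewrite -nth0 nth_take; [apply: set_nth_default; flia | flia].
have h1 : forall y, last y (drop l.+1 s) = v (2 * l).
  move=> y; rewrite -nth_last nth_drop z1 (set_nth_default x0); last by rewrite s_size; flia.
  by congr nth; flia.
case e0 : (take l s) => [|v0 A] in es z0 h0 *; first by rewrite /= in z0; flia.
case e1 : (drop l.+1 s) => [|p B] in es z1 h1 *; first by rewrite /= in z1; flia.
have hv0 : v0 = v 0 by rewrite -(h0 x0).
have hv2 : last p B = v (2 * l) by rewrite -(h1 x0).
apply: (@petals v0 A (v l) p B w1 q) => //; try by rewrite -?z0 -?z1 -?eQ.
- by move: U; rewrite [in X in X -> _]es -catA.
- by rewrite -es.
- by rewrite -em.
- by rewrite hv0 -em.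
by rewrite hv2; move: c2; rewrite em.
Qed.

End WithPath.

Theorem connected_min_deg_false : conn E D -> 2 * l + 2 <= #|D| -> False.
Proof.
move=> cn lD; have [s [us ss sz]] := long_path E_in min_deg l_ge2 cn lD.
have s0 : 0 < size s by rewrite sz; flia.
have sD : {subset s <= D} by apply: (sorted_sub E_in ss); rewrite sz; flia.
have szD : size s < #|D| by rewrite sz; flia.
have [u [w [uS wS uw]]] := outside_nbr cn szD sD s0.
(* The outside path is prolonged as long as possible; [d] bounds the number of steps that remain. *)
have main : forall d w1 q m, #|V| < size q + d -> uniq (s ++ w1 :: q) -> path (adj E) w1 q ->
    m <= 2 * l -> adj E w1 (nth u s m) -> False.
  elim=> [|d IH] w1 q m lt U pq ml a1.
    by have := uniq_size_card U; rewrite size_cat /=; flia.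
  apply: (outside_path_false us ss sz U pq ml a1) => z Uz pz.
  by apply: (IH w1 (rcons q z) m) => //; rewrite size_rcons; flia.
apply: (main #|V|.+1 w [::] (index u s)) => //=; first by rewrite cat_uniq us /= orbF wS.
  by have := uS; rewrite -index_mem sz; flia.
by rewrite nth_index // adjC.
Qed.

End ConnectedMinDegree.

Section DegreeSum.
Variable V : finType.
Implicit Types (E : {set {set V}}) (D Q : {set V}).

Lemma ein0 E : ein E set0 = 0.
Proof. by apply/eqP; rewrite -leqn0; apply: leq_trans (ein_le _ _) _; rewrite cards0. Qed.

Lemma deg_split E D Q x : Q \subset D -> deg E D x = deg E (D :\: Q) x + deg E Q x.
Proof.
move=> QD; rewrite /deg -(cardsID Q [set y in D | adj E x y]) addnC; congr (_ + _).
  by apply: eq_card => y; rewrite !inE andbA.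
by apply: eq_card => y; rewrite !inE; case yQ: (y \in Q); rewrite ?andbF // (subsetP QD) ?yQ //= andbT.
Qed.

(** The degree sum counts the edges inside [Q] twice and those leaving [Q] once. *)
Lemma ein_degree_sum E D Q : Q \subset D ->
  ein E D + ein E Q = ein E (D :\: Q) + \sum_(x in Q) deg E D x.
Proof.
have [m] := ubnP #|Q|; elim: m Q => // m IH Q lt QD.
have [->|/set0Pn[q qQ]] := eqVneq Q set0.
  by rewrite setD0 big_set0 ein0.
have cQ := cardsD1 q Q; rewrite qQ in cQ.
have QD' : Q :\ q \subset D by apply: subset_trans (subD1set _ _) QD.
have qD : q \in D :\: (Q :\ q) by rewrite !inE eqxx /= (subsetP QD).
have IHq := IH (Q :\ q) ltac:(flia) QD'.
have e1 : D :\: Q = (D :\: (Q :\ q)) :\ q.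
  apply/setP => z; rewrite !inE; have [->|zq] := eqVneq z q; first by rewrite qQ.
  by [].
have := ein_rem E qD; rewrite -e1 => e2.
have := ein_rem E qQ => e3.
have := deg_split E q QD' => e4; have e5 := degD1 E Q q.
rewrite (big_setD1 q qQ) /=; flia.
Qed.

Lemma handshake E D : \sum_(x in D) deg E D x = 2 * ein E D.
Proof.
have := ein_degree_sum E (subxx D); rewrite setDv.
by rewrite ein0; flia.
Qed.

End DegreeSum.

(** * Disconnected graphs of minimum degree l *)

Section DisconnectedMinDegree.
Variables (V : finType) (col : {set V} -> nat) (E : {set {set V}}) (D : {set V}) (l : nat).
Implicit Types (x y z u v w : V) (s q : seq V).
Hypothesis no_rainbow_path : forall E : {set {set V}}, rainbow col E -> pathfree (2 * l + 2) E.
Hypothesis rE : rainbow col E.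
Hypothesis E_in : E \subset pairs_in D.
Hypothesis min_deg : forall x, x \in D -> l <= deg E D x.
Hypothesis l_ge2 : 2 <= l.
Let adjC := adj_sym E.

Lemma deg_gt_nbr x s : x \in D -> size s < deg E D x -> exists2 y, adj E x y & y \notin s.
Proof.
move=> xD lt; have /subsetPn[y] : ~~ ([set y in D | adj E x y] \subset s).
  by apply/negP => /subset_leq_card h; have := leq_trans h (card_size s); rewrite -/(deg E D x); flia.
by rewrite inE => /andP[_ a] ys; exists y.
Qed.

Lemma join_paths u v (g : {set V}) s t : ~~ connect (adj E) u v -> rainbow col ([set u; v] |: (E :\ g)) ->
  uniq (u :: s) -> uniq (v :: t) -> path (adj (E :\ g)) u s -> path (adj (E :\ g)) v t ->
  size s + size t < 2 * l.
Proof.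
move=> nc rK us ut ps pt.
have nuv : u != v by apply: contraNneq nc => ->; apply: connect0.
have : size (rev (u :: s) ++ v :: t) < 2 * l + 2.
  apply: (pathfreeP _ _ (no_rainbow_path rK)).
    rewrite cat_uniq rev_uniq us ut andbT andTb; apply/hasPn => z zt; rewrite mem_rev.
    apply: contra nc => zs.
    have sub : E :\ g \subset E by apply: subD1set.
    apply: (@connect_trans _ _ z); apply: (connect_subset sub).
      by apply: (path_connect ps).
    by rewrite adj_csym; apply: (path_connect pt).
  have sub : subrel (adj (E :\ g)) (adj ([set u; v] |: (E :\ g))).
    by move=> a b; apply: adjS; apply: subsetUr.
  apply: (@sorted_cat _ _ u).
  - rewrite sorted_rev; last exact: adj_sym.
    by apply: (sub_path sub).
  - by apply: (sub_path sub).
  by move=> _ _; rewrite last_rev /=; apply: adj_link.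
by rewrite size_cat size_rev /=; flia.
Qed.

Lemma adj_D1 (g : {set V}) x y : adj E x y -> [set x; y] != g -> adj (E :\ g) x y.
Proof. by case/andP=> n h ng; rewrite /adj n !inE ng h. Qed.

Lemma deg_del (g : {set V}) x : #|g| = 2 -> deg E D x <= deg (E :\ g) D x + (x \in g).
Proof.
move=> g2; case xg: (x \in g); last first.
  rewrite addn0; apply: subset_leq_card; apply/subsetP => y; rewrite !inE => /andP[-> a].
  by apply: adj_D1 => //; apply: contraFneq xg => <-; rewrite !inE eqxx.
have /cards2P[a [b [nab eg]]] : #|g| == 2 by rewrite g2.
have [y ey] : exists y, g = [set x; y].
  by move: xg; rewrite eg !inE => /orP[] /eqP ->; [exists b | exists a; rewrite setUC].
apply: leq_trans (_ : #|y |: [set z in D | adj (E :\ g) x z]| <= _).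
  apply: subset_leq_card; apply/subsetP => z; rewrite !inE => /andP[zD az].
  have [//|nz] := eqVneq z y; rewrite zD /=; apply: adj_D1 => //.
  by rewrite ey; apply: contraNneq nz => /set2_eq[[_ ->]|[-> ->]].
by rewrite cardsU1 addnC leq_add2l; case: (_ \in _).
Qed.

(** Every vertex keeps degree [l - 1] without [g], so [l - 1] edges are found greedily. The last
    step fails only if the end is in [g] and adjacent to all earlier vertices. Exchanging the last
    two vertices then gives a second end, which would be in [g] as well; but these two are joined by
    an edge other than [g]. *)
Lemma avoiding_path (g : {set V}) x : 3 <= l -> #|g| = 2 -> x \in D ->
  exists s, [/\ uniq (x :: s), path (adj (E :\ g)) x s & size s = l].
Proof.
move=> l3 g2 xD.
have gsub : E :\ g \subset pairs_in D by apply: subset_trans E_in; apply: subD1set.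
have ext y s : y \in D -> size s < deg (E :\ g) D y -> exists2 z, adj (E :\ g) y z & z \notin s.
  move=> yD lt; have /subsetPn[z] : ~~ ([set z in D | adj (E :\ g) y z] \subset s).
    by apply/negP => /subset_leq_card h; have := leq_trans h (card_size s); rewrite -/(deg (E :\ g) D y); flia.
  by rewrite inE => /andP[_ a] ys; exists z.
have dg y : y \in D -> l <= deg (E :\ g) D y + (y \in g).
  by move=> yD; apply: leq_trans (min_deg yD) (deg_del y g2).
have lastD y s : y \in D -> path (adj (E :\ g)) y s -> last y s \in D.
  elim: s y => //= z s IH y yD /andP[a ps]; apply: IH ps.
  by case/andP: (adj_in gsub a).
have step s : uniq (x :: s) -> path (adj (E :\ g)) x s ->
    size s < deg (E :\ g) D (last x s) ->
    exists z, uniq (x :: rcons s z) /\ path (adj (E :\ g)) x (rcons s z).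
  move=> us ps lt; have yD := lastD _ _ xD ps.
  have [z a zs] := ext (last x s) (belast x s) yD ltac:(by rewrite size_belast).
  have zn : z \notin x :: s by rewrite lastI mem_rcons inE negb_or zs andbT eq_sym (adj_neq a).
  exists z; rewrite rcons_path ps a; split=> //.
  have Uz : uniq (z :: x :: s) by rewrite cons_uniq zn us.
  by apply: (uniq_of_count Uz) => p; rewrite /= -cats1 count_cat /=; flia.
have base r : r < l -> exists s, [/\ uniq (x :: s), path (adj (E :\ g)) x s & size s = r].
  elim: r => [|r IH] rl; first by exists [::].
  have [s [us ps sz]] := IH (ltnW rl).
  have yD := lastD _ _ xD ps; have := dg _ yD.
  case: (_ \in g) => dy; have [z [uz pz]] := step s us ps ltac:(flia);
    by exists (rcons s z); rewrite size_rcons sz.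
have [s [us ps sz]] := base (l - 1) ltac:(flia).
have finish t y : uniq (x :: rcons t y) -> path (adj (E :\ g)) x (rcons t y) -> size (rcons t y) = l - 1 ->
    (exists s, [/\ uniq (x :: s), path (adj (E :\ g)) x s & size s = l]) \/
    y \in g /\ forall z, z \in x :: t -> adj (E :\ g) y z.
  move=> ut pt zt; rewrite size_rcons in zt.
  have [w /andP[aw nw]|none] := pickP [pred w | adj (E :\ g) y w && (w \notin x :: rcons t y)].
    left; exists (rcons (rcons t y) w); split; last by rewrite !size_rcons; flia.
      have Uw : uniq (w :: x :: rcons t y) by rewrite cons_uniq nw.
      by apply: (uniq_of_count Uw) => p; rewrite /= -!cats1 !count_cat /=; flia.
    by rewrite rcons_path pt last_rcons.
  right; have yD : y \in D by have := lastD _ _ xD pt; rewrite last_rcons.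
  pose N := [set z in D | adj (E :\ g) y z].
  have sN : N \subset [set z in x :: t].
    apply/subsetP => z; rewrite !inE => /andP[_ a].
    have := none z; rewrite /= a /= => /negbFE.
    rewrite inE mem_rcons inE => /or3P[->|/eqP e|->] //; rewrite ?orbT //.
    by move: a; rewrite e adj_irr.
  have ct : #|[set z in x :: t]| <= l - 1.
    by rewrite cardsE; apply: leq_trans (card_size _) _; rewrite /=; flia.
  have cN := subset_leq_card sN; have := dg _ yD; rewrite -/(deg (E :\ g) D y) in cN.
  rewrite /deg -/N => dy; split; first by move: dy; rewrite -/N in cN *; case: (y \in g) => //; rewrite /deg -/N in cN; flia.
  have eN : N = [set z in x :: t].
    apply/eqP; rewrite eqEcard sN /=; rewrite /deg -/N in cN.
    by move: dy; case: (y \in g); flia.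
  by move=> z zt'; have : z \in N by [rewrite eN inE]; rewrite inE => /andP[].
case/lastP: s => [|s y] in us ps sz *; first by rewrite /= in sz; flia.
have [//|[yg Ny]] := finish s y us ps sz.
case/lastP: s => [|s y'] in us ps sz Ny *; first by rewrite /= in sz; flia.
have := ps; rewrite !rcons_path !last_rcons => /andP[/andP[ps0 a1] a2].
have ayl : adj (E :\ g) (last x s) y.
  rewrite adj_sym; apply: Ny; rewrite -rcons_cons mem_rcons inE.
  by rewrite mem_last orbT.
have us' : uniq (x :: rcons (rcons s y) y').
  by apply: (uniq_of_count us) => p; rewrite /= -!cats1 !count_cat /=; flia.
have ps' : path (adj (E :\ g)) x (rcons (rcons s y) y').
  by rewrite !rcons_path !last_rcons ps0 ayl adj_sym.
have sz' : size (rcons (rcons s y) y') = l - 1 by move: sz; rewrite !size_rcons.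
have [//|[yg' _]] := finish _ _ us' ps' sz'.
have nyy : y' != y by apply: adj_neq a2.
have eg : g = [set y'; y].
  apply/esym/eqP; rewrite eqEcard g2 cards2 nyy subUset !sub1set yg yg' //.
by case/andP: a2 => _; rewrite -eg !inE eqxx.
Qed.

(** Paths with [l] edges in two components, joined by a new pair, have [2 * l + 2] vertices. For
    [l = 2] such a path may be missing, as in a triangle that has lost the edge opposite to the
    start; there the surplus of edges supplies a vertex [z] of degree at least 3. *)
Theorem disconnected_min_deg_false : #|D| + 2 <= #|E| \/ 3 <= l -> ~ conn E D -> False.
Proof.
move=> hl nconn.
have [u [v [uD vD nuv]]] : exists u v, [/\ u \in D, v \in D & ~~ connect (adj E) u v].
  have [/forall_inP h|] := boolP [forall u in D, forall v in D, connect (adj E) u v].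
    by case: nconn => u v uD vD; have /forall_inP := h _ uD; apply.
  rewrite negb_forall => /existsP[u]; rewrite negb_imply => /andP[uD].
  rewrite negb_forall => /existsP[v]; rewrite negb_imply => /andP[vD nc].
  by exists u, v.
have swap a b : ~~ connect (adj E) a b -> exists g : {set V}, rainbow col ([set a; b] |: (E :\ g)) /\ #|g| = 2.
  move=> nc; have nab : a != b by apply: contraNneq nc => ->; apply: connect0.
  have eP : [set a; b] \in pairs_in [set: V] by rewrite pair_pairs_in // !inE.
  by have [g [rK g2 _]] := rainbow_swap rE eP; exists g.
have [l3|l3] := leqP 3 l.
  have [g [rK g2]] := swap _ _ nuv.
  have [s [us ps sz]] := avoiding_path l3 g2 uD.
  have [t [ut pt zt]] := avoiding_path l3 g2 vD.
  by have := join_paths nuv rK us ut ps pt; rewrite sz zt; flia.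
have l2 : l = 2 by flia.
have cE : #|D| + 2 <= #|E| by case: hl => //; flia.
have [z zD dz] : exists2 z, z \in D & 2 < deg E D z.
  have [/exists_inP[z zD dz]|] := boolP [exists z in D, 2 < deg E D z]; first by exists z.
  rewrite negb_exists => /forallP h; exfalso.
  have := handshake E D; rewrite (ein_full E_in) => hs.
  have : \sum_(x in D) deg E D x <= \sum_(x in D) 2.
    by apply: leq_sum => x xD; have := h x; rewrite xD /= -leqNgt.
  by rewrite hs sum_nat_const; flia.
have [y yD nzy] : exists2 y, y \in D & ~~ connect (adj E) z y.
  have [cu|] := boolP (connect (adj E) z u); last by exists u.
  exists v => //; apply: contra nuv => cv; rewrite adj_csym in cu; exact: connect_trans cu cv.
have two x w : x \in D -> exists2 y, adj E x y & y != w.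
  move=> xD; have [y0 a] := @deg_gt_nbr x [:: w] xD ltac:(by have := min_deg xD; rewrite l2 /=; flia).
  by rewrite inE; exists y0.
have nD a b : adj E a b -> b \in D by move=> h; case/andP: (adj_in E_in h).
have [a za _] := two z z zD; have aD := nD _ _ za.
have [a' aa' na'] := two a z aD.
have [b zb nb] := @deg_gt_nbr z [:: a; a'] zD dz; rewrite !inE negb_or in nb.
have bD := nD _ _ zb; case/andP: nb => nba nba'.
have ncby : ~~ connect (adj E) b y.
  by apply: contra nzy => c; apply: connect_trans (connect1 zb) c.
have [g [rK g2]] := swap _ _ ncby.
have zC x : connect (adj E) z x -> ~~ connect (adj E) y x.
  by move=> c; apply: contra nzy => c'; rewrite adj_csym in c'; apply: connect_trans c c'.
have [y1 yy1 _] := two y y yD; have y1D := nD _ _ yy1.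
have [y2 y12 ny2] := two y1 y y1D.
have cy1 : connect (adj E) y y1 by apply: connect1.
have cy2 : connect (adj E) y y2 by apply: connect_trans cy1 (connect1 y12).
have cb : connect (adj E) z b by apply: connect1.
have ca : connect (adj E) z a by apply: connect1.
have ca' : connect (adj E) z a' by apply: connect_trans ca (connect1 aa').
(* If [g] meets the component of [z], two edges are used on either side of the new pair; if not,
   three in the component of [z] and one at [y]. *)
have [/existsP[c /andP[cg zc]]|noC] := boolP [exists c, (c \in g) && connect (adj E) z c].
  have notg (p q : V) : connect (adj E) y p -> connect (adj E) y q -> [set p; q] != g.
    move=> cp cq; apply: contraTneq cg => <-; rewrite !inE negb_or.
    by apply/andP; split; apply: contraNneq (zC _ zc) => ->.
  have [s [us ps sz]] : exists s, [/\ uniq (b :: s), path (adj (E :\ g)) b s & size s = 2].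
    have [bzg|bzg] := eqVneq [set b; z] g.
      have [p bp np] := two b z bD; have pD := nD _ _ bp.
      have [q pq nq] := two p b pD.
      exists [:: p; q]; split=> //.
        by rewrite /= !inE negb_or (adj_neq bp) eq_sym nq (adj_neq pq).
      rewrite /path; have npg (r t : V) : r != z -> r != b -> [set t; r] != g.
        by move=> n1 n2; rewrite -bzg; apply: contraNneq n1 => /set2_eq[[_ ->]|[_ rb]] //; rewrite rb eqxx in n2.
      have npb : p != b by rewrite eq_sym (adj_neq bp).
      have -> /= : adj (E :\ g) b p by apply: adj_D1 => //; apply: npg.
      by rewrite andbT; apply: adj_D1 => //; rewrite [[set p; q]]setUC npg.
    have dz' : 1 < deg (E :\ g) D z by have := deg_del z g2; case: (z \in g); flia.
    have /subsetPn[q] : ~~ ([set y in D | adj (E :\ g) z y] \subset [:: b]).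
      by apply/negP => /subset_leq_card h; have := leq_trans h (card_size _); rewrite -/(deg (E :\ g) D z) /=; flia.
    rewrite !inE => /andP[qD zq] nq; exists [:: z; q]; split=> //.
      by rewrite /= !inE negb_or eq_sym (adj_neq zb) eq_sym nq (adj_neq zq).
    by rewrite /= zq adj_D1 // adjC.
  have ut : uniq (y :: [:: y1; y2]).
    by rewrite /= !inE negb_or (adj_neq yy1) eq_sym ny2 (adj_neq y12).
  have pt : path (adj (E :\ g)) y [:: y1; y2].
    by rewrite /= !adj_D1 // notg // connect0.
  by have := join_paths ncby rK us ut ps pt; rewrite sz l2 /=; flia.
have notg (p q : V) : connect (adj E) z p -> [set p; q] != g.
  move=> cp; apply: contraNneq noC => <-; apply/existsP; exists p; rewrite !inE eqxx //.
have [c yc ncg] : exists2 c, adj E y c & [set y; c] != g.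
  have [e1|] := eqVneq [set y; y1] g; last by exists y1.
  have [y3 a3 n3] := two y y1 yD; exists y3 => //; rewrite -e1.
  by apply: contraNneq n3 => /set2_eq[[_ ->]|[e2 e3]] //; rewrite e3 -e2.
have us : uniq (b :: [:: z; a; a']).
  rewrite /= !inE !negb_or eq_sym (adj_neq zb) nba nba' (adj_neq za) (adj_neq aa') eq_sym na' //.
have ps : path (adj (E :\ g)) b [:: z; a; a'].
  by rewrite /= !adj_D1 ?notg ?connect0 // adjC.
have ut : uniq (y :: [:: c]) by rewrite /= inE (adj_neq yc).
have pt : path (adj (E :\ g)) y [:: c] by rewrite /= adj_D1.
by have := join_paths ncby rK us ut ps pt; rewrite l2 /=; flia.
Qed.

End DisconnectedMinDegree.

Lemma set2_neq (V : finType) (a b c : V) : b != c -> [set a; b] != [set a; c].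
Proof. by apply: contraNneq => /set2_eq[[_ ->]|[<- <-]]. Qed.

(** * Graphs of order 2l + 2 *)

Section Weave.
Variables (V : finType) (e : rel V).
Hypothesis e_sym : symmetric e.
Implicit Types (b js : seq V) (bs : seq (seq V)).

(** The path of a graph in which dominating vertices [js] link the pieces [b :: bs] into which the
    rest falls. *)
Fixpoint weave b js bs := match js, bs with
  | j :: js', b' :: bs' => b ++ j :: weave b' js' bs'
  | _, _ => b
  end.

Lemma count_weave (p : pred V) b js bs : size js = size bs ->
  count p (weave b js bs) = count p b + count p js + count p (flatten bs).
Proof.
elim: js b bs => [|j js IH] b [|b' bs] //=; first by rewrite !addn0.
by case=> /IH h; rewrite !count_cat /= h; flia.
Qed.

Lemma size_weave b js bs : size js = size bs ->
  size (weave b js bs) = size b + size js + size (flatten bs).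
Proof. by move=> h; rewrite -!(count_predT) count_weave. Qed.

Lemma head_weave x b js bs : 0 < size b -> head x (weave b js bs) = head x b.
Proof. by case: b => // y b; case: js => // j js; case: bs. Qed.

Definition block b := (0 < size b) && sorted e b.

Lemma weave_sorted b js bs : block b -> all block bs ->
  (forall j x, j \in js -> x \in b ++ flatten bs -> e j x) -> sorted e (weave b js bs).
Proof.
elim: js b bs => [|j js IH] b [|b' bs] //=; try by move=> /andP[].
move=> /andP[b0 sb] /andP[/andP[b0' sb'] abs] h.
have jj : j \in j :: js by rewrite inE eqxx.
have mh c : 0 < size c -> head j c \in c by case: c => //= ? ? _; rewrite inE eqxx.
have ml c : 0 < size c -> last j c \in c by case: c => //= y c _; apply: mem_last.
apply: (@sorted_cat _ _ j) => //.
  rewrite -cat1s; apply: (@sorted_cat _ _ j) => //.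
    apply: IH => //; first by rewrite /block b0'.
    move=> j' x j's xs; apply: h; first by rewrite inE j's orbT.
    by rewrite mem_cat xs orbT.
  by move=> _ _; rewrite head_weave //=; apply: h; rewrite // !mem_cat mh // orbT.
by move=> _ _ /=; rewrite e_sym; apply: h; rewrite // mem_cat ml.
Qed.

(** Only [n] and the first vertex [x] of the path may be non-adjacent. Placing [n] last among the
    connectors separates them, unless [b0] is [[:: x]] and [n] is the only connector, which the
    premise on sizes excludes. *)
Lemma weave_avoid js b0 bs n x :
  size js = size bs -> uniq (js ++ b0 ++ flatten bs) -> block b0 -> all block bs ->
  n \in js -> head x b0 = x -> (1 < size b0) || (1 < size js) ->
  (forall j y, j \in js -> y \in b0 ++ flatten bs -> ~~ ((j == n) && (y == x)) -> e j y) ->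
  exists s, [/\ uniq s, sorted e s & size s = size js + size b0 + size (flatten bs)].
Proof.
move=> sz U bl0 abl nj hx big h.
have UJ : uniq js by move: U; rewrite cat_uniq => /and3P[].
have UB : uniq (b0 ++ flatten bs) by move: U; rewrite cat_uniq => /and3P[].
have x0 : x \in b0 by case/andP: bl0; case: (b0) hx => //= y b' -> _ _; rewrite inE eqxx.
have xf : x \notin flatten bs.
  by move: UB; rewrite cat_uniq => /and3P[_ /hasPn hh _]; apply/negP => /hh; rewrite /= x0.
pose js' := rcons (rem n js) n.
have pj : perm_eq js' js.
  by rewrite perm_sym; apply: perm_trans (perm_to_rem nj) _; rewrite perm_sym perm_rcons.
have sz' : size js' = size bs by rewrite (perm_size pj).
exists (weave b0 js' bs); split.
- by apply: (uniq_of_count U) => p; rewrite count_weave // !count_cat (permP pj); flia.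
- have mj j : j \in js' -> j \in js by rewrite (perm_mem pj).
  have mr := mem_rem_uniq n UJ.
  have [q0|q0] := posnP (size (rem n js)).
    have b1 : 1 < size b0.
      by move: big; rewrite -(perm_size pj) size_rcons q0 orbF.
    have ejs : js' = [:: n] by rewrite /js'; case: (rem n js) q0.
    rewrite ejs in sz' *; case: bs => [|b1' [|]] //= in sz' sz U abl h UB xf *.
    rewrite cats0 andbT in abl h xf; case/andP: abl => b1'0 sb1'.
    case/andP: bl0 => b00 sb0; apply: (@sorted_cat _ _ n) => //.
      rewrite -cat1s; apply: (@sorted_cat _ _ n) => // _ _ /=.
      have hb : head n b1' \in b1' by case: (b1') b1'0 => //= ? ? _; rewrite inE eqxx.
      apply: h => //; first by rewrite mem_cat hb orbT.
      by rewrite eqxx /=; apply: contraNneq xf => <-.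
    move=> _ _ /=; rewrite e_sym.
    have lb : last n b0 \in b0 by case: (b0) b00 => //= y c _; apply: mem_last.
    apply: h => //; first by rewrite mem_cat lb.
    rewrite eqxx /=; case/lastP: (b0) b1 hx UB => [|c y] // b1 hx; rewrite last_rcons cat_uniq => /andP[uc _].
    case: c b1 hx uc => [|c0 c] //= _ ->; rewrite mem_rcons inE negb_or eq_sym => /andP[/andP[-> _] _] //.
  case er : (rem n js) q0 => [|j1 r] // _.
  have ejs : js' = j1 :: rcons r n by rewrite /js' er.
  have j1n : (j1 != n) && (j1 \in js) by have := mr j1; rewrite er inE eqxx !inE => <-.
  rewrite ejs in sz' mj *; case: bs => [|b1 bs] //= in sz' sz U abl h UB xf *.
  case/andP: bl0 => b00 sb0; case/andP: j1n => j1n j1s; case/andP: abl => bl1 abl.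
  case/andP: (bl1) => b10 sb1.
  apply: (@sorted_cat _ _ n) => //.
    rewrite -cat1s; apply: (@sorted_cat _ _ n) => //.
      apply: weave_sorted => // j y js1 ys; apply: h; first by apply: mj; rewrite inE js1 orbT.
        by rewrite mem_cat ys orbT.
      by rewrite negb_and; apply/orP; right; apply: contraNneq xf => <-.
    move=> _ _ /=; rewrite head_weave //.
    have hb : head n b1 \in b1 by case: (b1) b10 => //= ? ? _; rewrite inE eqxx.
    by apply: h; rewrite // ?(negPf j1n) // !mem_cat hb orbT.
  move=> _ _ /=; rewrite e_sym.
  have lb : last n b0 \in b0 by case: (b0) b00 => //= y c _; apply: mem_last.
  by apply: h; rewrite // ?(negPf j1n) // mem_cat lb.
by rewrite size_weave // (perm_size pj); flia.
Qed.

Definition missing (A J : {set V}) := \sum_(a in A) #|[set j in J | ~~ e a j]|.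

Lemma missing_remr (A J : {set V}) j : j \in J ->
  missing A J = missing A (J :\ j) + #|[set a in A | ~~ e a j]|.
Proof.
move=> jJ; rewrite -sum1dep_card [X in _ + X]big_mkcondr /= -big_split [LHS]/missing /=.
apply: eq_bigr => a aA; rewrite (cardsD1 j) inE jJ /= addnC; congr (_ + _).
by apply: eq_card => z; rewrite !inE andbA.
Qed.

Lemma missing_pair (A J : {set V}) a : a \in A ->
  missing A J = #|[set j in J | ~~ e a j]| + missing (A :\ a) J.
Proof. by move=> aA; rewrite /missing (big_setD1 a aA). Qed.

(** Each step goes from [a] to a neighbour [j] and on to a vertex of [A :\ a]. Removing [a] and [j]
    also removes a missing pair, if there is any, so the bound by [#|J| - 1] persists. *)
Lemma zigzag_dense (J A : {set V}) a :
  [disjoint J & A] -> a \in A -> #|A| = #|J|.+1 -> missing A J <= #|J| - 1 ->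
  exists s, [/\ uniq (a :: s), path e a s, {subset s <= J :|: A} & size s = 2 * #|J|].
Proof.
have [m] := ubnP #|J|; elim: m J A a => // m IH J A a lt dis aA cA mis.
have [J0|Jpos] := posnP #|J|; first by exists [::]; rewrite J0.
have cA' := cardsD1 a A; rewrite aA in cA'; set A' := A :\ a in cA' *.
have mA := missing_pair J aA; rewrite -/A' in mA.
have good j : j \in J -> e a j -> missing A' (J :\ j) <= #|J| - 2 ->
    #|[set a' in A' | ~~ e a' j]| < #|A'| ->
  exists s, [/\ uniq (a :: s), path e a s, {subset s <= J :|: A} & size s = 2 * #|J|].
  move=> jJ aj mj lt'.
  have [a2 a2A a2j] : exists2 a2, a2 \in A' & e a2 j.
    have /subsetPn[a2 a2A] : ~~ (A' \subset [set a' in A' | ~~ e a' j]).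
      by apply/negP => /subset_leq_card; flia.
    by rewrite inE a2A /= negbK; exists a2.
  have cJ := cardsD1 j J; rewrite jJ in cJ.
  have dis' : [disjoint J :\ j & A'].
    apply: disjointWl (subD1set J j) _; apply: disjointWr dis; exact: subD1set.
  have [s [us ps sub sz]] := IH (J :\ j) A' a2 ltac:(flia) dis' a2A ltac:(flia) ltac:(flia).
  have a2s x : x \in a2 :: s -> (x \in (J :\ j) :|: A').
    by rewrite inE => /orP[/eqP->|/sub] //; rewrite inE a2A orbT.
  exists [:: j, a2 & s]; split.
  - have na : a \notin J by apply/negP => aJ; move/disjointFr: dis => /(_ a aJ); rewrite aA.
    have njA : j \in A = false by apply: (disjointFr dis).
    rewrite [uniq _]/= -/(uniq (a2 :: s)) us andbT; apply/andP; split.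
      rewrite inE negb_or; apply/andP; split; first by apply: contraNneq na => ->.
      by apply/negP => /a2s; rewrite !inE eqxx (negPf na) andbF.
    by apply/negP => /a2s; rewrite !inE eqxx njA andbF.
  - by rewrite /= aj e_sym a2j ps.
  - move=> x; rewrite inE => /orP[/eqP->|/a2s]; first by rewrite inE jJ.
    by rewrite !inE => /orP[/andP[_ ->]|/andP[_ ->]]; rewrite ?orbT.
  by rewrite /= sz; flia.
have sumle j : j \in J -> missing A' J = missing A' (J :\ j) + #|[set a' in A' | ~~ e a' j]|.
  exact: missing_remr.
(* If [a] belongs to a missing pair, any neighbour [j] will do; otherwise [j] is taken from a
   missing pair. *)
have [c0|cpos] := posnP #|[set j in J | ~~ e a j]|.
  have all_j j : j \in J -> e a j.
    by move=> jJ; apply/negPn/negP => n; move/eqP: c0; rewrite cards_eq0 => /eqP/setP/(_ j); rewrite !inE jJ n.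
  have [m0|mpos] := posnP (missing A' J).
    have : 0 < #|J| by flia.
    case/card_gt0P => j jJ; have := sumle j jJ => sj.
    by apply: (good j) => //; [exact: all_j | flia | flia].
  have [j jJ jpos] : exists2 j, j \in J & 0 < #|[set a' in A' | ~~ e a' j]|.
    have /existsP[a' /andP[a'A /card_gt0P[j]]] : [exists a', (a' \in A') && (0 < #|[set j in J | ~~ e a' j]|)].
      apply: contraTT mpos; rewrite negb_exists => /forallP hh; rewrite -eqn0Ngt sum_nat_eq0.
      by apply/forallP => a'; apply/implyP => a'A; have := hh a'; rewrite a'A /= -eqn0Ngt.
    rewrite inE => /andP[jJ na]; exists j => //; apply/card_gt0P; exists a'.
    by rewrite inE a'A.
  have := sumle j jJ => sj.
  by apply: (good j) => //; [exact: all_j | flia | flia].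
have [j jJ aj] : exists2 j, j \in J & e a j.
  have /subsetPn[j jJ] : ~~ (J \subset [set j in J | ~~ e a j]).
    by apply/negP => /subset_leq_card; flia.
  by rewrite inE jJ /= negbK; exists j.
have := sumle j jJ => sj.
by apply: (good j) => //; flia.
Qed.

End Weave.

(** * Two configurations excluded by one exchange *)

Section Extremal.
Variables (V : finType) (col : {set V} -> nat) (E : {set {set V}}) (l : nat).
Hypothesis no_rainbow_path : forall E : {set {set V}}, rainbow col E -> pathfree (2 * l + 2) E.
Hypothesis rE : rainbow col E.
Hypothesis l_ge2 : 2 <= l.

(** The new pair joins [i], which has most missing pairs, to some [i'] in [I]; from there the path
    alternates between [J] and [I :\ i]. Leaving out [i] saves a missing pair, if there is any, and
    the loss of [g] costs at most one. *)
Lemma independent_case (J I : {set V}) : [disjoint J & I] -> #|J| = l -> #|I| = l + 2 ->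
  missing (adj E) I J <= l - 1 -> False.
Proof.
move=> dis cJ cI mis.
have : 0 < #|I| by flia.
case/card_gt0P => y0 y0I.
case: (arg_maxnP (fun i => #|[set j in J | ~~ adj E i j]|) y0I) => i iI imax.
have {}iI : i \in I := iI.
have cI' := cardsD1 i I; rewrite iI in cI'.
have : 0 < #|I :\ i| by flia.
case/card_gt0P => i' i'I; have := i'I; rewrite !inE => /andP[ni _].
have nii : i != i' by rewrite eq_sym.
have eP : [set i; i'] \in pairs_in [set: V] by rewrite pair_pairs_in // !inE.
have [g [rK g2 _]] := rainbow_swap rE eP; set K := _ |: _ in rK.
have dis' : [disjoint J & I :\ i] by apply: disjointWr dis; apply: subD1set.
have m1 := missing_pair (adj E) J iI.
have mis1 : missing (adj E) (I :\ i) J <= l - 2.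
  have [z|p] := posnP #|[set j in J | ~~ adj E i j]|; last by flia.
  suff -> : missing (adj E) (I :\ i) J = 0 by [].
  apply: big1 => a; rewrite !inE => /andP[_ aI]; apply/eqP; rewrite -leqn0.
  by apply: leq_trans (imax a aI) _; rewrite z.
have misK : missing (adj K) (I :\ i) J <= l - 1.
  have h1 : missing (adj K) (I :\ i) J <=
      \sum_(a in I :\ i) (#|[set j in J | ~~ adj E a j]| + #|[set j in J | [set a; j] == g]|).
    apply: leq_sum => a _; apply: leq_trans (leq_card_setU _ _); apply: subset_leq_card.
    apply/subsetP => j; rewrite !inE => /andP[-> nK] /=.
    by case aE: (adj E a j) => //=; apply: contraNT nK => ng; apply: adj_swap.
  rewrite big_split /= in h1.
  have h2 : \sum_(a in I :\ i) #|[set j in J | [set a; j] == g]| <= 1.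
    have [/existsP[a /andP[aI]]|] := boolP [exists a, (a \in I :\ i) && (0 < #|[set j in J | [set a; j] == g]|)].
      case/card_gt0P => j; rewrite inE => /andP[jJ /eqP eg].
      rewrite (big_setD1 a aI) /= big1 ?addn0.
        apply/card_le1P => j1; rewrite inE => /andP[j1J /eqP e1] j2; rewrite !inE.
        apply/andP/eqP => [[j2J /eqP e2]|-> //]; last by rewrite j1J e1 eqxx.
        have : [set a; j2] = [set a; j1] by rewrite e1.
        by case/set2_eq => -[] // -> ->.
      move=> a' /setD1P[na' a'I]; apply/eqP; rewrite cards_eq0; apply/eqP/setP => j'; rewrite !inE.
      apply/negP => /andP[j'J /eqP e1]; have : [set a'; j'] = [set a; j] by rewrite e1 eg.
      case/set2_eq => -[e2 e3]; first by rewrite e2 eqxx in na'.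
      by move: (disjointFr dis' jJ); rewrite -e2 a'I.
    rewrite negb_exists => /forallP no; rewrite big1 // => a aI.
    by have := no a; rewrite aI /= -eqn0Ngt => /eqP.
  by rewrite -/(missing (adj E) (I :\ i) J) in h1; flia.
have [s [us ps sub sz]] := @zigzag_dense V (adj K) (adj_sym K) J (I :\ i) i' dis' i'I
  ltac:(flia) ltac:(by rewrite cJ).
have : size (i :: i' :: s) <= 2 * l + 1.
  apply: (no_long no_rainbow_path l_ge2 rK); last by rewrite /= ps adj_link.
  rewrite cons_uniq us andbT inE negb_or nii; apply/negP => /sub.
  rewrite !inE eqxx /= orbF => iJ; by move: (disjointFr dis iJ); rewrite iI.
by rewrite /= sz cJ; flia.
Qed.

(** The triangle, [o], [o'] and the vertices of [L] are [l + 1] pieces, whereas the [l - 1] vertices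
    of [Ns] link only [l]; the new pair [o o'] merges two pieces. If [g] lies in the triangle, the
    other two edges of the triangle are used. *)
Lemma pendant_case (Ns L : seq V) z1 z2 z3 o o' :
  (size Ns).+1 = l -> (size L).+2 = l ->
  uniq (Ns ++ [:: z1; z2; z3; o; o'] ++ L) ->
  (forall n x, n \in Ns -> x \in [:: z1; z2; z3; o; o'] ++ L -> adj E n x) ->
  adj E z1 z2 -> adj E z2 z3 -> adj E z1 z3 -> False.
Proof.
move=> sN sL U hN a12 a23 a13.
have U' : uniq ([:: z1; z2; z3; o; o'] ++ L) by move: U; rewrite cat_uniq => /and3P[].
have noo : o != o'.
  have : uniq ([:: z1; z2; z3] ++ [:: o, o' & L]) by [].
  by rewrite cat_uniq => /and3P[_ _]; rewrite cons_uniq inE negb_or => /andP[/andP[]].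
have eP : [set o; o'] \in pairs_in [set: V] by rewrite pair_pairs_in // !inE.
have [g [rK g2 _]] := rainbow_swap rE eP; set K := _ |: _ in rK.
have KC := adj_sym K.
have koo : adj K o o' by apply: adj_link.
have koo' : adj K o' o by rewrite KC.
have sw x y : adj E x y -> [set x; y] != g -> adj K x y by apply: adj_swap.
have fin s : uniq s -> sorted (adj K) s -> size s = 2 * l + 2 -> False.
  by move=> us ss sz; have := no_long no_rainbow_path l_ge2 rK us ss; rewrite sz; flia.
have [n0 n0N] : exists n, n \in Ns.
  by case: (Ns) sN => [|n r]; [rewrite /=; flia | exists n; rewrite inE eqxx].
pose sing := [seq [:: x] | x <- L].
have fsing (t : seq V) : flatten [seq [:: x] | x <- t] = t by elim: t => //= x t ->.
have bsing (t : seq V) : all (block (adj K)) [seq [:: x] | x <- t] by elim: t.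
have disN x : x \in [:: z1; z2; z3; o; o'] ++ L -> x \notin Ns.
  by move=> xs; move: U; rewrite cat_uniq => /and3P[_ /hasPn h _]; apply: (h x).
(* In each of the next three claims the pair formed by [n] and the first vertex of the path is the only
   edge between [Ns] and the rest that the exchange may have destroyed. *)
have first_Z n a b c : perm_eq [:: a; b; c] [:: z1; z2; z3] -> adj K a b -> adj K b c -> n \in Ns ->
    (forall j y, j \in Ns -> y \in [:: z1; z2; z3; o; o'] ++ L -> ~~ ((j == n) && (y == a)) -> adj K j y) -> False.
  move=> pz ab bc nN h.
  have := @weave_avoid V (adj K) KC Ns [:: a; b; c] ([:: o; o'] :: sing) n a.
  rewrite /= fsing size_map => /(_ ltac:(flia)) W.
  have mem y : y \in [:: a, b, c, o, o' & L] -> y \in [:: z1; z2; z3; o; o'] ++ L.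
    rewrite -[[:: a, b, c, o, o' & L]]/([:: a; b; c] ++ ([:: o; o'] ++ L)).
    rewrite -[[:: z1; z2; z3; o; o'] ++ L]/([:: z1; z2; z3] ++ ([:: o; o'] ++ L)).
    by rewrite !(mem_cat y) (perm_mem pz).
  have [|||||||s [us ss sz]] := W; rewrite ?/block /= ?ab ?bc ?koo ?bsing //.
  - apply: (uniq_of_count U) => p; rewrite !count_cat; have := permP pz p; rewrite /=; flia.
  - by move=> j y jN /mem yy; apply: h.
  by apply: (fin s) => //; rewrite sz; flia.
have first_o n p q : perm_eq [:: p; q] [:: o; o'] -> adj K p q -> ~~ (g \subset [:: z1; z2; z3]) -> n \in Ns ->
    (forall j y, j \in Ns -> y \in [:: z1; z2; z3; o; o'] ++ L -> ~~ ((j == n) && (y == p)) -> adj K j y) -> False.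
  move=> pz pq gZ nN h.
  have := @weave_avoid V (adj K) KC Ns [:: p; q] ([:: z1; z2; z3] :: sing) n p.
  rewrite /= fsing size_map => /(_ ltac:(flia)) W.
  have mem y : y \in [:: p, q, z1, z2, z3 & L] -> y \in [:: z1; z2; z3; o; o'] ++ L.
    have := perm_mem pz y; rewrite !inE => e1; move: e1.
    by case: (y == p); case: (y == q); case: (y == o); case: (y == o'); case: (y == z1);
       case: (y == z2); case: (y == z3); case: (y \in L).
  have sZ : sorted (adj K) [:: z1; z2; z3] by apply: sorted_swap; rewrite //= a12 a23.
  have [|||||||s [us ss sz]] := W; rewrite ?/block ?sZ /= ?pq ?bsing //.
  - apply: (uniq_of_count U) => P; rewrite !count_cat; have := permP pz P; rewrite /=; flia.
  - by move=> j y jN /mem yy; apply: h.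
  by apply: (fin s) => //; rewrite sz; flia.
have first_L n x : x \in L -> ~~ (g \subset [:: z1; z2; z3]) -> n \in Ns ->
    (forall j y, j \in Ns -> y \in [:: z1; z2; z3; o; o'] ++ L -> ~~ ((j == n) && (y == x)) -> adj K j y) -> False.
  move=> xL gZ nN h; have px := perm_to_rem xL; have zx := size_rem xL.
  have := @weave_avoid V (adj K) KC Ns [:: x] ([:: z1; z2; z3] :: [:: o; o'] :: [seq [:: y] | y <- rem x L]) n x.
  have L0 : 0 < size L by case: (L) xL.
  rewrite /= fsing size_map zx => /(_ ltac:(flia)) W.
  have mem y : y \in [:: x, z1, z2, z3, o, o' & rem x L] -> y \in [:: z1; z2; z3; o; o'] ++ L.
    have := perm_mem px y; rewrite !inE => ->.
    by case: (y == x); case: (y == o); case: (y == o'); case: (y == z1);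
       case: (y == z2); case: (y == z3).
  have sZ : sorted (adj K) [:: z1; z2; z3] by apply: sorted_swap; rewrite //= a12 a23.
  have [|||||||s [us ss sz]] := W; rewrite ?/block ?sZ /= ?koo ?bsing //.
  - apply: (uniq_of_count U) => P; rewrite !count_cat; have := permP px P; rewrite /=; flia.
  - by flia.
  - by move=> j y jN /mem yy; apply: h.
  by apply: (fin s) => //; rewrite sz; flia.
have inZ x : x \in [:: z1; z2; z3] -> x \in [:: z1; z2; z3; o; o'] ++ L.
  by rewrite !inE => /or3P[] ->; rewrite ?orbT.
have [gZ|gZ] := boolP (g \subset [:: z1; z2; z3]).
  have hN' j y : j \in Ns -> y \in [:: z1; z2; z3; o; o'] ++ L -> adj K j y.
    move=> jN yy; apply: sw; first exact: hN.
    apply: contraTneq jN => eg; apply: disN; apply: inZ; apply: (subsetP gZ).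
    by rewrite -eg !inE eqxx.
  have nz : [/\ z1 != z2, z2 != z3 & z1 != z3] by split; apply: adj_neq; eassumption.
  case: nz => n12 n23 n13.
  have [e12|n12'] := eqVneq [set z1; z2] g.
    apply: (first_Z n0 z1 z3 z2) => //; last by move=> j y jN yy _; apply: hN'.
    - by apply/permP => p; rewrite /=; flia.
    - by apply: sw => //; rewrite -e12 set2_neq // eq_sym.
    by rewrite KC; apply: sw => //; rewrite -e12 [[set z1; z2]]setUC set2_neq // eq_sym.
  have [e23|n23'] := eqVneq [set z2; z3] g.
    apply: (first_Z n0 z2 z1 z3) => //; last by move=> j y jN yy _; apply: hN'.
    - by apply/permP => p; rewrite /=; flia.
    - by rewrite KC; apply: sw.
    by apply: sw => //; rewrite -e23 [[set z1; z3]]setUC [[set z2; z3]]setUC set2_neq.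
  apply: (first_Z n0 z1 z2 z3) => //; try exact: sw.
  by move=> j y jN yy _; apply: hN'.
have zK x y : x \in [:: z1; z2; z3] -> y \in [:: z1; z2; z3] -> adj E x y -> adj K x y.
  move=> xZ yZ a; apply: sw => //; apply: contraNneq gZ => <-.
  by apply/subsetP => z; rewrite !inE => /orP[] /eqP->; rewrite !inE in xZ yZ *.
have k12 : adj K z1 z2 by apply: zK; rewrite // !inE eqxx ?orbT.
have k23 : adj K z2 z3 by apply: zK; rewrite // !inE eqxx ?orbT.
have k13 : adj K z1 z3 by apply: zK; rewrite // !inE eqxx ?orbT.
have k21 : adj K z2 z1 by rewrite KC.
have k31 : adj K z3 z1 by rewrite KC.
have [/hasP[n nN /hasP[x xs /eqP gnx]]|no] :=
    boolP (has (fun n => has (fun x => g == [set n; x]) ([:: z1; z2; z3; o; o'] ++ L)) Ns); last first.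
  apply: (first_Z n0 z1 z2 z3) => // j y jN yy _; apply: sw; first exact: hN.
  by apply: contraNneq no => <-; apply/hasP; exists j => //; apply/hasP; exists y.
have hK j y : j \in Ns -> y \in [:: z1; z2; z3; o; o'] ++ L -> ~~ ((j == n) && (y == x)) -> adj K j y.
  move=> jN yy nn; apply: sw; first exact: hN.
  rewrite gnx; apply: contraNneq nn => /set2_eq[[-> ->]|[jx _]]; first by rewrite !eqxx.
  by have := disN _ xs; rewrite -jx jN.
move: xs; rewrite -[[:: z1; z2; z3; o; o'] ++ L]/([:: z1, z2, z3, o, o' & L]) !inE.
case/or4P => [/eqP ex|/eqP ex|/eqP ex|/or3P[/eqP ex|/eqP ex|xL]]; try rewrite ex in hK.
- exact: (first_Z n z1 z2 z3).
- by apply: (first_Z n z2 z1 z3) => //; apply/permP => p; rewrite /=; flia.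
- by apply: (first_Z n z3 z1 z2) => //; apply/permP => p; rewrite /=; flia.
- exact: (first_o n o o').
- by apply: (first_o n o' o) => //; apply/permP => p; rewrite /=; flia.
exact: (first_L n x).
Qed.

End Extremal.

Lemma bin2S n : 'C(n.+1, 2) = 'C(n, 2) + n.
Proof. by rewrite binS bin1. Qed.

Lemma bin2_double n : 2 * 'C(n.+1, 2) = n.+1 * n.
Proof. by elim: n => // n IH; rewrite bin2S mulnDr IH; lia. Qed.

(** * Edge-maximal graphs without a spanning path *)

Section Closure.
Variable V : finType.
Implicit Types (E H : {set {set V}}) (D I R : {set V}).

Lemma edge_max_in k D E : pathfree k E -> E \subset pairs_in D ->
  exists H, [/\ E \subset H, H \subset pairs_in D, pathfree k H & edge_max k D H].
Proof.
move=> pf sE.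
have [|H /maxsetP[/andP[pH sH] mH] EH] := @maxset_exists _ (fun H => pathfree k H && (H \subset pairs_in D)) E.
  by rewrite pf sE.
exists H; split=> // x y xD yD nxy; apply: contraNN => pf'.
have := mH _ _ (subsetUr [set [set x; y]] H); rewrite pf' subUset sH sub1set pair_pairs_in // xD yD.
by move=> /(_ isT) eH; rewrite /adj nxy -eH in_setU1 eqxx.
Qed.

(** A spanning path through the added pair splits into two paths starting at [x] and [y], and
    [cross_count] with [h = 0] applies to each of them. *)
Lemma edge_max_degree_sum D H x y : 1 < #|D| -> H \subset pairs_in D -> pathfree #|D| H ->
  edge_max #|D| D H -> x \in D -> y \in D -> x != y -> ~~ adj H x y ->
  deg H D x + deg H D y + 2 <= #|D|.
Proof.
move=> D1 sH pf em xD yD nxy nadj.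
have := em _ _ xD yD nxy nadj.
rewrite negb_forall => /existsP[t]; rewrite negbK => /andP[Ut st].
have sK : [set x; y] |: H \subset pairs_in D by rewrite subUset sH sub1set pair_pairs_in // xD yD.
have tD : {subset t <= D} by apply: (sorted_sub sK st); rewrite size_tuple.
have Dt z : z \in D -> z \in t.
  have sub : {subset t <= enum D} by move=> w /tD; rewrite mem_enum.
  have le : size (enum D) <= size t by rewrite size_tuple cardE.
  have [_ h] := uniq_min_size Ut sub le.
  by rewrite h mem_enum.
case: (sorted_addE Ut st) => [s0|[s1 [u [v [s2 [et euv ss1 ss2]]]]]].
  by have := pathfreeP _ _ pf _ Ut s0; rewrite size_tuple ltnn.
have szt := size_tuple t; rewrite et in Ut szt.
pose a := u :: rev s1; pose b := v :: s2.
have sza : size a + size b = #|D| + 0 by rewrite /= size_rev -szt size_cat size_rcons /=; flia.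
have Uab : uniq (a ++ b).
  by apply: (uniq_of_count Ut) => p; rewrite /= !count_cat -cats1 count_cat count_rev /=; flia.
have Uba : uniq (b ++ a) by rewrite uniq_catC.
have sa : sorted (adj H) a by move: ss1; rewrite -sorted_rev ?rev_rcons //; apply: adj_sym.
have sb : sorted (adj H) b by [].
have Dab z : z \in D -> z \in a ++ b.
  move=> zD; have : z \in tval t := Dt _ zD; rewrite et !mem_cat mem_rcons !inE mem_rev.
  by case: (z == u); case: (z == v); case: (z \in s1); case: (z \in s2).
have du := deg_le_count (fun z zD _ => Dab z zD) : deg H D u <= count (adj H u) (a ++ b).
have dv := deg_le_count (fun z zD _ => Dab z zD) : deg H D v <= count (adj H v) (a ++ b).
rewrite count_cat in du; rewrite count_cat in dv.
have bnd p q c d : uniq (c ++ d) -> sorted (adj H) c -> sorted (adj H) d -> 0 < size c -> 0 < size d ->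
    head p c = p -> head q d = q -> size c + size d = #|D| + 0 ->
    count (adj H p) c + count (adj H q) c < size c.
  move=> Ucd sc sd c0 d0 hp hq sz.
  have [hs|] := boolP (has (adj H q) c).
    by have := cross_count pf Ucd sc sd c0 d0 hp hq sz hs; flia.
  rewrite has_count => h0; case: (c) c0 hp h0 => //= w c' _ -> h0.
  by rewrite adj_irr; have := count_size (adj H p) c'; flia.
have b1 := bnd u v a b Uab sa sb isT isT erefl erefl sza.
have b2 := bnd v u b a Uba sb sa isT isT erefl erefl (etrans (addnC _ _) sza).
by case/set2_eq: euv => -[<- <-]; flia.
Qed.

Lemma subset_card_exists (A : {set V}) m : m <= #|A| -> exists2 B : {set V}, B \subset A & #|B| = m.
Proof.
move=> mA; exists [set x in take m (enum A)].
  by apply/subsetP => x; rewrite inE => /mem_take; rewrite mem_enum.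
rewrite cardsE; have /card_uniqP -> : uniq (take m (enum A)) by rewrite take_uniq // enum_uniq.
by rewrite size_takel // -cardE.
Qed.

Lemma ein_compl H D R : R \subset D -> ein H R + ein (pairs_in D :\: H) R = 'C(#|R|, 2).
Proof.
move=> RD; rewrite -card_pairs_in /ein -(cardsID H (pairs_in R)) setIC; congr (_ + _).
apply: eq_card => e; rewrite !in_setI !in_setD; case eR: (e \in pairs_in R); rewrite ?andbF //.
by rewrite (subsetP (pairs_inS RD)) // !andbT.
Qed.

Lemma ein_subset H R D : R \subset D -> ein H R <= ein H D.
Proof. by move=> RD; apply: subset_leq_card; apply: setIS; apply: pairs_inS. Qed.

Lemma clique_of_ein H R x y : ein H R = 'C(#|R|, 2) -> x \in R -> y \in R -> x != y -> adj H x y.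
Proof.
move=> eR xR yR nxy; rewrite /adj nxy /=.
have : H :&: pairs_in R = pairs_in R.
  by apply/eqP; rewrite eqEcard subsetIr card_pairs_in -eR /ein leqnn.
by move/setP/(_ [set x; y]); rewrite in_setI pair_pairs_in // xR yR /= andbT.
Qed.

Lemma adj_compl D H x y : x \in D -> y \in D -> x != y ->
  adj (pairs_in D :\: H) x y = ~~ adj H x y.
Proof. by move=> xD yD n; rewrite /adj n in_setD pair_pairs_in // xD yD /= andbT. Qed.

Lemma ein_two M D I x y : x \in D -> y \in D -> x != y -> I \subset D :\ x :\ y ->
  ein M I + deg M D x + deg M D y <= ein M D + 1.
Proof.
move=> xD yD nxy sI.
have yD' : y \in D :\ x by rewrite !inE eq_sym nxy.
have := ein_rem M xD; have := ein_rem M yD'; have := ein_subset M sI.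
have : deg M D y <= deg M (D :\ x) y + 1.
  rewrite {1}/deg (cardsD1 x) addnC leq_add //; last by case: (_ \in _).
  by apply: subset_leq_card; apply/subsetP => u; rewrite !inE => /and3P[-> -> ->].
flia.
Qed.

(* [l - 1] dominating vertices link the blocks of a matching with three edges into a spanning path. *)
Lemma matching_path D (T : {set V}) l H : #|D| = 2 * l + 2 -> T \subset D -> #|T| = l + 3 -> 2 <= l ->
  (forall j x, j \in D :\: T -> x \in T -> adj H j x) ->
  (forall x, x \in T -> deg H T x <= 1) -> 3 <= ein H T -> ~~ pathfree (2 * l + 2) H.
Proof.
move=> cD TD cT l2 dom d1 e3; apply/negP => pf.
have nb x y z : x \in T -> y \in T -> z \in T -> adj H x y -> adj H x z -> y = z.
  move=> xT yT zT xy xz; have := d1 x xT; move/card_le1P => /(_ y).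
  by rewrite inE yT xy => /(_ isT z); rewrite inE zT xz => /esym/eqP.
case/card_gt2P: e3 => e1 [e2 [e3 [[h1 h2 h3] [n12 n23 n31]]]].
have ex e : e \in H :&: pairs_in T -> exists a b, [/\ a \in T, b \in T, adj H a b & e = [set a; b]].
  rewrite in_setI => /andP[eH /pairs_inP[a [b [aT bT nab ee]]]]; exists a, b; split=> //.
  by rewrite /adj nab -ee.
have [a1 [b1 [a1T b1T ab1 ee1]]] := ex _ h1.
have [a2 [b2 [a2T b2T ab2 ee2]]] := ex _ h2.
have [a3 [b3 [a3T b3T ab3 ee3]]] := ex _ h3.
have dis a b c d : a \in T -> b \in T -> c \in T -> d \in T -> adj H a b -> adj H c d ->
    [set a; b] != [set c; d] -> [&& a != c, a != d, b != c & b != d].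
  move=> aT bT cT' dT ab cd n; apply/and4P; split; apply: contraNneq n => e; subst.
  - by rewrite (nb c b d).
  - by rewrite setUC (nb d b c) // adj_sym.
  - by rewrite setUC (nb c a d) // adj_sym.
  by rewrite (nb d a c) // adj_sym.
rewrite ee1 ee2 ee3 in n12 n23 n31.
have /and4P[p1 p2 p3 p4] := dis _ _ _ _ a1T b1T a2T b2T ab1 ab2 n12.
have /and4P[q1 q2 q3 q4] := dis _ _ _ _ a2T b2T a3T b3T ab2 ab3 n23.
have /and4P[r1 r2 r3 r4] := dis _ _ _ _ a3T b3T a1T b1T ab3 ab1 n31.
pose six := [:: a1; b1; a2; b2; a3; b3].
have U6 : uniq six.
  rewrite /= !inE !negb_or (adj_neq ab1) (adj_neq ab2) (adj_neq ab3) p1 p2 p3 p4 q1 q2 q3 q4.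
  by rewrite ![_ == a3]eq_sym ![_ == b3]eq_sym r1 r2 r3 r4.
pose rest := [seq x <- enum T | x \notin six].
have pT : perm_eq (six ++ rest) (enum T).
  apply: uniq_perm; rewrite ?enum_uniq //.
    rewrite cat_uniq U6 filter_uniq ?enum_uniq // andbT.
    by apply/hasPn => x; rewrite mem_filter => /andP[].
  move=> x; rewrite mem_cat mem_filter mem_enum; case xs : (x \in six) => //=.
  by move: xs; rewrite !inE => /or4P[/eqP->|/eqP->|/eqP->|/or3P[]/eqP->].
have zr : size rest + 6 = l + 3.
  by have := perm_size pT; rewrite size_cat -cardE cT /=; flia.
pose js := enum (D :\: T).
have zj : size js + 1 = l.
  by rewrite /js -cardE; have := cardsID T D; rewrite (setIidPr TD) cD cT; flia.
pose sing := [seq [:: x] | x <- rest].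
have fsing (t : seq V) : flatten [seq [:: x] | x <- t] = t by elim: t => //= x t ->.
have bsing (t : seq V) : all (block (adj H)) [seq [:: x] | x <- t] by elim: t.
pose bs := [:: a2; b2] :: [:: a3; b3] :: sing.
have sz : size js = size bs by rewrite /= size_map; flia.
have fb : [:: a1; b1] ++ flatten bs = six ++ rest by rewrite /= fsing.
have ss : sorted (adj H) (weave [:: a1; b1] js bs).
  apply: weave_sorted; first exact: adj_sym.
  - by rewrite /block /= ab1.
  - by rewrite /= /block /= ab2 ab3 bsing.
  move=> j x jj; rewrite fb (perm_mem pT) mem_enum => xT; apply: dom => //.
  by move: jj; rewrite mem_enum.
have us : uniq (weave [:: a1; b1] js bs).
  apply: (@uniq_of_count V _ (js ++ six ++ rest)).
    rewrite cat_uniq enum_uniq (perm_uniq pT) enum_uniq andbT; apply/hasPn => x.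
    by rewrite (perm_mem pT) !mem_enum inE => ->.
  move=> p; have := congr1 (count p) fb; rewrite !count_cat => e; rewrite count_weave // !count_cat.
  by flia.
have szf : size [:: a1; b1] + size (flatten bs) = size six + size rest by rewrite -!size_cat fb.
have z6 : size six = 6 by []. have z2 : size [:: a1; b1] = 2 by [].
have := pathfreeP _ _ pf _ us ss; rewrite size_weave //; flia.
Qed.

End Closure.

(** The product is concave in [c] and equals [l] at [c = 1] and [c = l]. *)
Lemma mul_gap c l : 0 < c -> c <= l -> l <= c * (l + 1 - c).
Proof.
move=> c0 cl; have [b ->] : exists b, l = c + b by exists (l - c); lia.
have -> : c + b + 1 - c = b + 1 by lia.
by case: c c0 {cl} => // c _; rewrite mulnDr muln1 addnC leq_add2r leq_pmull.
Qed.

(** The left side is convex in [h], with equality at [h = 0] and [h = l - 1]. *)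
Lemma quad_gap h l : 0 < h -> h.+1 < l -> l * (l - h + 1) + h.+1 * h < l * l + l.
Proof.
move=> h0 hl; have [b ->] : exists b, l = h + b + 2 by exists (l - h - 2); lia.
have -> : h + b + 2 - h + 1 = b + 3 by lia.
rewrite !mulnDl !mulnDr mulSn; lia.
Qed.

(** * Case analysis on the degrees of an edge-maximal supergraph of order 2l + 2 *)

Section SmallestOrder.
Variables (V : finType) (col : {set V} -> nat) (D : {set V}) (l : nat).
Implicit Types (E : {set {set V}}) (R : {set V}).
Hypothesis no_rainbow_path : forall E : {set {set V}}, rainbow col E -> pathfree (2 * l + 2) E.
Hypothesis l_ge2 : 2 <= l.
Hypothesis D_card : #|D| = 2 * l + 2.

(** The consequence of an (l+1)-core with at most [l + 2] vertices: outside it vertices of degree at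
    most [l] can be deleted, and ['C(l + 2, 2) = 'C(l, 2) + 2 * l + 1] yields the summand 1. *)
Definition core_bound E := forall R, R \subset D -> l <= #|R| ->
  ein E R <= 'C(l, 2) + l * (#|R| - l) + 1.

Section NoIsolated.
Variable E : {set {set V}}.
Hypothesis rE : rainbow col E.
Hypothesis E_in : E \subset pairs_in D.
Hypothesis core : core_bound E.
(** One more than the second term of the claimed maximum for [n = 2 * l + 2]. *)
Hypothesis E_card : 'C(l, 2) + l * l + l + 1 <= #|E|.
Hypothesis no_iso : forall x, x \in D -> 0 < deg E D x.

(** A clique on [l + 2] vertices and [l] vertices of degree [l - 1] give exactly the number of edges
    demanded, so equality holds throughout: [D :\: Q] is a clique and [Q] is independent with all
    degrees [l - 1]. The degree sums in [H] force the vertices of [Q] to have the same neighbours,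
    which is the configuration of [pendant_case]. *)
Lemma clique_case (Q : {set V}) (H : {set {set V}}) : E \subset H -> Q \subset D -> #|Q| = l ->
  (forall q, q \in Q -> deg H D q <= l - 1) ->
  (forall x y, x \in D -> y \in D -> x != y -> ~~ adj H x y -> deg H D x + deg H D y <= 2 * l) ->
  False.
Proof.
move=> EH QD cQ dQ ds.
have dQE q : q \in Q -> deg E D q <= l - 1.
  by move=> /dQ; apply: leq_trans; apply: degS.
have sumE := ein_degree_sum E QD; rewrite (ein_full E_in) in sumE.
have cR : #|D :\: Q| = l + 2.
  by have := cardsID Q D; rewrite (setIidPr QD) D_card cQ; flia.
have cl2 : 'C(l + 2, 2) = 'C(l, 2) + l + l.+1 by rewrite addn2 !bin2S.
have eR := ein_le E (D :\: Q); rewrite cR in eR.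
have sQ : \sum_(q in Q) deg E D q <= \sum_(q in Q) (l - 1) by apply: leq_sum => q; apply: dQE.
rewrite sum_nat_const cQ in sQ.
have ll : l * (l - 1) + l = l * l by rewrite -mulnSr; congr (_ * _); flia.
have eR' : ein E (D :\: Q) = 'C(#|D :\: Q|, 2) by rewrite cR; flia.
have eQ0 : ein E Q = 0 by flia.
have sQ' : \sum_(q in Q) deg E D q = l * (l - 1) by flia.
have dQ' q : q \in Q -> deg E D q = l - 1.
  move=> qQ; apply/eqP; rewrite eqn_leq dQE //= leqNgt; apply/negP => lt.
  suff : \sum_(q in Q) deg E D q < \sum_(q in Q) (l - 1) by rewrite sum_nat_const cQ sQ' ltnn.
  rewrite (big_setD1 q qQ) [X in _ < X](big_setD1 q qQ) /= -addSn leq_add //.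
  by apply: leq_sum => q' /setD1P[_]; apply: dQE.
set R := D :\: Q in cR eR eR' sumE.
have RD : R \subset D by apply: subsetDl.
have clR x y : x \in R -> y \in R -> x != y -> adj E x y by apply: clique_of_ein.
have indQ x y : x \in Q -> y \in Q -> adj E x y = false.
  move=> xQ yQ; apply/negP => a; have := deg_le_ein E xQ; rewrite eQ0 leqn0 cards_eq0.
  by move/eqP/setP/(_ y); rewrite !inE yQ a.
have nbrs q r : q \in Q -> adj H q r -> r \in D -> adj E q r.
  move=> qQ a rD; have : [set z in D | adj E q z] = [set z in D | adj H q z].
    apply/eqP; rewrite eqEcard -/(deg E D q) -/(deg H D q) dQ' // dQ // andbT.
    by apply/subsetP => z; rewrite !inE => /andP[-> /(adjS EH)].
  by move/setP/(_ r); rewrite !inE rD a.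
have same q q' r : q \in Q -> q' \in Q -> adj E q r -> adj E q' r.
  move=> qQ q'Q a; have rD : r \in D by case/andP: (adj_in E_in a).
  have rR : r \in R by rewrite inE rD andbT; apply/negP => rQ; rewrite indQ in a.
  apply/negPn/negP => na.
  have q'D := subsetP QD _ q'Q.
  have nqr : q' != r by apply: contraTneq rR => <-; rewrite inE q'Q.
  have nH : ~~ adj H q' r by apply: contra na => aH; apply: nbrs.
  have := ds _ _ q'D rD nqr nH.
  have d1 : deg E D q' <= deg H D q' by apply: degS.
  have d2 : l + 2 <= deg H D r.
    apply: (@leq_trans (deg E D r)); last exact: degS.
    apply: (@leq_trans #|q |: (R :\ r)|).
      rewrite cardsU1 !inE qQ /= andbF /=; have := cardsD1 r R; rewrite rR; flia.
    apply: subset_leq_card; apply/subsetP => z; rewrite in_setU1 => /orP[/eqP->|/setD1P[nz zR]].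
      by rewrite inE (subsetP QD) // adj_sym.
    by rewrite inE (subsetP RD) // clR // eq_sym.
  by have := dQ' _ q'Q; flia.
have : 0 < #|Q| by flia.
case/card_gt0P => q0 q0Q.
pose N := [set r in D | adj E q0 r].
have cN : #|N| = l - 1 by apply: dQ'.
have NR : N \subset R.
  apply/subsetP => r; rewrite !inE => /andP[-> a]; rewrite andbT; apply/negP => rQ.
  by rewrite indQ in a.
have cZ : #|R :\: N| = 3 by have := cardsID N R; rewrite (setIidPr NR) cR cN; flia.
case eZ : (enum (R :\: N)) (cZ) => [|z1 [|z2 [|z3 [|]]]]; rewrite cardE ?eZ //= => _.
case eL : (enum Q) (cQ) => [|o [|o' L]]; rewrite cardE ?eL /=; try flia.
move=> sL.
have UZ := enum_uniq (R :\: N); rewrite eZ in UZ.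
have UL := enum_uniq Q; rewrite eL in UL.
have zZ z : z \in [:: z1; z2; z3] -> (z \in R) && (z \notin N).
  by rewrite -eZ mem_enum inE andbC.
have zL z : z \in [:: o, o' & L] -> z \in Q by rewrite -eL mem_enum.
have zz i j : i \in [:: z1; z2; z3] -> j \in [:: z1; z2; z3] -> i != j -> adj E i j.
  by move=> /zZ/andP[iR _] /zZ/andP[jR _]; apply: clR.
move: (UZ); rewrite /= !inE !negb_or => /and3P[/andP[n12 n13] n23 _].
apply: (@pendant_case V col E l no_rainbow_path rE l_ge2 (enum N) L z1 z2 z3 o o').
- by rewrite -cardE cN; flia.
- by [].
- rewrite -[[:: z1; z2; z3; o; o'] ++ L]/([:: z1; z2; z3] ++ [:: o, o' & L]).
  have UZL : uniq ([:: z1; z2; z3] ++ [:: o, o' & L]).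
    rewrite cat_uniq UZ UL andbT andTb; apply/hasPn => z /zL zQ; apply/negP => /zZ/andP[].
    by rewrite inE zQ.
  rewrite cat_uniq enum_uniq UZL andbT andTb; apply/hasPn => z; rewrite mem_cat.
  case/orP => [/zZ/andP[_ zN]|/zL zQ]; rewrite /= mem_enum //.
  by apply/negP => /(subsetP NR); rewrite inE zQ.
- move=> n x; rewrite mem_enum => nN.
  rewrite -[[:: z1; z2; z3; o; o'] ++ L]/([:: z1; z2; z3] ++ [:: o, o' & L]) mem_cat.
  case/orP => [/zZ/andP[xR xN]|/zL xQ].
    apply: clR => //; first exact: (subsetP NR).
    by apply: contraNneq xN => <-.
  rewrite adj_sym; apply: (same q0) => //; by move: nN; rewrite inE => /andP[].
- by apply: zz; rewrite ?inE ?eqxx ?orbT.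
- by apply: zz; rewrite ?inE ?eqxx ?orbT.
by apply: zz; rewrite ?inE ?eqxx ?orbT.
Qed.

(** The complement of [H] has at most [l - 1] pairs beyond the ['C(l + 2, 2)] that the small degrees
    in [I] force. So [J] is a clique of [H], and all its vertices but at most one are adjacent to
    everything. Without exception [I] is independent and [independent_case] applies; otherwise the
    exception and [I] induce a matching with at least three edges, as in [matching_path]. *)
Lemma balanced_case (I : {set V}) (H : {set {set V}}) : E \subset H -> H \subset pairs_in D -> pathfree (2 * l + 2) H ->
  I \subset D -> #|I| = l + 2 -> (forall i, i \in I -> deg H D i <= l) ->
  (forall x y, x \in D -> y \in D -> x != y -> ~~ adj H x y -> deg H D x + deg H D y <= 2 * l) ->
  False.
Proof.
move=> EH HP pfH ID cI dI ds.
pose M := pairs_in D :\: H; pose c x := deg M D x.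
have cE x : x \in D -> deg H D x + c x = 2 * l + 1.
  by move=> xD; have := deg_compl H xD; rewrite D_card -/(c x); flia.
pose J := D :\: I.
have cJ : #|J| = l by have := cardsID I D; rewrite (setIidPr ID) D_card cI -/J; flia.
have eHM := @ein_compl V H D D (subxx _); rewrite (ein_full HP) D_card -/M in eHM.
have eIM := @ein_compl V H D I ID; rewrite cI -/M in eIM.
have cEH := subset_leq_card EH.
have B1 : 2 * 'C(2 * l + 2, 2) = (2 * l + 2) * (2 * l + 1) by rewrite addn2 bin2_double addn1.
have B2 : 2 * 'C(l + 2, 2) = (l + 2) * (l + 1) by rewrite addn2 bin2_double addn1.
have B3 : 2 * 'C(l, 2) + l = l * l by case: (l) => // m; rewrite bin2_double; lia.
have ebar : ein M D <= 'C(l + 2, 2) + l - 1.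
  have E1 : (2 * l + 2) * (2 * l + 1) = 4 * (l * l) + 6 * l + 2 by lia.
  have E2 : (l + 2) * (l + 1) = l * l + 3 * l + 2 by lia.
  rewrite E1 in B1; rewrite E2 in B2; have := E_card; move: B1 B2 B3 eHM cEH.
  move: ('C(2 * l + 2, 2)) ('C(l + 2, 2)) ('C(l, 2)) (l * l) => x1 x2 x3 x4; flia.
have sumM := ein_degree_sum M ID; rewrite -/J in sumM.
have sumlow : (l + 2) * (l + 1) <= \sum_(x in I) deg M D x.
  rewrite -cI -sum_nat_const; apply: leq_sum => i iI.
  by have := cE i (subsetP ID _ iI); have := dI i iI; rewrite /c; flia.
have eI : ein H I <= l - 1 by flia.
have sumup : \sum_(x in I) deg M D x <= (l + 2) * (l + 1) + (l - 1) by flia.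
have two j j' : j \in J -> j' \in J -> j != j' -> c j + c j' <= 2 * l - 1.
  move=> jJ j'J n; have jD : j \in D by move: jJ; rewrite inE => /andP[].
  have j'D : j' \in D by move: j'J; rewrite inE => /andP[].
  have sI : I \subset D :\ j :\ j'.
    apply/subsetP => i iI; rewrite !inE (subsetP ID) // andbT.
    by apply/andP; split; apply: contraTneq iI => ->; [move: j'J | move: jJ]; rewrite inE => /andP[].
  by have := @ein_two V M D I j j' jD j'D n sI; rewrite -/(c j) -/(c j'); flia.
have JD j : j \in J -> j \in D by rewrite inE => /andP[].
have clJ j j' : j \in J -> j' \in J -> j != j' -> adj H j j'.
  move=> jJ j'J n; apply/negPn/negP => na.
  have := ds j j' (JD _ jJ) (JD _ j'J) n na; have := two _ _ jJ j'J n.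
  by have := cE _ (JD _ jJ); have := cE _ (JD _ j'J); flia.
have degJ j : j \in J -> c j = deg M I j.
  move=> jJ; rewrite /c (deg_split M j ID) -/J; suff -> : deg M J j = 0 by [].
  apply/eqP; rewrite cards_eq0; apply/eqP/setP => j'; rewrite !inE.
  apply/negP => /andP[/andP[j'I j'D] a]; have nn := adj_neq a.
  have j'J : j' \in J by rewrite inE j'I.
  by move: a; rewrite /M adj_compl ?JD // clJ.
(* If [1 <= c j <= l], the degree sums force [l + 1 - c j] extra missing pairs at each of the [c j]
   non-neighbours of [j], at least [l] in total by [mul_gap]. *)
have big j : j \in J -> 0 < c j -> l < c j.
  move=> jJ c0; rewrite ltnNge; apply/negP => cl.
  have : \sum_(i in I) (l + 1 + (if adj M j i then l + 1 - c j else 0)) <= \sum_(x in I) deg M D x.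
    apply: leq_sum => i iI; have iD := subsetP ID _ iI.
    have := dI i iI; have := cE i iD; rewrite -/(c i).
    case: ifP => a; last by flia.
    have n := adj_neq a; have jD := JD _ jJ.
    have na : ~~ adj H j i by move: a; rewrite /M adj_compl.
    by have := ds j i (JD _ jJ) iD n na; have := cE _ (JD _ jJ); flia.
  rewrite big_split /= sum_nat_const cI -big_mkcondr /= sum_nat_const.
  have -> : #|[pred i in I | adj M j i]| = c j.
    by rewrite degJ //; apply: eq_card => i; rewrite !inE.
  move=> h; have : c j * (l + 1 - c j) <= l - 1 by flia.
  have := mul_gap c0 cl.
  flia.
have [/exists_inP[j0 j0J c0]|none] := boolP [exists j in J, 0 < c j]; last first.
  have zero j : j \in J -> c j = 0.
    by move=> jJ; apply/eqP; rewrite -leqn0 leqNgt; apply: contra none => cj; apply/exists_inP; exists j.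
  have ind i : i \in I -> deg E I i = 0.
    move=> iI; have iD := subsetP ID _ iI.
    have dMJ : deg M J i = 0.
      apply/eqP; rewrite cards_eq0; apply/eqP/setP => j; rewrite !inE; apply/negP => /andP[/andP[jI jD] a].
      have jJ : j \in J by rewrite inE jI.
      have := zero _ jJ; rewrite /c /deg => /eqP; rewrite cards_eq0 => /eqP/setP/(_ i).
      by rewrite !inE iD adj_sym a.
    have := deg_split M i ID; rewrite -/J dMJ -/(c i) add0n => ci.
    have := deg_compl H iI; rewrite cI.
    have : deg M I i <= deg (pairs_in I :\: H) I i.
      apply: subset_leq_card; apply/subsetP => z; rewrite !inE => /andP[zI a]; rewrite zI /=.
      have n := adj_neq a; move: a; rewrite /M !adj_compl //; exact: (subsetP ID).
    have := cE i iD; have := dI i iI; have := @degS _ E H I I i EH (subxx _); flia.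
  apply: (@independent_case V col E l no_rainbow_path rE l_ge2 J I) => //.
    by rewrite -setI_eq0; apply/eqP/setP => z; rewrite !inE; case: (z \in I); rewrite ?andbF.
  have sE := ein_degree_sum E ID; rewrite (ein_full E_in) -/J in sE.
  have eJ := ein_le E J; rewrite cJ in eJ.
  have e1 : missing (adj E) I J + \sum_(i in I) deg E D i = (l + 2) * l.
    rewrite /missing -big_split /= -cI -sum_nat_const; apply: eq_bigr => i iI.
    rewrite (deg_split E i ID) -/J (ind i iI) addn0 -cJ -(cardsID [set j | adj E i j] J) addnC.
    by congr (_ + _); apply: eq_card => j; rewrite !inE andbC // andbC.
  have e2 : (l + 2) * l = l * l + 2 * l by lia.
  have eI0 : ein E I <= ein H I by apply: einS.
  by rewrite e2 in e1; have := E_card; flia.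
have lc := big _ j0J c0.
have zero j : j \in J -> j != j0 -> c j = 0.
  move=> jJ n; apply/eqP; rewrite -leqn0 leqNgt; apply/negP => cj.
  by have := big _ jJ cj; have := two _ _ jJ j0J n; flia.
pose T := j0 |: I.
have TD : T \subset D by rewrite subUset sub1set JD.
have j0I : j0 \notin I by move: j0J; rewrite inE => /andP[].
have cT : #|T| = l + 3 by rewrite cardsU1 j0I cI; flia.
have dT x : x \in T -> deg H D x <= l.
  rewrite in_setU1 => /orP[/eqP->|]; last exact: dI.
  by have := cE _ (JD _ j0J); flia.
have dom j x : j \in D :\: T -> x \in D -> j != x -> adj H j x.
  rewrite !inE negb_or => /andP[/andP[jj0 jI] jD] xD n.
  have jJ : j \in J by rewrite inE jI.
  apply/negPn/negP => na; have := zero _ jJ jj0; rewrite /c /deg => /eqP.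
  by rewrite cards_eq0 => /eqP/setP/(_ x); rewrite !inE xD /M adj_compl // na.
have := pfH; apply/negP; apply: (@matching_path V D T l H) => //.
- move=> j x jT xT; apply: dom => //; first exact: (subsetP TD).
  by apply: contraTneq xT => <-; move: jT; rewrite inE => /andP[].
- move=> x xT; have := dT _ xT; rewrite (deg_split H x TD).
  suff : l - 1 <= deg H (D :\: T) x by flia.
  have <- : #|D :\: T| = l - 1 by have := cardsID T D; rewrite (setIidPr TD) D_card cT; flia.
  apply: subset_leq_card; apply/subsetP => j jT; rewrite inE jT /= adj_sym.
  apply: dom => //; first exact: (subsetP TD).
  by apply: contraTneq xT => <-; move: jT; rewrite inE => /andP[].
have := @ein_compl V H D T TD; rewrite cT -/M; have := ein_subset M TD.
by rewrite addn3 bin2S -[l.+2]addn2; flia.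
Qed.

(** As in Chvátal's theorem, take a non-adjacent pair of largest degree sum, with degrees
    [h <= deg H D y]. All non-neighbours of [y] have degree at most [h], and there are more than [h]
    of them. By [core] and [quad_gap] this leaves too few edges unless [h] is 0, [l - 1] or [l], and
    [no_iso] excludes 0. *)
Lemma order_2l2_no_isolated : False.
Proof.
have pfE := no_rainbow_path rE.
have [H [EH HP pfH em]] := edge_max_in pfE E_in.
have D1 : 1 < #|D| by flia.
have ds x y : x \in D -> y \in D -> x != y -> ~~ adj H x y -> deg H D x + deg H D y <= 2 * l.
  move=> xD yD n na; have := @edge_max_degree_sum V D H x y D1 HP.
  rewrite D_card => /(_ pfH em xD yD n na); flia.
pose P (p : V * V) := [&& p.1 \in D, p.2 \in D, p.1 != p.2 & ~~ adj H p.1 p.2].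
have [p0 p0P] : exists p, P p.
  have [/existsP[p pP]|no] := boolP [exists p, P p]; first by exists p.
  exfalso; have : size (enum D) < 2 * l + 2.
    apply: (pathfreeP _ _ pfH); rewrite ?enum_uniq //; apply: clique_sorted; rewrite ?enum_uniq //.
    move=> x y; rewrite !mem_enum => xD yD n; apply: contraNT no => na.
    by apply/existsP; exists (x, y); rewrite /P /= xD yD n.
  by rewrite -cardE D_card ltnn.
case: (@arg_maxnP _ p0 P (fun p => deg H D p.1 + deg H D p.2) p0P) => -[x y] /= xyP xymax.
wlog le : x y xyP xymax / deg H D x <= deg H D y.
  move=> W; have [le|lt] := leqP (deg H D x) (deg H D y); first exact: (W x y).
  apply: (W y x) => //; last exact: ltnW.
    by case/and4P: xyP => /= h1 h2 h3 h4; rewrite /P /= h2 h1 eq_sym h3 adj_sym.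
  by move=> p pP; rewrite [X in _ <= X]addnC; apply: xymax.
case/and4P: xyP => /= xD yD nxy na.
have dsxy := ds _ _ xD yD nxy na.
set h := deg H D x in xymax le dsxy.
have h1 : 0 < h by apply: leq_trans (no_iso xD) _; apply: degS.
pose M := pairs_in D :\: H; pose L0 := [set z in D | adj M y z].
have cL0 : #|L0| + deg H D y = 2 * l + 1.
  by have := deg_compl H yD; rewrite D_card -/M /L0 -/(deg M D y); flia.
have L0P z : z \in L0 -> [/\ z \in D, y != z & deg H D z <= h].
  rewrite inE => /andP[zD a]; have n := adj_neq a; split=> //.
  have nz : ~~ adj H y z by move: a; rewrite /M adj_compl.
  have := xymax (y, z); rewrite /P /= yD zD n nz => /(_ isT); rewrite /geq /=; flia.
have [hl|hl] := ltnP h l; last first.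
  apply: (@balanced_case (y |: L0) H) => //.
  - by rewrite subUset sub1set yD; apply/subsetP => z; rewrite inE => /andP[].
  - by rewrite cardsU1 inE adj_irr andbF; flia.
  by move=> i; rewrite in_setU1 => /orP[/eqP->|/L0P[_ _]]; flia.
have [Q QL cQ] : exists2 Q : {set V}, Q \subset L0 & #|Q| = h.+1.
  by apply: subset_card_exists; flia.
have QD : Q \subset D by apply: subset_trans QL _; apply/subsetP => z; rewrite inE => /andP[].
have dQ q : q \in Q -> deg H D q <= h by move=> /(subsetP QL)/L0P[].
have [e1|lt1] := eqVneq h.+1 l.
  apply: (@clique_case Q H) => //; first by rewrite cQ.
  by move=> q /dQ; flia.
have sE := ein_degree_sum E QD; rewrite (ein_full E_in) in sE.
have cR : #|D :\: Q| = 2 * l + 1 - h.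
  by have := cardsID Q D; rewrite (setIidPr QD) D_card cQ; flia.
have := core (subsetDl D Q); rewrite cR => /(_ ltac:(flia)) cb.
have sQ : \sum_(q in Q) deg E D q <= \sum_(q in Q) h.
  by apply: leq_sum => q /dQ; apply: leq_trans; apply: degS.
rewrite sum_nat_const cQ in sQ.
have e2 : 2 * l + 1 - h - l = l - h + 1 by flia.
rewrite e2 in cb; have := E_card.
have : l * (l - h + 1) + h.+1 * h < l * l + l by apply: quad_gap => //; flia.
flia.
Qed.

End NoIsolated.

(** If [z] is isolated, the other vertices attain [core_bound], hence all have degree at least [l].
    Exchanging in a pair [zy] then gives a graph without isolated vertices that satisfies the same
    bounds. *)
Theorem order_2l2_false E : rainbow col E -> E \subset pairs_in D -> core_bound E ->
  'C(l, 2) + l * l + l + 1 <= #|E| -> False.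
Proof.
move=> rE E_in core E_card.
have [/exists_inP[z zD /eqP dz]|no] := boolP [exists z in D, deg E D z == 0]; last first.
  apply: (order_2l2_no_isolated rE E_in core E_card) => x xD; rewrite lt0n.
  by apply: contra no => dx; apply/exists_inP; exists x.
have cDz := cardsD1 z D; rewrite zD D_card in cDz.
have eDz : ein E (D :\ z) = #|E| by have := ein_rem E zD; rewrite dz addn0 (ein_full E_in).
have cb := core _ (subD1set D z) ltac:(flia).
have e1 : #|D :\ z| - l = l + 1 by flia.
have ll : l * (l + 1) = l * l + l by lia.
rewrite eDz e1 ll in cb.
have dl y : y \in D :\ z -> l <= deg E D y.
  move=> yD; have cy := cardsD1 y (D :\ z); rewrite yD in cy.
  have sub : D :\ z :\ y \subset D by apply: subset_trans (subD1set _ _) (subD1set _ _).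
  have := core _ sub ltac:(flia); have -> : #|D :\ z :\ y| - l = l by flia.
  have := ein_rem E yD; rewrite eDz; have := @degS _ E E (D :\ z) D y (subxx _) (subD1set _ _).
  by flia.
have : 0 < #|D :\ z| by flia.
case/card_gt0P => y yDz; have := yDz; rewrite !inE => /andP[nyz yD].
have nzy : z != y by rewrite eq_sym.
have eP : [set z; y] \in pairs_in [set: V] by rewrite pair_pairs_in // !inE.
have [g [rK g2 hg]] := rainbow_swap rE eP; set K := _ |: _ in rK.
have nE : [set z; y] \notin E.
  apply/negP => h; have := dz; rewrite /deg => /eqP; rewrite cards_eq0 => /eqP/setP/(_ y).
  by rewrite !inE yD /adj nzy h.
have cK : #|E| <= #|K|.
  rewrite /K cardsU1 !inE (negPf nE) andbF /=; have := cardsD1 g E; case: (g \in E); flia.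
have KP : K \subset pairs_in D.
  rewrite subUset sub1set pair_pairs_in // zD yD /=; apply: subset_trans E_in; exact: subD1set.
have einK R : z \notin R -> ein K R <= ein E R.
  move=> zR; apply: subset_leq_card; apply/subsetP => e; rewrite !in_setI in_setU1 => /andP[h eR].
  rewrite eR andbT; case/orP: h => [/eqP ee|/setD1P[] //].
  by move: eR; rewrite ee pair_pairs_in // (negPf zR).
have dKz R : deg K R z <= 1.
  apply: leq_trans (_ : #|[set y]| <= 1); last by rewrite cards1.
  apply: subset_leq_card; apply/subsetP => w; rewrite !inE => /andP[_].
  rewrite /K adjU1 => /orP[a|/andP[_ /eqP/set2_eq[[_ ->]|[-> ->]]]] //.
  have aE : adj E z w by apply: adjS a; apply: subD1set.
  have wD : w \in D by case/andP: (adj_in E_in aE).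
  by have := dz; rewrite /deg => /eqP; rewrite cards_eq0 => /eqP/setP/(_ w); rewrite !inE wD aE.
have coreK : core_bound K.
  move=> R RD lR; have [zR|zR] := boolP (z \in R); last by apply: leq_trans (einK _ zR) (core _ RD lR).
  have cR := cardsD1 z R; rewrite zR in cR.
  have [eR|gtR] := eqVneq #|R| l.
    by apply: leq_trans (ein_le _ _) _; rewrite eR; flia.
  have zRz : z \notin R :\ z by rewrite !inE eqxx.
  have := core (R :\ z) (subset_trans (subD1set _ _) RD) ltac:(flia).
  have := einK _ zRz; have := ein_rem K zR; have := dKz R.
  have -> : #|R| - l = (#|R :\ z| - l).+1 by flia.
  by rewrite mulnS; flia.
apply: (order_2l2_no_isolated rK KP coreK) => [|x xD]; first by apply: leq_trans E_card cK.
have [->|nx] := eqVneq x z.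
  by apply/card_gt0P; exists y; rewrite inE yD adj_link.
have := dl x ltac:(by rewrite !inE nx); have := deg_del E D x g2.
have : deg (E :\ g) D x <= deg K D x by apply: degS => //; apply: subsetUr.
by case: (x \in g); flia.
Qed.

End SmallestOrder.

(** * Even k with a small (l+1)-core *)

Section EvenCase.
Variables (V : finType) (col : {set V} -> nat) (l : nat).
Hypothesis no_rainbow_path : forall E : {set {set V}}, rainbow col E -> pathfree (2 * l + 2) E.
Hypothesis l_ge2 : 2 <= l.

(** The constant 3 exceeds epsilon = 2 by one. It gives exactly the bound demanded by
    [order_2l2_false], and for [l = 2] the [#|D| + 2] edges needed by
    [disconnected_min_deg_false]. *)
Theorem core_bounded_false (D : {set V}) (E : {set {set V}}) :
  2 * l + 2 <= #|D| -> rainbow col E -> core_bound D l E ->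
  'C(l - 1, 2) + (l - 1) * (#|D| - l + 1) + 3 <= ein E D -> False.
Proof.
have [m] := ubnP #|D|; elim: m D E => // m IH D E lt kD rE core cE.
pose F := E :&: pairs_in D.
have FE : F \subset E by apply: subsetIl. have FD : F \subset pairs_in D by apply: subsetIr.
have rF : rainbow col F by apply: rainbow_subset rE.
have cF : ein E D = #|F| by [].
have coreF : core_bound D l F by move=> R RD lR; apply: leq_trans (einS _ FE) (core R RD lR).
have [eD|nD] := eqVneq #|D| (2 * l + 2).
  apply: (@order_2l2_false V col D l no_rainbow_path l_ge2 eD F rF FD coreF).
  rewrite -cF; apply: leq_trans cE.
  have -> : #|D| - l + 1 = l + 3 by flia.
  have e1 : 'C(l, 2) = 'C(l - 1, 2) + (l - 1) by rewrite -bin2S -subSn ?subn1 //; flia.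
  have e2 : (l - 1) * (l + 3) + 3 = l * l + 2 * l by nia.
  by rewrite e1; flia.
have [/exists_inP[x xD dx]|] := boolP [exists x in D, deg E D x < l].
  have cx := cardsD1 x D; rewrite xD in cx.
  apply: (IH (D :\ x) E) => //; try flia.
    by move=> R RD; apply: core; apply: subset_trans RD (subD1set _ _).
  have := ein_rem E xD.
  have -> : #|D :\ x| - l + 1 = #|D| - l by flia.
  have : (l - 1) * (#|D| - l + 1) = (l - 1) * (#|D| - l) + (l - 1) by rewrite mulnDr muln1.
  flia.
rewrite negb_exists => /forallP hd.
have md x : x \in D -> l <= deg F D x.
  move=> xD; have := hd x; rewrite xD /= -leqNgt => h; apply: leq_trans h _.
  apply: subset_leq_card; apply/subsetP => y; rewrite !inE => /andP[yD a]; rewrite yD /=.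
  by case/andP: a => n h; rewrite /adj n in_setI h pair_pairs_in // xD yD.
have [cn|ncn] := boolP [forall x in D, forall y in D, connect (adj F) x y].
  apply: (@connected_min_deg_false V col F D l) => //.
  by move=> x y xD yD; move/forall_inP: cn => /(_ x xD)/forall_inP/(_ y yD).
apply: (@disconnected_min_deg_false V col F D l) => //.
  have [l3|l3] := leqP 3 l; [by right|left].
  have l2 : l = 2 by flia.
  by move: cE; rewrite cF l2 /= mul1n; flia.
move=> cn; case/negP: ncn; apply/forall_inP => x xD; apply/forall_inP => y yD; exact: cn.
Qed.

End EvenCase.

(** * Numerical inequalities *)

Lemma bin2_sq n : 2 * 'C(n, 2) + n = n * n.
Proof. by case: n => // n; rewrite bin2_double; lia. Qed.

(** Doubling replaces binomials by squares and leaves the inequalities below to polynomial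
    arithmetic. *)
Lemma bin2_le n c f : 2 * c + n * n <= 2 * f + n -> 'C(n, 2) + c <= f.
Proof. by have := bin2_sq n; lia. Qed.

Lemma bin2_ge n c f : 'C(n, 2) + c <= f -> 2 * c + n * n <= 2 * f + n.
Proof. by have := bin2_sq n; lia. Qed.

(* The two lower bounds on [f] are linear in [u = n - k]; the product inequalities below eliminate [u]
   between the second one and the negated goal. *)
Lemma num_odd_disc l u t f : 1 <= t -> t + 2 <= l ->
  'C(2 * l - 1, 2) + 1 <= f -> 'C(l - 1, 2) + ((l - 1) * (l + 2 + u) + 1) <= f ->
  'C(2 * l - 1 - t, 2) + t * (u + t + 1) <= f.
Proof.
move=> t1 tl /bin2_ge A /bin2_ge B; apply: bin2_le.
have [r er] : exists r, l = t + 2 + r by exists (l - t - 2); lia.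
have [t' et] : exists t', t = t' + 1 by exists (t - 1); lia.
have e1 : 2 * l - 1 = 2 * t' + 5 + 2 * r by lia.
have e2 : l - 1 = t' + 2 + r by lia.
have e3 : 2 * l - 1 - t = t' + 4 + 2 * r by lia.
rewrite e3; rewrite e1 in A; rewrite e2 er et in B; rewrite et {e1 e2 e3 er et t1 tl l t}.
rewrite leqNgt; apply/negP => N.
have h1 := leq_mul (leqnn (t' + 1)) B; have h2 := leq_mul (leqnn (r + 1)) A.
have h3 := leq_mul (leqnn (t' + 2 + r)) N; move: h1 h2 h3; clear; nia.
Qed.

Lemma num_even_disc l u t f : 1 <= t -> t + 1 <= l ->
  'C(2 * l, 2) + 1 <= f -> 'C(l - 1, 2) + ((l - 1) * (l + 3 + u) + 2) <= f ->
  'C(2 * l - t, 2) + t * (u + t + 1) <= f.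
Proof.
move=> t1 tl /bin2_ge A /bin2_ge B; apply: bin2_le.
have [r er] : exists r, l = t + 1 + r by exists (l - t - 1); lia.
have [t' et] : exists t', t = t' + 1 by exists (t - 1); lia.
have e1 : 2 * l = 2 * t' + 4 + 2 * r by lia.
have e2 : l - 1 = t' + 1 + r by lia.
have e3 : 2 * l - t = t' + 3 + 2 * r by lia.
rewrite e3; rewrite e1 in A; rewrite e2 er et in B; rewrite et {e1 e2 e3 er et t1 tl l t}.
rewrite leqNgt; apply/negP => N.
have h1 := leq_mul (leqnn (t' + 1)) B; have h2 := leq_mul (leqnn r) A.
have h3 := leq_mul (leqnn (t' + 1 + r)) N; move: h1 h2 h3; clear; nia.
Qed.

Lemma num_odd_conn l u t f : 1 <= t -> t + 2 <= l ->
  'C(2 * l - 1, 2) + 1 <= f -> 'C(l - 1, 2) + ((l - 1) * (l + 2 + u) + 1) <= f ->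
  'C(2 * l - 1 - t, 2) + (t + 1) * (u + t + 2) <= f.
Proof.
move=> t1 tl /bin2_ge A /bin2_ge B; apply: bin2_le.
have [r er] : exists r, l = t + 2 + r by exists (l - t - 2); lia.
have [t' et] : exists t', t = t' + 1 by exists (t - 1); lia.
have e1 : 2 * l - 1 = 2 * t' + 5 + 2 * r by lia.
have e2 : l - 1 = t' + 2 + r by lia.
have e3 : 2 * l - 1 - t = t' + 4 + 2 * r by lia.
rewrite e3; rewrite e1 in A; rewrite e2 er et in B; rewrite et {e1 e2 e3 er et t1 tl l t}.
rewrite leqNgt; apply/negP => N.
have h1 := leq_mul (leqnn (t' + 2)) B; have h2 := leq_mul (leqnn r) A.
have h3 := leq_mul (leqnn (t' + 2 + r)) N; move: h1 h2 h3; clear; nia.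
Qed.

Lemma num_even_conn l u t f : 1 <= t -> t + 3 <= l ->
  'C(2 * l, 2) + 1 <= f -> 'C(l - 1, 2) + ((l - 1) * (l + 3 + u) + 2) <= f ->
  'C(2 * l - t, 2) + (t + 1) * (u + t + 2) <= f.
Proof.
move=> t1 tl /bin2_ge A /bin2_ge B; apply: bin2_le.
have [r er] : exists r, l = t + 3 + r by exists (l - t - 3); lia.
have [t' et] : exists t', t = t' + 1 by exists (t - 1); lia.
have e1 : 2 * l = 2 * t' + 8 + 2 * r by lia.
have e2 : l - 1 = t' + 3 + r by lia.
have e3 : 2 * l - t = t' + 7 + 2 * r by lia.
rewrite e3; rewrite e1 in A; rewrite e2 er et in B; rewrite et {e1 e2 e3 er et t1 tl l t}.
rewrite leqNgt; apply/negP => N.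
have h1 := leq_mul (leqnn (t' + 2)) B; have h2 := leq_mul (leqnn (r + 1)) A.
have h3 := leq_mul (leqnn (t' + 3 + r)) N; move: h1 h2 h3; clear; nia.
Qed.

(** For large [u] the bound of slope [l - 1] dominates; for small [u] a graph with more than [f]
    edges misses few enough pairs for [dense_set_bound]. *)
Lemma num_odd_clique l u f : 2 <= l ->
  'C(2 * l - 1, 2) + 1 <= f -> 'C(l - 1, 2) + ((l - 1) * (l + 2 + u) + 1) <= f ->
  'C(2 * l - 1, 2) + (u + 2) <= f \/ 'C(2 * l - 1, 2) + u + 9 <= f + (2 * l + 1).
Proof.
move=> l2 A B; have [h|h] := leqP (u + 7) (2 * l); first by right; lia.
left; apply: bin2_le; move/bin2_ge: B; clear A; have [m em] : exists m, l = m + 2 by exists (l - 2); lia.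
have e1 : 2 * l - 1 = 2 * m + 3 by lia. have e2 : l - 1 = m + 1 by lia.
rewrite e1 e2 em; rewrite em in h; clear e1 e2 em l l2.
case: m h => [|m] h; first by lia.
have [d ed] : exists d, u + 3 = 2 * m + 1 + d by exists (u + 3 - 2 * m - 1); lia.
have := leq_mul (leqnn (m.+1)) (eq_leq ed); nia.
Qed.

(** The first half serves the glued graph, the second the connected case, where [#|S| = 2 * l] and
    [#|S| > l + 2] force [l >= 3]. *)
Lemma num_even_clique l u f : 2 <= l ->
  'C(2 * l, 2) + 1 <= f -> 'C(l - 1, 2) + ((l - 1) * (l + 3 + u) + 2) <= f ->
  ('C(2 * l, 2) + (u + 1) <= f \/ 'C(2 * l, 2) + u + 8 <= f + (2 * l + 2)) /\
  (3 <= l -> 'C(2 * l, 2) + (u + 2) <= f \/ 'C(2 * l, 2) + u + 9 <= f + (2 * l + 2)).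
Proof.
move=> l2 A /bin2_ge B; have A2 := bin2_ge A; have sq := bin2_sq (2 * l); split.
  have [h|h] := leqP (u + 5) (2 * l); first by right; lia.
  left; apply: bin2_le; have [m em] : exists m, l = m + 2 by exists (l - 2); lia.
  have e2 : l - 1 = m + 1 by lia.
  move: B; rewrite e2 em; rewrite em in h; clear - h.
  have [d ed] : exists d, u = 2 * m + d by exists (u - 2 * m); lia.
  rewrite ed; clear; nia.
move=> l3; have [h|h] := leqP (u + 6) (2 * l); first by right; lia.
have [m em] : exists m, l = m + 3 by exists (l - 3); lia.
have [d ed] : exists d, u = 2 * m + 1 + d by exists (u - 2 * m - 1); lia.
have e2 : l - 1 = m + 2 by lia.
rewrite e2 em ed in B; rewrite em ed in sq A2 *; clear - B sq A2.
have [m0|m0] := posnP m.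
  rewrite m0 in B sq A2 *; have [d0|d0] := posnP d.
    by right; rewrite d0 in B *; move: ('C(2 * (0 + 3), 2)) sq => c; lia.
  by left; apply: bin2_le; lia.
left; apply: bin2_le; nia.
Qed.

Lemma bin2_shift N K : 0 < N -> N <= K -> 2 <= K -> 'C(N, 2) + (K - N) <= 'C(K, 2).
Proof.
move=> N0 NK K2; apply: bin2_le; have := bin2_sq K.
have [d ed] : exists d, K = N + d by exists (K - N); lia.
have [m em] : exists m, N = m + 1 by exists (N - 1); lia.
have -> : K - N = d by lia.
subst; case: d K2 {NK} => [|d] K2; first by nia.
case: m K2 {N0} => [|m] K2; last by nia.
by case: d K2 => // d _; nia.
Qed.

Lemma core_of_small_core (V : finType) (D S : {set V}) (E : {set {set V}}) l :
  #|S| <= l + 2 ->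
  (forall R : {set V}, R \subset D -> ~~ (R \subset S) -> exists2 x, x \in R :\: S & deg E R x < l.+1) ->
  core_bound D l E.
Proof.
move=> cS P1 R; have [m] := ubnP #|R|; elim: m R => // m IH R lt RD lR.
have [eR|nR] := eqVneq #|R| l.
  by apply: leq_trans (ein_le _ _) _; rewrite eR; flia.
have [RS|RS] := boolP (R \subset S); last first.
  have [x xR dx] := P1 R RD RS; move: xR; rewrite inE => /andP[_ xR].
  have cx := cardsD1 x R; rewrite xR in cx.
  have := IH (R :\ x) ltac:(flia) (subset_trans (subD1set _ _) RD) ltac:(flia).
  have := ein_rem E xR; have -> : #|R| - l = (#|R :\ x| - l).+1 by flia.
  by rewrite mulnS; flia.
have cR := subset_leq_card RS; apply: leq_trans (ein_le _ _) _.
have [e|e] : #|R| = l.+1 \/ #|R| = l.+2 by flia.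
  by rewrite e bin2S subSnn muln1; flia.
have -> : #|R| - l = 2 by flia.
by rewrite e !bin2S; flia.
Qed.

(** * The upper bound *)

Section Upper.
Variables (V : finType) (col : {set V} -> nat) (k l u f : nat).
Hypothesis no_rainbow_path : forall E : {set {set V}}, rainbow col E -> pathfree k E.
Hypothesis l_ge2 : 2 <= l.
Hypothesis V_card : #|V| = k + u.

Lemma degenerate_bound N e : 0 < e -> 2 * l + 1 <= k -> k - 1 <= N -> N < k + u ->
  'C(l - 1, 2) + ((l - 1) * (k + u - l + 1) + e) <= f ->
  'C(l - 1, 2) + (l - 1) * (N - (l - 1)) + (k + u - N - 1) <= f.
Proof.
move=> e0 lk kN Nn fB.
have e1 : k + u - l + 1 = (N - (l - 1)) + (k + u - N) by flia.
have : k + u - N <= (l - 1) * (k + u - N) by rewrite leq_pmull //; flia.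
by rewrite e1 mulnDr in fB; flia.
Qed.

(** Lowering [N] by one loses [k - 2 - s >= 1] and gains 1, so [N = k + u - 1] is the worst case. *)
Lemma core_reduce N s : k - 1 <= N -> N < k + u -> s + 3 <= k ->
  'C(s, 2) + (k - 2 - s) * (u + (k - 2 - s) + 1) <= f ->
  'C(s, 2) + (k - 2 - s) * (N - s) + (k + u - N - 1) <= f.
Proof.
move=> kN Nn sk; have -> : u + (k - 2 - s) + 1 = (N - s) + (k + u - N - 1) by flia.
have : k + u - N - 1 <= (k - 2 - s) * (k + u - N - 1) by rewrite leq_pmull //; flia.
by rewrite mulnDr; flia.
Qed.

Lemma small_reduce N : 0 < N -> N + 3 <= k -> 5 <= k -> 'C(k - 3, 2) + (u + 2) <= f ->
  'C(N, 2) + (k + u - N - 1) <= f.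
Proof.
move=> N0 Nk k5; have := @bin2_shift N (k - 3) N0 ltac:(flia) ltac:(flia); flia.
Qed.

(** For [#|S| = k - 2] Kopylov's theorem leaves at most [u + 2] edges outside [S]. With more than
    [f] edges in all, either this is already too few, or [S] is complete enough for
    [dense_set_bound]. *)
Lemma dense_finish (E : {set {set V}}) (S : {set V}) : rainbow col E -> #|S| + 2 = k ->
  #|E| <= ein E S + (u + 2) -> 'C(k - 2, 2) + 1 <= f ->
  'C(k - 2, 2) + (u + 2) <= f \/ 'C(k - 2, 2) + u + 9 <= f + k -> #|E| <= f.
Proof.
move=> rE sk eE fA alt; have eS : #|S| = k - 2 by flia.
have := ein_le E S; rewrite eS => eS2.
case: alt => h; first by flia.
case: (leqP #|E| f) => // lt.
have := @dense_set_bound V col k no_rainbow_path E S rE sk ltac:(rewrite V_card; flia).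
rewrite eS => h2; have : #|E| <= 'C(k - 2, 2) + 1 by apply: h2; flia.
flia.
Qed.

Theorem upper_odd E0 : full col E0 -> k = 2 * l + 1 -> 'C(2 * l - 1, 2) + 1 <= f ->
  'C(l - 1, 2) + ((l - 1) * (l + 2 + u) + 1) <= f -> #|E0| <= f.
Proof.
move=> fE0 ek fA fB; have [E [fE <- dich]] := suzuki_dichotomy fE0.
have k2 : k - 2 = 2 * l - 1 by flia.
have fB' : 'C(l - 1, 2) + ((l - 1) * (k + u - l + 1) + 1) <= f.
  by have -> : k + u - l + 1 = l + 2 + u by flia.
have clq := num_odd_clique l_ge2 fA fB; rewrite -k2 -ek in clq.
have fA' : 'C(k - 2, 2) + 1 <= f by rewrite k2.
have [rE _] := fullP _ _ fE; have [sE _] := rainbowP _ _ rE.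
case: dich => [cn|[F [FE cF cross]]]; last first.
  apply: (@disconnected_bound V col k l f no_rainbow_path _ l_ge2 _ _ _ _ _ fA' E F fE FE cF cross).
  - by flia.
  - by rewrite V_card leq_addr.
  - by move=> N kN; rewrite V_card => Nn; apply: (degenerate_bound (e := 1)) => //; flia.
  - move=> N s kN; rewrite V_card => Nn ls sk; apply: core_reduce => //.
    have := @num_odd_disc l u (k - 2 - s) f ltac:(flia) ltac:(flia) fA fB.
    by have -> : 2 * l - 1 - (k - 2 - s) = s by flia.
  - move=> N N0 Nk; rewrite V_card; apply: small_reduce => //; first by flia.
    have [l3|l3] := leqP 3 l.
      have := @num_odd_disc l u 1 f isT l3 fA fB.
      have -> : 2 * l - 1 - 1 = k - 3 by flia.
      by rewrite mul1n; flia.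
    (* [num_odd_disc] requires [t + 2 <= l], so [l = 2] is read off from the second bound
       directly. *)
    have l2 : l = 2 by flia.
    by move: fB; rewrite ek l2 /=; have -> : 'C(2, 2) = 1 by []; rewrite mul1n; flia.
  by rewrite V_card; case: clq => h; [left | right]; flia.
have kV : k <= #|[set: V]| by rewrite cardsT V_card; flia.
have pfE := no_rainbow_path rE.
have [S [SD P1 P2]] := @kopylov V E [set: V] k l pfE cn ltac:(flia) ltac:(flia) kV.
rewrite (ein_full sE) cardsT V_card in P2.
case: P2 => [S0|[lS Sk eS]].
  have := @ein_degenerate _ E [set: V] (l - 1) (l - 1) _ [set: V] (subxx _) ltac:(rewrite cardsT V_card; flia).
  rewrite (ein_full sE) cardsT V_card => h.
  have : #|E| <= 'C(l - 1, 2) + (l - 1) * (k + u - (l - 1)).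
    apply: h => R RD lR; have [|x] := P1 R RD.
      by rewrite S0 subset0 -card_gt0; flia.
    by rewrite inE => /andP[_ xR] dx; exists x => //; flia.
  have -> : k + u - (l - 1) = l + 2 + u by flia.
  flia.
have [Sk3|Sk3] := leqP (#|S| + 3) k.
  have := @num_odd_conn l u (k - 2 - #|S|) f ltac:(flia) ltac:(flia) fA fB.
  have -> : 2 * l - 1 - (k - 2 - #|S|) = #|S| by flia.
  have := ein_le E S.
  have <- : k - 1 - #|S| = k - 2 - #|S| + 1 by flia.
  have <- : k + u - #|S| = u + (k - 2 - #|S|) + 2 by flia.
  flia.
apply: (@dense_finish E S) => //; first by flia.
apply: leq_trans eS _; rewrite leq_add2l.
have -> : k - 1 - #|S| = 1 by flia.
by flia.
Qed.

Theorem upper_even E0 : full col E0 -> k = 2 * l + 2 -> 'C(2 * l, 2) + 1 <= f ->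
  'C(l - 1, 2) + ((l - 1) * (l + 3 + u) + 2) <= f -> #|E0| <= f.
Proof.
move=> fE0 ek fA fB; have [E [fE <- dich]] := suzuki_dichotomy fE0.
have k2 : k - 2 = 2 * l by flia.
have fB' : 'C(l - 1, 2) + ((l - 1) * (k + u - l + 1) + 2) <= f.
  by have -> : k + u - l + 1 = l + 3 + u by flia.
have [clq1 clq2] := num_even_clique l_ge2 fA fB; rewrite -ek -k2 in clq1 clq2.
have fA' : 'C(k - 2, 2) + 1 <= f by rewrite k2.
have [rE _] := fullP _ _ fE; have [sE _] := rainbowP _ _ rE.
case: dich => [cn|[F [FE cF cross]]]; last first.
  apply: (@disconnected_bound V col k l f no_rainbow_path _ l_ge2 _ _ _ _ _ fA' E F fE FE cF cross).
  - by flia.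
  - by rewrite V_card leq_addr.
  - by move=> N kN; rewrite V_card => Nn; apply: (degenerate_bound (e := 2)) => //; flia.
  - move=> N s kN; rewrite V_card => Nn ls sk; apply: core_reduce => //.
    have := @num_even_disc l u (k - 2 - s) f ltac:(flia) ltac:(flia) fA fB.
    by have -> : 2 * l - (k - 2 - s) = s by flia.
  - move=> N N0 Nk; rewrite V_card; apply: small_reduce => //; first by flia.
    have := @num_even_disc l u 1 f isT ltac:(flia) fA fB.
    have -> : 2 * l - 1 = k - 3 by flia.
    by rewrite mul1n; flia.
  by rewrite V_card; case: clq1 => h; [left | right]; flia.
have kV : k <= #|[set: V]| by rewrite cardsT V_card; flia.
have pfE := no_rainbow_path rE.
have [S [SD P1 P2]] := @kopylov V E [set: V] k l.+1 pfE cn ltac:(flia) ltac:(flia) kV.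
case: (leqP #|E| f) => // ltE.
have [cS|cS] := leqP #|S| (l + 2).
  exfalso; apply: (@core_bounded_false V col l _ l_ge2 [set: V] E) => //.
  - by move=> E1 rE1; rewrite -ek; apply: no_rainbow_path.
  - by rewrite -ek.
  - exact: core_of_small_core cS P1.
  rewrite (ein_full sE) cardsT V_card.
  by flia.
rewrite (ein_full sE) cardsT V_card in P2.
case: P2 => [S0|[lS Sk eS]]; first by rewrite S0 cards0 in cS; flia.
have [Sk3|Sk3] := leqP (#|S| + 3) k.
  have := @num_even_conn l u (k - 2 - #|S|) f ltac:(flia) ltac:(flia) fA fB.
  have -> : 2 * l - (k - 2 - #|S|) = #|S| by flia.
  have := ein_le E S.
  have <- : k - 1 - #|S| = k - 2 - #|S| + 1 by flia.
  have <- : k + u - #|S| = u + (k - 2 - #|S|) + 2 by flia.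
  flia.
suff h : #|E| <= f by move: (leq_ltn_trans h ltE); rewrite ltnn.
apply: (@dense_finish E S) => //; first by flia.
  apply: leq_trans eS _; rewrite leq_add2l.
  have -> : k - 1 - #|S| = 1 by flia.
  by flia.
by apply: clq2; flia.
Qed.

End Upper.

(** * Colourings *)

Section Coloring.
Variables (n : nat) (c : 'I_n -> 'I_n -> nat) (col : {set 'I_n} -> nat).
Hypothesis c_col : forall x y, x != y -> c x y = col [set x; y].

Lemma mem_colors_used i :
  reflect (exists2 e, e \in pairs_in [set: 'I_n] & col e = i) (i \in colors_used c).
Proof.
rewrite mem_undup; apply: (iffP flatten_mapP).
  case=> x _ /mapP[y]; rewrite mem_filter => /andP[nxy _] ->.
  by exists [set x; y]; rewrite ?pair_pairs_in ?inE // c_col.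
case=> e /pairs_inP[x [y [_ _ nxy ->]]] <-; exists x; first by rewrite mem_enum.
by rewrite -c_col //; apply/mapP; exists y; rewrite // mem_filter nxy mem_enum.
Qed.

Lemma num_colors_full (E : {set {set 'I_n}}) : full col E -> num_colors c = #|E|.
Proof.
move=> /fullP[/rainbowP[sE iE] hE].
have U : uniq [seq col e | e <- enum E].
  by rewrite map_inj_in_uniq ?enum_uniq // => e g; rewrite !mem_enum; apply: iE.
have : perm_eq (colors_used c) [seq col e | e <- enum E].
  apply: uniq_perm => //; first exact: undup_uniq.
  move=> i; apply/mem_colors_used/mapP => [[e eP <-]|[e]].
    by have [g gE ge] := hE e eP; exists g; rewrite ?mem_enum.
  by rewrite mem_enum => eE ->; exists e => //; apply: (subsetP sE).
by move/perm_size; rewrite size_map -cardE.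
Qed.

Lemma mem_path_colors (E : {set {set 'I_n}}) (s : seq 'I_n) i : sorted (adj E) s -> i \in path_colors c s ->
  exists x y, [/\ x \in s, y \in s, adj E x y & i = col [set x; y]].
Proof.
elim: s => [|x [|y s] IH] //= /andP[a ps]; rewrite inE => /orP[/eqP->|h].
  by exists x, y; rewrite !inE !eqxx orbT c_col // (adj_neq a).
have [x' [y' [xs ys a' ->]]] := IH ps h; exists x', y'.
by rewrite in_cons xs orbT in_cons ys orbT.
Qed.

Lemma rainbow_pathfree k (E : {set {set 'I_n}}) : ~ has_rainbow_path k c -> rainbow col E -> pathfree k E.
Proof.
move=> no /rainbowP[sE iE]; apply/negPn/negP; rewrite negb_forall => /existsP[t].
rewrite negbK => /andP[ut st]; apply: no; exists (tval t); split=> //; first by rewrite size_tuple.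
elim: (tval t) ut st => [|x [|y s] IH] // /andP[xs us] /= /andP[a ps].
rewrite (IH us ps) andbT; apply/negP => h.
have [x' [y' [x's y's a' e]]] := @mem_path_colors E (y :: s) _ ps h.
move: e; rewrite c_col ?(adj_neq a) // => e.
have : [set x; y] = [set x'; y'] by apply: iE => //; [case/andP: a | case/andP: a'].
move/setP/(_ x); rewrite !inE eqxx /= => /esym/orP[]/eqP ex; move: xs; rewrite ex ?x's ?y's //.
Qed.

Lemma full_exists : exists E, full col E.
Proof.
have r0 : rainbow col set0 by apply/rainbowP; split; [apply: sub0set | move=> e g; rewrite inE].
have [E /maxsetP[rE mE] _] := @maxset_exists _ (rainbow col) _ r0.
exists E; apply/fullP; split=> // e eP.
have [/exists_inP[g gE /eqP ge]|no] := boolP [exists g in E, col g == col e]; first by exists g.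
exists e => //; have := mE (e |: E) _ (subsetUr _ _) => <-; first by rewrite in_setU1 eqxx.
apply: rainbow_add => // g gE ge; case/negP: no; apply/exists_inP.
by exists g; rewrite ?ge.
Qed.

(** The edges of a rainbow path that are not [good] have distinct colours from [L], so at most
    [size L] of its [k - 1] edges are of this kind. *)
Lemma few_special_edges k (good : rel 'I_n) (L : seq nat) (s : seq 'I_n) :
  size s = k -> uniq s -> uniq (path_colors c s) ->
  (forall x y, x != y -> ~~ good x y -> c x y \in L) ->
  k <= count (fun e => good e.1 e.2) (zip s (behead s)) + size L + 1.
Proof.
move=> sz us uc hL; set z := zip s (behead s).
have zs : size z = k - 1 by rewrite size_zip size_behead sz; lia.
have zn e : e \in z -> e.1 != e.2.
  rewrite /z; elim: (s) us e => [|x [|y s'] IH] //= /andP[xs us'] e; rewrite inE => /orP[/eqP->|h] /=.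
    by apply: contraNneq xs => ->; rewrite inE eqxx.
  exact: IH.
have := count_predC (fun e => good e.1 e.2) z; rewrite zs.
suff : count (predC (fun e => good e.1 e.2)) z <= size L by lia.
rewrite -size_filter -(size_map (fun e => c e.1 e.2)); apply: uniq_leq_size.
  apply: subseq_uniq uc; apply: map_subseq; exact: filter_subseq.
move=> i /mapP[e]; rewrite mem_filter => /andP[/= ng ez] ->; apply: hL => //; exact: zn.
Qed.

End Coloring.

(** The summand [has S s] records that a path meeting [S] has fewer edges inside [S] than vertices
    in [S]. *)
Lemma count_inside_edges (T : eqType) (S : pred T) (s : seq T) :
  count (fun e => S e.1 && S e.2) (zip s (behead s)) + has S s <= count S s.
Proof.
elim: s => [|x [|y s] IH] //=; first by case: (S x).
move: IH => /=; case: (S x); case: (S y) => /=; lia.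
Qed.

Lemma count_touching_edges (T : eqType) (S : pred T) (s : seq T) :
  count (fun e => S e.1 || S e.2) (zip s (behead s)) <= 2 * count S s.
Proof.
(* Strengthened for the induction: a first vertex in [S] is an end of one edge only. *)
suff h : count (fun e => S e.1 || S e.2) (zip s (behead s)) + head false (map S s) <= 2 * count S s by lia.
elim: s => [|x [|y s] IH] //=; first by case: (S x).
move: IH => /=; case: (S x); case: (S y) => /=; lia.
Qed.

Lemma bin2_split n q p : q <= n -> 'C(n - q, 2) + p = 'C(n, 2) -> p = 'C(q, 2) + q * (n - q).
Proof.
move=> qn; have [m ->] : exists m, n = m + q by exists (n - q); lia.
rewrite addnK; have := bin2_sq q; have := bin2_sq m; have := bin2_sq (m + q).
by rewrite mulnDl !mulnDr; lia.
Qed.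

(** * The two extremal colourings *)

Section Lower.
Variables (n k : nat).
Hypothesis k_ge5 : 5 <= k.
Hypothesis k_le_n : k <= n.
Implicit Types (X S : {set 'I_n}).

Lemma pair_neq0 (x y : 'I_n) : ([set x; y] == set0) = false.
Proof. by apply/negbTE/set0Pn; exists x; rewrite !inE eqxx. Qed.

Lemma exists_set m : m <= n -> exists S, #|S| = m.
Proof.
move=> mn; have [|S _ cS] := @subset_card_exists _ [set: 'I_n] m; last by exists S.
by rewrite cardsT card_ord.
Qed.

Lemma count_set_le S (s : seq 'I_n) : uniq s -> count (mem S) s <= #|S|.
Proof.
move=> us; rewrite -size_filter; have /card_uniqP <- : uniq (filter (mem S) s) by rewrite filter_uniq.
by apply: subset_leq_card; apply/subsetP => x; rewrite mem_filter => /andP[].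
Qed.

(** Pairs in [P] get private colours from 2 on, [e1] outside [P] gets 1 and the rest 0. With
    [e1 = set0], which is no pair, the colour 1 does not occur. *)
Definition special (P : {set {set 'I_n}}) (e1 e : {set 'I_n}) : nat :=
  if e \in P then (enum_rank e).+2 else if e == e1 then 1 else 0.

Lemma special_inj (P : {set {set 'I_n}}) (e1 e g : {set 'I_n}) : e \in P -> special P e1 e = special P e1 g -> e = g.
Proof.
rewrite /special => eP; rewrite eP; case: (g \in P); last by case: (g == e1).
by case=> /ord_inj/enum_rank_inj.
Qed.

(** A path has at most [k - 3] edges inside the [k - 2] vertices of [S], and all other pairs
    together contribute one colour, whereas a path on [k] vertices has [k - 1] edges. *)
Lemma lower_clique : exists c : 'I_n -> 'I_n -> nat,
  [/\ edge_coloring c, ~ has_rainbow_path k c & num_colors c = 'C(k - 2, 2) + 1].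
Proof.
have [S cS] := @exists_set (k - 2) ltac:(flia).
pose P := pairs_in S; pose col := special P set0; pose c x y := col [set x; y].
exists c; split.
- by move=> x y; rewrite /c setUC.
- case=> s [sz us uc].
  have hL x y : x != y -> ~~ ((x \in S) && (y \in S)) -> c x y \in [:: 0].
    move=> nxy ng; rewrite /c /col /special /P pair_pairs_in // (negPf ng) inE.
    by rewrite pair_neq0.
  have := few_special_edges sz us uc hL; have := count_inside_edges (mem S) s.
  have := count_set_le S us; rewrite cS has_count /=; case: (count (mem S) s) => [|m] /=; flia.
have : 1 < #|~: S| by have := cardsC S; rewrite card_ord cS; flia.
case/card_gt1P => w [w' []]; rewrite !inE => wS w'S nww.
have nP : [set w; w'] \notin P by rewrite pair_pairs_in // (negPf wS).
have e0 x y : x != y -> [set x; y] \notin P -> col [set x; y] = 0.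
  move=> nxy ng; rewrite /col /special (negPf ng).
  by rewrite pair_neq0.
have fE : full col ([set w; w'] |: P).
  apply/fullP; split.
    apply/rainbowP; split.
      by rewrite subUset sub1set pair_pairs_in ?inE // pairs_inS ?subsetT.
    move=> e g; rewrite !in_setU1 => /orP[/eqP->|eP] /orP[/eqP->|gP] //.
    - by move=> h; apply/esym; apply: (special_inj gP (esym h)).
    - exact: special_inj.
    exact: special_inj.
  move=> e /pairs_inP[x [y [_ _ nxy ->]]].
  have [inP|ninP] := boolP ([set x; y] \in P); first by exists [set x; y]; rewrite ?in_setU1 ?inP ?orbT.
  by exists [set w; w']; rewrite ?in_setU1 ?eqxx // !e0.
rewrite (num_colors_full (col := col) _ fE) // cardsU1 nP card_pairs_in cS addnC //.
Qed.

(** The [l - 1] vertices of [T] are ends of at most [2 * (l - 1)] edges of a path, and the pairs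
    avoiding [T] have [eps] colours; together these give at most [k - 2] edges of a rainbow path. *)
Lemma lower_join l eps : 2 <= l -> k = 2 * l + eps -> (eps == 1) || (eps == 2) ->
  exists c : 'I_n -> 'I_n -> nat,
  [/\ edge_coloring c, ~ has_rainbow_path k c &
      num_colors c = 'C(l - 1, 2) + (l - 1) * (n - l + 1) + eps].
Proof.
move=> l2 ek ee; have [T cT] := @exists_set (l - 1) ltac:(flia).
pose P := pairs_in [set: 'I_n] :\: pairs_in (~: T).
have cC : #|~: T| = n - (l - 1) by have := cardsC T; rewrite card_ord cT; flia.
have : 2 < #|~: T| by rewrite cC; flia.
case/card_gt2P => a [b [d [[aT bT dT] [nab nbd nda]]]].
pose e1 := [set a; b]; pose e2 := [set b; d].
pose col := special P (if eps == 2 then e1 else set0); pose c x y := col [set x; y].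
have inP x y : x != y -> ([set x; y] \in P) = (x \in T) || (y \in T).
  by move=> nxy; rewrite in_setD !pair_pairs_in // !inE /= andbT negb_and !negbK.
exists c; split.
- by move=> x y; rewrite /c setUC.
- case=> s [sz us uc].
  pose L := if eps == 2 then [:: 0; 1] else [:: 0].
  have hL x y : x != y -> ~~ ((x \in T) || (y \in T)) -> c x y \in L.
    move=> nxy ng; rewrite /c /col /special inP // (negPf ng) /L.
    case: (eps == 2); first by case: (_ == _); rewrite !inE.
    by rewrite pair_neq0.
  have sL : size L = eps by rewrite /L; case/orP: ee => /eqP ->.
  have := few_special_edges sz us uc hL; have := count_touching_edges (mem T) s.
  have := count_set_le T us; rewrite cT sL /=; flia.
have e1P : e1 \notin P by rewrite inP //; move: aT bT; rewrite !inE => /negPf-> /negPf->.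
have e2P : e2 \notin P by rewrite inP //; move: dT bT; rewrite !inE => /negPf-> /negPf->.
have e12 : e1 != e2.
  by rewrite /e1 setUC; apply: set2_neq; rewrite eq_sym.
have e20 : e2 != set0 by apply/set0Pn; exists b; rewrite !inE eqxx.
have cP : #|P| = 'C(l - 1, 2) + (l - 1) * (n - l + 1).
  have := cardsID (pairs_in (~: T)) (pairs_in [set: 'I_n]).
  rewrite (setIidPr (pairs_inS (subsetT _))) !card_pairs_in cC cardsT card_ord -/P => h.
  have ln : l - 1 <= n by flia.
  have -> : n - l + 1 = n - (l - 1) by flia.
  exact: bin2_split ln h.
(* Representatives of the colours on pairs avoiding [T]: [e2] for 0 and, when [eps] is 2, [e1] for
   1. *)
pose X := if eps == 2 then [set e1; e2] else [set e2].
have cX : #|X| = eps.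
  by rewrite /X; case/orP: ee => /eqP -> /=; rewrite ?cards1 // cards2 e12.
have XE e : e \in X -> e = e1 \/ e = e2.
  by rewrite /X; case: (eps == 2); rewrite !inE; [case/orP => /eqP; [left | right] | move/eqP; right].
have XP e : e \in X -> e \notin P.
  by case/XE => ->.
have Xpair e : e \in X -> e \in pairs_in [set: 'I_n].
  by case/XE => ->; rewrite pair_pairs_in // !inE.
have fE : full col (X :|: P).
  apply/fullP; split.
    apply/rainbowP; split.
      by rewrite subUset subsetDl andbT; apply/subsetP.
    move=> e g; rewrite !in_setU => /orP[eX|eP] /orP[gX|gP] //.
    - have := XP _ eX; have := XP _ gX; move: eX gX.
      rewrite /col /special /X => + + /negPf-> /negPf->.
      case: (eps == 2); rewrite !inE; last by move=> /eqP-> /eqP->.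
      by move=> /orP[]/eqP-> /orP[]/eqP->; rewrite ?eqxx // ?(negPf e12) // eq_sym (negPf e12).
    - by move=> h; apply/esym; apply: (special_inj gP (esym h)).
    - exact: special_inj.
    exact: special_inj.
  move=> e eA; have [eP|eP] := boolP (e \in P); first by exists e; rewrite // in_setU eP orbT.
  rewrite /col /special (negPf eP).
  have [ee1|ne1] := eqVneq e (if eps == 2 then e1 else set0).
    case e2e : (eps == 2) in ee1 *; last by move: eA; rewrite ee1 inE cards0 andbF.
    by exists e1; rewrite ?(negPf e1P) ?eqxx // in_setU /X e2e !inE eqxx.
  exists e2; first by rewrite in_setU /X; case: (eps == 2); rewrite !inE eqxx ?orbT.
  by rewrite (negPf e2P); case: (eps == 2); rewrite ?(negPf e20) // eq_sym (negPf e12).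
rewrite (num_colors_full (col := col) _ fE) // cardsU cX cP.
have -> : X :&: P = set0.
  by apply/setP => e; rewrite in_setI in_set0; apply/negP => /andP[/XP/negPf->].
by rewrite cards0 subn0 addnC.
Qed.

End Lower.

(** The colouring as a function on sets, the form used by [rainbow]. The elements are taken in the
    order of [enum], which is harmless for symmetric [c]; sets with fewer than two elements get the
    default 0. *)
Definition pair_color n (c : 'I_n -> 'I_n -> nat) (e : {set 'I_n}) :=
  if enum e is x :: y :: _ then c x y else 0.

Lemma pair_colorE n (c : 'I_n -> 'I_n -> nat) x y : edge_coloring c -> x != y ->
  c x y = pair_color c [set x; y].
Proof.
move=> cs nxy; rewrite /pair_color.
have : perm_eq (enum [set x; y]) [:: x; y].
  by apply: uniq_perm; rewrite ?enum_uniq //= ?inE ?nxy // => z; rewrite mem_enum !inE.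
move=> h; have sz := perm_size h; case: (enum _) h sz => [|a [|b [|z r]]] //= h _.
have := perm_mem h a; have := perm_mem h b; have := perm_uniq h; rewrite /= !inE nxy /= andbT !eqxx orbT.
by move=> nab /esym/orP[]/eqP eb /esym/orP[]/eqP ea; move: nab; rewrite ea eb ?eqxx.
Qed.

Theorem theorem1 (n k : nat) (hk : 5 <= k) (hkn : k <= n) :
  let l := (k - 1) %/ 2 in
  let eps := if odd k then 1 else 2 in
  is_AR_path n k
    (maxn ('C(k - 2, 2) + 1) ('C(l - 1, 2) + (l - 1) * (n - l + 1) + eps)).
Proof.
move=> l eps.
have ek : k = 2 * l + eps.
  rewrite /l /eps; have := odd_double_half k; case: (odd k); rewrite -muln2; flia.
have l2 : 2 <= l by move: ek; rewrite /eps; case: (odd k); flia.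
have ee : (eps == 1) || (eps == 2) by rewrite /eps; case: (odd k).
clearbody l eps; set A := 'C(k - 2, 2) + 1; set B := 'C(l - 1, 2) + _ + eps.
split.
  have [le|lt] := leqP A B.
    have [c [cs nr nc]] := lower_join hk hkn l2 ek ee.
    by exists c; split=> //; rewrite nc (maxn_idPr le).
  have [c [cs nr nc]] := lower_clique hk hkn.
  by exists c; split=> //; rewrite nc (maxn_idPl (ltnW lt)).
move=> c cs nr; set f := maxn A B.
have cc := pair_colorE cs.
have [E fE] := full_exists (pair_color c).
rewrite (num_colors_full cc fE).
have no E' := @rainbow_pathfree n c (pair_color c) cc k E' nr.
have [u eu] : exists u, n = k + u by exists (n - k); flia.
have cV : #|'I_n| = k + u by rewrite card_ord.
have fA : A <= f by apply: leq_maxl. have fB : B <= f by apply: leq_maxr.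
have e1 : n - l + 1 = l + 1 + eps + u by flia.
rewrite /B e1 -addnA in fB.
case/orP: ee => /eqP e; rewrite e in ek fB.
  apply: (@upper_odd _ (pair_color c) k l u f no l2 cV E fE ek).
    by move: fA; rewrite /A ek; have -> : 2 * l + 1 - 2 = 2 * l - 1 by flia.
  by move: fB; have -> : l + 1 + 1 + u = l + 2 + u by flia.
apply: (@upper_even _ (pair_color c) k l u f no l2 cV E fE ek).
  by move: fA; rewrite /A ek; have -> : 2 * l + 2 - 2 = 2 * l by flia.
by move: fB; have -> : l + 1 + 2 + u = l + 3 + u by flia.
Qed.
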